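(* Let $\beta>0$ and assume the following. (1) $G:\mathbb{R}\to[0,+\infty)$ is locally Lipschitz continuous and $\lim_{p\to\pm\infty}G(p)=+\infty$. (2) $G(0)=0$, $G_1:=G|_{(-\infty,0]}$ is strictly decreasing and $G_2:=G|_{[0,+\infty)}$ is strictly increasing. (3) $a:\mathbb{R}\times\Omega\to(0,1]$ and $V:\mathbb{R}\times\Omega\to[0,1]$ are stationary, i.e. $a(x,\omega)=a(0,\tau_x\omega)$ and $V(x,\omega)=V(0,\tau_x\omega)$ for every $(x,\omega)$. (4) $\inf_{x\in\mathbb{R}}V(x,\omega)=0$ and $\sup_{x\in\mathbb{R}}V(x,\omega)=1$ for $\mathbb{P}$-a.e. $\omega$. (5) $\sqrt{a(\cdot,\omega)}$ is Lipschitz continuous on $\mathbb{R}$ and $V(\cdot,\omega)$ is uniformly continuous on $\mathbb{R}$ for every $\omega\in\Omega$. (6) (Scaled hill condition) For every $h\in(0,1)$, $C>0$ and $\mathbb{P}$-a.e. $\omega$, there is an interval $[L_1,L_2]$ such that $\int_{L_1}^{L_2}\frac{dy}{a(y,\omega)}\ge C$ and $V(\cdot,\omega)\ge h$ on $[L_1,L_2]$. (7) For every $\omega\in\Omega$, the Cauchy problem for $$\partial_tu=a(x,\omega)\partial^2_{xx}u+G(\partial_xu)+\beta V(x,\omega),\quad(t,x)\in(0,+\infty)\times\mathbb{R},$$ is well-posed in $\mathrm{UC}([0,+\infty)\times\mathbb{R})$ (see context). (8) For every $\omega\in\Omega$ and $\theta\in\mathbb{R}$, the unique viscosity solution $u_\theta(\cdot,\cdot,\omega)\in\mathrm{UC}([0,+\infty)\times\mathbb{R})$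 of the equation in (7) with $u_\theta(0,x,\omega)=\theta x$ for all $x\in\mathbb{R}$ satisfies, for some $\ell_\theta=\ell_\theta(\omega)>0$, $|u_\theta(t,x,\omega)-u_\theta(t,y,\omega)|\le\ell_\theta|x-y|$ for all $t\in[0,+\infty)$ and $x,y\in\mathbb{R}$. With $\theta_1,\theta_2$ as defined in the context, let $\overline H:\mathbb{R}\to\mathbb{R}$ be given by $\overline H(\theta)=\theta_1^{-1}(\theta)$ for $\theta\le\theta_1(\beta)$, $\overline H(\theta)=\beta$ for $\theta\in(\theta_1(\beta),\theta_2(\beta))$, and $\overline H(\theta)=\theta_2^{-1}(\theta)$ for $\theta\ge\theta_2(\beta)$. Then there exists $\Omega_0\in\mathcal{F}$ with $\mathbb{P}(\Omega_0)=1$ such that, for every $\omega\in\Omega_0$ and $g\in\mathrm{UC}(\mathbb{R})$, as $\epsilon\to0$, the unique viscosity solution $u_g^\epsilon(\cdot,\cdot,\omega)\in\mathrm{UC}([0,+\infty)\times\mathbb{R})$ of $$\partial_tu^\epsilon=\epsilon\, a\!\left(\tfrac x\epsilon,\omega\right)\partial^2_{xx}u^\epsilon+G(\partial_xu^\epsilon)+\beta V\!\left(\tfrac x\epsilon,\omega\right),\quad(t,x)\in(0,+\infty)\times\mathbb{R},$$ with initial condition $u_g^\epsilon(0,\cdot,\omega)=g$ converges locally uniformly on $[0,+\infty)\times\mathbb{R}$ to the unique viscosity solution $\overline u_g\in\mathrm{UC}([0,+\infty)\times\mathbb{R})$ of $$\partial_t\overline u=\overline H(\partial_x\overline u),\quad(t,x)\in(0,+\infty)\times\mathbb{R},$$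 with the same initial condition.
   Context: $(\Omega,\mathcal{F},\mathbb{P})$ is a probability space equipped with a group of measure-preserving transformations $\tau_x:\Omega\to\Omega$, $x\in\mathbb{R}$ (so $\tau_0=\mathrm{id}$, $\tau_{x+y}=\tau_x\circ\tau_y$), such that $(x,\omega)\mapsto\tau_x\omega$ is measurable, and $\mathbb{P}$ is ergodic: $\mathbb{P}(A)\in\{0,1\}$ whenever $A\in\mathcal{F}$ satisfies $\tau_xA=A$ for all $x\in\mathbb{R}$. $\mathbb{E}$ is expectation under $\mathbb{P}$. The functions $a(0,\cdot)$ and $V(0,\cdot)$ are measurable. $\mathrm{UC}(X)$ is the space of uniformly continuous real-valued functions on $X$. $G_1^{-1}:[0,+\infty)\to(-\infty,0]$ and $G_2^{-1}:[0,+\infty)\to[0,+\infty)$ denote the inverses of $G_1$ and $G_2$. Viscosity solutions: for an equation $\partial_tu=A(x)\partial^2_{xx}u+H(\partial_xu)+W(x)$ on $(0,+\infty)\times\mathbb{R}$ with $A\ge0$, a continuous function $v$ is a viscosity subsolution (resp. supersolution) if for every $(t_0,x_0)$ and $\varphi\in C^2((0,+\infty)\times\mathbb{R})$ such that $v-\varphi$ attains a local maximum (resp. minimum) at $(t_0,x_0)$, one has $\partial_t\varphi\le$ (resp. $\ge$) $A(x_0)\partial^2_{xx}\varphi+H(\partial_x\varphi)+W(x_0)$ at $(t_0,x_0)$; a viscosity solution is both. Well-posedness: the Cauchy problem for such an equation is well-posed in $\mathrm{UC}([0,+\infty)\times\mathbb{R})$ if (i) for every $g\in\mathrm{UC}(\mathbb{R})$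 there is a viscosity solution $u\in\mathrm{UC}([0,+\infty)\times\mathbb{R})$ with $u(0,\cdot)=g$; and (ii) any two viscosity solutions $u_1,u_2\in\mathrm{UC}([0,+\infty)\times\mathbb{R})$ satisfy $\sup_{[0,+\infty)\times\mathbb{R}}|u_1-u_2|=\sup_{x\in\mathbb{R}}|u_1(0,x)-u_2(0,x)|$. By scaling ($u\mapsto\epsilon u(t/\epsilon,x/\epsilon)$), (7) implies well-posedness for the $\epsilon$-equation for every $\epsilon>0$. Functions $\theta_1,\theta_2$: under (1)–(4) and continuity of $a(\cdot,\omega),V(\cdot,\omega)$, for every $\lambda\ge\beta$ and $\omega\in\Omega$ the equation $a(x,\omega)F''+G(F')+\beta V(x,\omega)=\lambda$, $x\in\mathbb{R}$, has a unique solution $F_1^\lambda(\cdot,\omega)\in C^2(\mathbb{R})$ with $F_1^\lambda(0,\omega)=0$ and $(F_1^\lambda)'(x,\omega)\in[G_1^{-1}(\lambda),G_1^{-1}(\lambda-\beta)]$ for all $x$, and a unique solution $F_2^\lambda(\cdot,\omega)\in C^2(\mathbb{R})$ with $F_2^\lambda(0,\omega)=0$ and $(F_2^\lambda)'(x,\omega)\in[G_2^{-1}(\lambda-\beta),G_2^{-1}(\lambda)]$ for all $x$; the derivatives $(F_i^\lambda)'$ are stationary. Set $\theta_i(\lambda):=\mathbb{E}[(F_i^\lambda)'(0,\omega)]$, $i\in\{1,2\}$. Then $\theta_1:[\beta,+\infty)\to(-\infty,\theta_1(\beta)]$ and $\theta_2:[\beta,+\infty)\to[\theta_2(\beta),+\infty)$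 are continuous bijections, decreasing and increasing respectively, with locally Lipschitz inverses, and $\theta_1(\beta)<0<\theta_2(\beta)$. *)

(* Defs.v *)
From HB Require Import structures.
From mathcomp Require Import all_boot all_order all_algebra.
From mathcomp Require Import all_classical all_reals all_analysis.
Set Implicit Arguments.
Unset Strict Implicit.
Unset Printing Implicit Defensive.
Import Order.TTheory GRing.Theory Num.Theory.
Import numFieldNormedType.Exports.
Local Open Scope classical_set_scope.
Local Open Scope ring_scope.

Definition measure_preserving_group (R : realType) (d : measure_display)
    (Omega : measurableType d) (P : probability Omega R)
    (tau : R -> Omega -> Omega) : Prop :=
  [/\ tau 0 = id,
      forall x y, tau (x + y) = tau x \o tau y,
      measurable_fun setT
        (fun z : measurableTypeR R * Omega => tau z.1 z.2) &
      forall x (A : set Omega), measurable A -> P (tau x @^-1` A) = P A].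

Definition ergodic (R : realType) (d : measure_display)
    (Omega : measurableType d) (P : probability Omega R)
    (tau : R -> Omega -> Omega) : Prop :=
  forall A : set Omega, measurable A -> (forall x, tau x @` A = A) ->
    P A = 0%E \/ P A = 1%E.

Definition stationary (R : realType) (Omega : Type)
    (tau : R -> Omega -> Omega) (f : R -> Omega -> R) : Prop :=
  forall x w, f x w = f 0 (tau x w).

Definition locally_lipschitz (R : realType) (f : R -> R) : Prop :=
  forall p : R, exists2 U : set R, nbhs p U & [lipschitz f q | q in U].

(** A function of (t, x) is represented by a total function on [R * R]; only
    its values on [spacetime], where t >= 0, are relevant. *)

Definition spacetime (R : realType) : set (R * R) := [set z | 0 <= z.1].
Definition spacetime_pos (R : realType) : set (R * R) := [set z | 0 < z.1].

Definition dt (R : realType) (f : R * R -> R) : R * R -> R :=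
  fun z => 'D_((1, 0) : R * R) f z.
Definition dx (R : realType) (f : R * R -> R) : R * R -> R :=
  fun z => 'D_((0, 1) : R * R) f z.

(** [D] is meant to be open: C^n is expressed through iterated partial
    derivatives. *)
Fixpoint Cn (R : realType) (n : nat) (D : set (R * R)) (f : R * R -> R) :
    Prop :=
  (forall z, D z -> {for z, continuous f}) /\
  if n is m.+1 then
    [/\ forall z, D z ->
          derivable f z ((1, 0) : R * R) /\ derivable f z ((0, 1) : R * R),
        Cn m D (dt f) & Cn m D (dx f)]
  else True.

(** The equation is
      dt u = A(x) dxx u + H(dx u) + W(x)   on (0, +oo) x R. *)

Definition equation_rhs (R : realType) (A H W : R -> R) (phi : R * R -> R)
    (z : R * R) : R :=
  A z.2 * dx (dx phi) z + H (dx phi z) + W z.2.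

Definition viscosity_subsolution (R : realType) (A H W : R -> R)
    (v : R * R -> R) : Prop :=
  (forall z, spacetime_pos z -> {for z, continuous v}) /\
  forall (z0 : R * R) (phi : R * R -> R),
    spacetime_pos z0 -> Cn 2 (@spacetime_pos R) phi ->
    (\forall z \near z0, v z - phi z <= v z0 - phi z0) ->
    dt phi z0 <= equation_rhs A H W phi z0.

Definition viscosity_supersolution (R : realType) (A H W : R -> R)
    (v : R * R -> R) : Prop :=
  (forall z, spacetime_pos z -> {for z, continuous v}) /\
  forall (z0 : R * R) (phi : R * R -> R),
    spacetime_pos z0 -> Cn 2 (@spacetime_pos R) phi ->
    (\forall z \near z0, v z0 - phi z0 <= v z - phi z) ->
    equation_rhs A H W phi z0 <= dt phi z0.

Definition viscosity_solution (R : realType) (A H W : R -> R)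
    (v : R * R -> R) : Prop :=
  viscosity_subsolution A H W v /\ viscosity_supersolution A H W v.

(** The entourages of [subspace spacetime] only constrain pairs of points of
    [spacetime]: this is uniform continuity on [0, +oo) x R, whatever the
    values at negative times. *)
Definition UC_spacetime (R : realType) (u : R * R -> R) : Prop :=
  unif_continuous (u : subspace (@spacetime R) -> R).

Definition UC_viscosity_solution (R : realType) (A H W : R -> R)
    (u : R * R -> R) : Prop :=
  UC_spacetime u /\ viscosity_solution A H W u.

Definition cauchy_solution (R : realType) (A H W g : R -> R)
    (u : R * R -> R) : Prop :=
  UC_viscosity_solution A H W u /\ forall x, u (0, x) = g x.

Definition unique_cauchy_solution (R : realType) (A H W g : R -> R)
    (u : R * R -> R) : Prop :=
  cauchy_solution A H W g u /\
  forall v, cauchy_solution A H W g v ->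
    forall z, spacetime z -> v z = u z.

(** Both suprema may be +oo. *)
Definition well_posed (R : realType) (A H W : R -> R) : Prop :=
  (forall g : R -> R, unif_continuous g ->
     exists u, cauchy_solution A H W g u) /\
  (forall u1 u2 : R * R -> R,
     UC_viscosity_solution A H W u1 -> UC_viscosity_solution A H W u2 ->
     ereal_sup [set (`|u1 z - u2 z|)%:E | z in @spacetime R] =
     ereal_sup [set (`|u1 (0, x) - u2 (0, x)|)%:E | x in [set: R]]).

(** [pinv_ d B f] is the inverse of the restriction of f to B, with values [d]
    outside the image of B. *)
Definition G1inv (R : realType) (G : R -> R) : R -> R :=
  'pinv_(fun=> 0) [set p : R | p <= 0] G.
Definition G2inv (R : realType) (G : R -> R) : R -> R :=
  'pinv_(fun=> 0) [set p : R | 0 <= p] G.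

Definition corrector (R : realType) (A G W : R -> R) (lam p q : R)
    (F : R -> R) : Prop :=
  [/\ [/\ forall x, derivable F x 1,
          forall x, derivable (derive1 F) x 1 &
          continuous (derive1n 2 F)],
      forall x, A x * derive1n 2 F x + G (derive1 F x) + W x = lam,
      F 0 = 0 &
      forall x, p <= derive1 F x <= q].

(** F_1^lambda and F_2^lambda exist and are unique for lambda >= beta under
    the standing assumptions; [xget] selects them. *)
Definition F1 (R : realType) (Omega : Type) (G : R -> R)
    (a V : R -> Omega -> R) (beta lam : R) (w : Omega) : R -> R :=
  xget (fun=> 0)
    [set F | corrector (a ^~ w) G (fun x => beta * V x w) lam
               (G1inv G lam) (G1inv G (lam - beta)) F].
Definition F2 (R : realType) (Omega : Type) (G : R -> R)
    (a V : R -> Omega -> R) (beta lam : R) (w : Omega) : R -> R :=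
  xget (fun=> 0)
    [set F | corrector (a ^~ w) G (fun x => beta * V x w) lam
               (G2inv G (lam - beta)) (G2inv G lam) F].

Definition theta1 (R : realType) (d : measure_display)
    (Omega : measurableType d) (P : probability Omega R) (G : R -> R)
    (a V : R -> Omega -> R) (beta lam : R) : R :=
  fine ('E_P[fun w => derive1 (F1 G a V beta lam w) 0])%E.
Definition theta2 (R : realType) (d : measure_display)
    (Omega : measurableType d) (P : probability Omega R) (G : R -> R)
    (a V : R -> Omega -> R) (beta lam : R) : R :=
  fine ('E_P[fun w => derive1 (F2 G a V beta lam w) 0])%E.

Definition Hbar (R : realType) (d : measure_display)
    (Omega : measurableType d) (P : probability Omega R) (G : R -> R)
    (a V : R -> Omega -> R) (beta theta : R) : R :=
  if theta <= theta1 P G a V beta beta then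
    'pinv_(fun=> 0) [set lam : R | beta <= lam] (theta1 P G a V beta) theta
  else if theta < theta2 P G a V beta beta then beta
  else
    'pinv_(fun=> 0) [set lam : R | beta <= lam] (theta2 P G a V beta) theta.

(* Main.v *)
Require Import Defs.
From HB Require Import structures.
From mathcomp Require Import all_boot all_order all_algebra.
From mathcomp Require Import all_classical all_reals all_analysis.
From mathcomp Require Import measurable_realfun.
From mathcomp Require Import ring lra.
Set Implicit Arguments.
Unset Strict Implicit.
Unset Printing Implicit Defensive.
Import Order.TTheory GRing.Theory Num.Theory.
Import numFieldNormedType.Exports.
Local Open Scope classical_set_scope.
Local Open Scope ring_scope.

(** Perturbed test functions reduce homogenization to the existence, for every
    slope [p], of approximate correctors at level [Hb p]: the half-relaxed limits
    of the solutions are then a sub- and a supersolution of the effective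
    equation, and the comparison principle identifies them.  For [p] outside the
    flat part, the correctors are the [F_i] at levels of a countable dense set;
    their slopes solve a first-order ODE (monotone iteration for existence,
    backward blow-up for uniqueness and comparison), are stationary, and Garsia's
    maximal inequality together with ergodicity gives
    [F_i x / x --> theta_i lam] almost surely.  In the flat part, [F_1] and [F_2]
    at level [beta] are glued on a long hill near [x0 / eps], where
    both slopes are almost zero; such hills exist near every [x0 / eps], for [eps]
    small, by the ergodic theorem applied to the indicator of a hill event.
    Gluing [F_1] on the left to [F_2] on the right gives the upper corrector;
    the opposite order gives the lower one. *)

(** * Calculus of [C^n] functions of two variables *)

(** The diffusion [a] may come arbitrarily close to [0], so lengths are measured by [S], the
    primitive of [1 / a]: in this variable the slope equation [f' = (lam - W - G(f)) / a] loses its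
    coefficient, and the hill condition provides exactly large [S]-lengths. The flat part is the
    obstacle: at level [beta] the correctors at hand have mean slope [theta1 beta] or [theta2 beta],
    none in between. A kinked profile replaces the missing one. A test function is perturbed only
    near its contact point, so the kink may sit there, and a convex kink only helps a maximum of
    [u - phi] to stay near [x0]; a concave one does the same for minima. Solving for the slopes by
    explicit iteration is what makes them measurable in [w]; uniqueness then carries measurability
    and stationarity over to the functions chosen by [xget]. No modulus of continuity in [x] uniform
    in [eps] is established for the solutions, whence the semicontinuous limits and a comparison
    principle for semicontinuous functions. *)

Section calc.
Variable R : realType.
Implicit Types (f g : R * R -> R) (z v : R * R).

(** Restriction to a line turns a directional derivative into a one-variable derivative at [0], to
    which the chain rule applies. *)
Lemma is_derive_line f z v (d : R) :
  is_derive z v f d <-> is_derive (0 : R) 1 (fun r : R => f (r *: v + z)) d.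
Proof.
have E : (fun h : R => h^-1 *: (((f \o shift z) (h *: v)) - f z)) =
  (fun h : R => h^-1 *: ((((fun r : R => f (r *: v + z)) \o shift 0) (h *: 1)) - f (0 *: v + z))).
  by apply/funext => h /=; rewrite addr0 scale0r add0r -[h *: 1]/(h * 1) mulr1.
split => -[H1 H2]; split.
- by move: H1; rewrite /derivable E.
- by move: H2; rewrite /derive E.
- by move: H1; rewrite /derivable E.
- by move: H2; rewrite /derive E.
Qed.

Lemma open_spacetime_pos : open (@spacetime_pos R).
Proof.
rewrite /spacetime_pos [X in open X](_ : _ = fst @^-1` [set x : R | 0 < x]) //.
by apply: open_comp => [x _|]; [exact: cvg_fst | exact: open_gt].
Qed.

Lemma is_derive_snd (h : R -> R) z (d : R) : is_derive z.2 1 h d ->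
  is_derive z ((0, 1) : R * R) (fun y => h y.2) d.
Proof.
move=> H; apply/is_derive_line => /=.
rewrite (_ : (fun r : R => _) = h \o (fun r : R => r + z.2)); last first.
  by apply/funext => r /=; rewrite -[r *: 1]/(r * 1) mulr1.
rewrite -[d]mulr1; apply: is_derive1_comp; first by rewrite add0r.
by apply: is_derive_eq; rewrite addr0.
Qed.

Lemma is_derive_snd0 (h : R -> R) z :
  is_derive z ((1, 0) : R * R) (fun y => h y.2) 0.
Proof.
apply/is_derive_line => /=.
rewrite (_ : (fun r : R => _) = cst (h z.2)); first exact: is_derive_cst.
by apply/funext => r /=; rewrite scaler0 add0r.
Qed.

Lemma is_derive_fst (h : R -> R) z (d : R) : is_derive z.1 1 h d ->
  is_derive z ((1, 0) : R * R) (fun y => h y.1) d.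
Proof.
move=> H; apply/is_derive_line => /=.
rewrite (_ : (fun r : R => _) = h \o (fun r : R => r + z.1)); last first.
  by apply/funext => r /=; rewrite -[r *: 1]/(r * 1) mulr1.
rewrite -[d]mulr1; apply: is_derive1_comp; first by rewrite add0r.
by apply: is_derive_eq; rewrite addr0.
Qed.

Lemma is_derive_fst0 (h : R -> R) z :
  is_derive z ((0, 1) : R * R) (fun y => h y.1) 0.
Proof.
apply/is_derive_line => /=.
rewrite (_ : (fun r : R => _) = cst (h z.1)); first exact: is_derive_cst.
by apply/funext => r /=; rewrite scaler0 add0r.
Qed.

Lemma is_derive_affine (s : R) w f z v (d : R) : is_derive (s *: z + w) v f d ->
  is_derive z v (fun y => f (s *: y + w)) (d * s).
Proof.
move=> /is_derive_line H; apply/is_derive_line => /=.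
rewrite (_ : (fun r : R => _) = (fun r : R => f (r *: v + (s *: z + w))) \o (fun r : R => s * r)); last first.
  by apply/funext => r /=; rewrite scalerDr scalerA addrA.
apply: is_derive1_comp; first by rewrite mulr0.
by apply: is_derive_eq; rewrite -[_ *: _]/(_ * _) mulr1.
Qed.

Lemma continuous_at_snd (h : R -> R) z : {for z.2, continuous h} ->
  {for z, continuous (fun y : R * R => h y.2)}.
Proof. by move=> hc; apply: (@continuous_comp _ _ _ snd h); [exact: cvg_snd|exact: hc]. Qed.

Lemma continuous_at_fst (h : R -> R) z : {for z.1, continuous h} ->
  {for z, continuous (fun y : R * R => h y.1)}.
Proof. by move=> hc; apply: (@continuous_comp _ _ _ fst h); [exact: cvg_fst|exact: hc]. Qed.

Lemma is_derive_continuous (h : R -> R) (x d : R) : is_derive x 1 h d ->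
  {for x, continuous h}.
Proof. by case=> H _; exact/differentiable_continuous/derivable1_diffP. Qed.

Section Cn.
Variable D : set (R * R).
Hypothesis oD : open D.

Lemma derivable_ext f g z v : D z -> (forall y, D y -> f y = g y) ->
  derivable f z v -> derivable g z v.
Proof.
move=> Dz fg; have [->|v0] := eqVneq v 0; first by move=> _; exact: derivable0.
by apply: near_eq_derivable => //; apply: filterS (open_nbhs_nbhs (conj oD Dz)) => y /fg.
Qed.

Lemma derive_ext f g z v : D z -> (forall y, D y -> f y = g y) ->
  'D_v f z = 'D_v g z.
Proof.
move=> Dz fg; apply: near_eq_derive.
by apply: filterS (open_nbhs_nbhs (conj oD Dz)) => y /fg.
Qed.

Lemma continuous_ext_open f g z : D z -> (forall y, D y -> f y = g y) ->
  {for z, continuous f} -> {for z, continuous g}.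
Proof.
move=> Dz fg fc; rewrite /prop_for /continuous_at -(fg _ Dz).
apply: cvg_trans fc; apply: near_eq_cvg.
by apply: filterS (open_nbhs_nbhs (conj oD Dz)) => y /fg.
Qed.

(** [Cn] recurses on the total functions [dt f] and [dx f], whose closed forms are valid only on
    [D]. The closure lemmas below compute derivatives on [D] and transfer regularity through this
    one. *)
Lemma Cn_ext n f g : (forall y, D y -> f y = g y) -> Cn n D f -> Cn n D g.
Proof.
elim: n f g => [|n IH] f g fg /= [fc].
  by move=> _; split=> // z Dz; exact: (continuous_ext_open Dz fg (fc z Dz)).
move=> [fd ft fx]; split; first by move=> z Dz; exact: (continuous_ext_open Dz fg (fc z Dz)).
split.
- by move=> z Dz; have [h1 h2] := fd z Dz; split; [exact: derivable_ext h1|exact: derivable_ext h2].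
- by apply: IH ft => y Dy; rewrite /dt (derive_ext _ Dy fg).
- by apply: IH fx => y Dy; rewrite /dx (derive_ext _ Dy fg).
Qed.

Lemma CnD n f g : Cn n D f -> Cn n D g -> Cn n D (fun z => f z + g z).
Proof.
elim: n f g => [|n IH] f g [fc +] [gc +].
  by move=> _ _; split=> // z Dz; apply: continuousD; [exact: fc|exact: gc].
move=> [fd ft fx] [gd gt gx]; split.
  by move=> z Dz; apply: continuousD; [exact: fc|exact: gc].
split.
- move=> z Dz; have [h1 h2] := fd z Dz; have [h3 h4] := gd z Dz.
  by split; apply: derivableD.
- apply: (Cn_ext _ (IH _ _ ft gt)) => z Dz; rewrite /dt.
  by have [h1 h2] := fd z Dz; have [h3 h4] := gd z Dz; rewrite deriveD.
- apply: (Cn_ext _ (IH _ _ fx gx)) => z Dz; rewrite /dx.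
  by have [h1 h2] := fd z Dz; have [h3 h4] := gd z Dz; rewrite deriveD.
Qed.

Lemma CnM_cst n f (c : R) : Cn n D f -> Cn n D (fun z => c * f z).
Proof.
elim: n f => [|n IH] f [fc +].
  by move=> _; split=> // z Dz; apply: continuousM; [exact: cst_continuous|exact: fc].
move=> [fd ft fx]; split.
  by move=> z Dz; apply: continuousM; [exact: cst_continuous|exact: fc].
split.
- by move=> z Dz; have [h1 h2] := fd z Dz; split; exact: derivableZ.
- apply: (Cn_ext _ (IH _ ft)) => z Dz; rewrite /dt.
  by have [h1 h2] := fd z Dz; exact: (esym (deriveZ c h1)).
- apply: (Cn_ext _ (IH _ fx)) => z Dz; rewrite /dx.
  by have [h1 h2] := fd z Dz; exact: (esym (deriveZ c h2)).
Qed.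

Lemma CnN n f : Cn n D f -> Cn n D (fun z => - f z).
Proof. by move=> /(CnM_cst (-1)); apply: Cn_ext => z _; rewrite mulN1r. Qed.

Lemma Cn_cst n (c : R) : Cn n D (fun=> c).
Proof.
elim: n c => [|n IH] c; split=> //; try by move=> z _; exact: cst_continuous.
split.
- by move=> z _; split; exact: derivable_cst.
- by apply: (Cn_ext _ (IH 0)) => z _; rewrite /dt derive_cst.
- by apply: (Cn_ext _ (IH 0)) => z _; rewrite /dx derive_cst.
Qed.

Lemma Cn_snd (h : nat -> R -> R) n :
  (forall i (x : R), (i < n)%N -> is_derive x 1 (h i) (h i.+1 x)) ->
  continuous (h n) -> Cn n D (fun z => h 0%N z.2).
Proof.
elim: n h => [|n IH] h hd hc.
  by split=> // z _; apply: continuous_at_snd; exact: hc.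
split.
  by move=> z _; apply: continuous_at_snd; exact: is_derive_continuous (hd 0%N z.2 isT).
split.
- move=> z _; split; first by have [] := is_derive_snd0 (h 0%N) z.
  by have [] := is_derive_snd (hd 0%N z.2 isT).
- apply: (Cn_ext _ (Cn_cst n 0)) => z _; rewrite /dt.
  by have [_ ->] := is_derive_snd0 (h 0%N) z.
- apply: (Cn_ext _ (IH (fun i => h i.+1) _ hc)).
    by move=> z _; rewrite /dx; have [_ ->] := is_derive_snd (hd 0%N z.2 isT).
  by move=> i x ni; exact: hd.
Qed.

Lemma Cn_fst (h : nat -> R -> R) n :
  (forall i (x : R), (i < n)%N -> is_derive x 1 (h i) (h i.+1 x)) ->
  continuous (h n) -> Cn n D (fun z => h 0%N z.1).
Proof.
elim: n h => [|n IH] h hd hc.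
  by split=> // z _; apply: continuous_at_fst; exact: hc.
split.
  by move=> z _; apply: continuous_at_fst; exact: is_derive_continuous (hd 0%N z.1 isT).
split.
- move=> z _; split; last by have [] := is_derive_fst0 (h 0%N) z.
  by have [] := is_derive_fst (hd 0%N z.1 isT).
- apply: (Cn_ext _ (IH (fun i => h i.+1) _ hc)).
    by move=> z _; rewrite /dt; have [_ ->] := is_derive_fst (hd 0%N z.1 isT).
  by move=> i x ni; exact: hd.
- apply: (Cn_ext _ (Cn_cst n 0)) => z _; rewrite /dx.
  by have [_ ->] := is_derive_fst0 (h 0%N) z.
Qed.

End Cn.

Lemma affine_continuous (s : R) (w : R * R) : continuous (fun y : R * R => s *: y + w).
Proof.
by move=> z; apply: cvgD; [exact: scaler_continuous|exact: cvg_cst].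
Qed.

Lemma spacetime_pos_affine (s k : R) z : 0 < s -> spacetime_pos z ->
  spacetime_pos (s *: z + (0, k)).
Proof. by rewrite /spacetime_pos /= => ? ?; rewrite addr0 mulr_gt0. Qed.

Lemma Cn_affine n f (s k : R) : 0 < s ->
  Cn n (@spacetime_pos R) f -> Cn n (@spacetime_pos R) (fun y => f (s *: y + (0, k))).
Proof.
move=> s0; have D z := @spacetime_pos_affine s k z s0.
have cc g z : spacetime_pos z -> (forall z, spacetime_pos z -> {for z, continuous g}) ->
    {for z, continuous (fun y : R * R => g (s *: y + (0, k)))}.
  move=> /D Dz gc.
  by apply: (@continuous_comp _ _ _ (fun y : R * R => s *: y + (0, k)) g); [exact: affine_continuous|exact: gc].
elim: n f => [|n IH] f [fc +].
  by move=> _; split=> // z Dz; exact: cc.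
move=> [fd ft fx]; split; first by move=> z Dz; exact: cc.
have W z v : derivable f (s *: z + (0, k)) v ->
    is_derive z v (fun y => f (s *: y + (0, k))) ('D_v f (s *: z + (0, k)) * s).
  by move=> H; apply: is_derive_affine; split.
split.
- by move=> z /D /fd [h1 h2]; split; [have [] := W _ _ h1|have [] := W _ _ h2].
- apply: (Cn_ext open_spacetime_pos _ (CnM_cst open_spacetime_pos s (IH _ ft))) => z /D /fd [h1 h2].
  by rewrite /dt; have [_ ->] := W _ _ h1; rewrite mulrC.
- apply: (Cn_ext open_spacetime_pos _ (CnM_cst open_spacetime_pos s (IH _ fx))) => z /D /fd [h1 h2].
  by rewrite /dx; have [_ ->] := W _ _ h2; rewrite mulrC.
Qed.

End calc.

(** * Viscosity sub- and supersolutions *)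

Section usc.
Variable R : realType.

Definition usc (T : topologicalType) (f : T -> R) : Prop :=
  forall z c, f z < c -> \forall y \near z, f y < c.

Lemma uscD (T : topologicalType) (f g : T -> R) :
  usc f -> usc g -> usc (fun z => f z + g z).
Proof.
move=> uf ug z c H.
pose e := (c - f z - g z) / 2.
have e0 : 0 < e by rewrite /e; lra.
have H1 := uf z (f z + e) ltac:(lra).
have H2 := ug z (g z + e) ltac:(lra).
near=> y.
have : f y < f z + e by near: y.
have : g y < g z + e by near: y.
rewrite /e; lra.
Unshelve. all: by end_near. Qed.

Lemma continuous_usc (T : topologicalType) (f : T -> R) : continuous f -> usc f.
Proof. by move=> fc z c H; exact: (cvgr_lt _ (fc z)). Qed.

Lemma usc_comp (S T : topologicalType) (h : S -> T) (f : T -> R) :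
  continuous h -> usc f -> usc (f \o h).
Proof. by move=> hc uf z c H; exact: (hc z _ (uf _ _ H)). Qed.

(** Two near-coverings of [K]: the first bounds [f], the second, were the supremum [s] not attained,
    would give [f <= s - e] on all of [K] for some [e > 0]. Semicontinuity is asked only at points
    of [K], because test functions are regular at positive times only. *)
Lemma usc_max (T : topologicalType) (f : T -> R) (K : set T) :
  (forall z c, K z -> f z < c -> \forall y \near z, f y < c) ->
  compact K -> K !=set0 -> exists2 z, K z & forall y, K y -> f y <= f z.
Proof.
move=> uf cK [z0 Kz0].
have /compact_near_coveringP ncK := cK.
have [M HM] : exists M, forall z, K z -> f z <= M.
  suff : \forall M \near +oo, forall z, K z -> f z <= M by case/filter_ex => M HM; exists M.
  apply: ncK => z Kz; near=> y M.
  have : f y < f z + 1 by near: y; apply: uf => //; lra.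
  move=> /ltW /le_trans; apply => /=.
  by near: M; apply: nbhs_pinfty_ge; rewrite num_real.
have hs : has_sup [set f z | z in K].
  by split; [exists (f z0), z0 | exists M => _ [z Kz <-]; exact: HM].
set s := sup [set f z | z in K].
have sub z : K z -> f z <= s by move=> Kz; apply: ub_le_sup; [case: hs | exists z].
apply: contrapT => no.
have lt z : K z -> f z < s.
  move=> Kz; rewrite lt_neqAle sub // andbT; apply/eqP => E; apply: no.
  by exists z => // y Ky; rewrite E sub.
have : \forall e \near 0^'+, forall z, K z -> f z <= s - e.
  apply: ncK => z Kz; have := lt _ Kz => Hz.
  near=> y e.
  have : f y < (f z + s) / 2 by near: y; apply: uf => //; lra.
  rewrite /=; suff : e < (s - f z) / 2 by lra.
  by near: e; apply: nbhs_right_lt; lra.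
move=> /(filterI (nbhs_right_gt 0)) /filter_ex [e [/= e0 He]].
suff : s <= s - e by lra.
apply: ge_sup; first by case: hs.
by move=> _ [z Kz <-]; exact: He.
Unshelve. all: by end_near. Qed.

(** The base point [p] is confined to [[- P, P]] but [p + e] may leave it, as happens when a bounded
    slope is perturbed; hence the near-covering argument on the product. *)
Lemma continuous_unif_itv (H : R -> R) (P k : R) : continuous H -> 0 < k ->
  exists2 nu, 0 < nu & forall p e, `|p| <= P -> `|e| <= nu -> `|H (p + e) - H p| < k.
Proof.
move=> Hc k0; have cK : compact `[- P, P] by exact: segment_compact.
have /compact_near_coveringP ncK := cK.
have : \forall e \near (0 : R), forall p, `[- P, P]%classic p -> `|H (p + e) - H p| < k.
  apply: (ncK _ (nbhs (0:R)) (fun e p => `|H (p + e) - H p| < k)) => p Kp.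
  have h1 : H (x.1 + x.2) @[x --> (p, 0 : R)] --> H p.
    apply: (@cvg_comp _ _ _ (fun x : R * R => x.1 + x.2) H _ (nbhs p) _ _ (Hc p)).
    have : (x.1 + x.2 : R) @[x --> (p, 0 : R)] --> (p : R) + 0.
      by apply: (@cvgD _ _ _ _ _ (@fst R R) (@snd R R)); [exact: cvg_fst|exact: cvg_snd].
    by rewrite addr0.
  have h2 : H x.1 @[x --> (p, 0 : R)] --> H p.
    by apply: (@cvg_comp _ _ _ (@fst R R) H _ (nbhs p) _ _ (Hc p)); exact: cvg_fst.
  have h3 := cvgB h1 h2; rewrite subrr in h3.
  have h4 : Filter (nbhs (p : R, 0 : R)) := nbhs_filter _.
  exact: cvgr0_norm_lt (h3 h4) _ k0.
move=> /nbhs_normP [d /= d0 Hd]; exists (d / 2); first by lra.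
move=> p e Pp He; apply: Hd => /=.
  by rewrite sub0r normrN; lra.
by rewrite in_itv /= -ler_norml.
Qed.

(** A chain of at most [|a - b| / d + 1] steps of length at most [d] joins [a] to [b], and each step
    costs [eta]. *)
Lemma unif_chain (f : R -> R) (d eta : R) : 0 < d -> 0 <= eta ->
  (forall a b, `|a - b| <= d -> `|f a - f b| <= eta) ->
  forall a b, `|f a - f b| <= eta + eta / d * `|a - b|.
Proof.
move=> d0 eta0 Hf.
have W n : forall a b, `|a - b| <= d *+ n -> `|f a - f b| <= eta *+ n.
  elim: n => [|n IH] a b; first by rewrite !mulr0n normr_le0 subr_eq0 => /eqP ->; rewrite subrr normr0.
  move=> H; have [small|big] := leP `|a - b| d.
    apply: (le_trans (Hf _ _ small)); rewrite mulrS lerDl mulrn_wge0 //.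
  pose c := a - Num.sg (a - b) * d.
  have ab0 : a - b != 0 by rewrite -normr_gt0; exact: lt_trans big.
  have h1 : `|a - c| <= d by rewrite /c opprB addrC subrK normrM normr_sg ab0 mul1r gtr0_norm.
  have h2 : `|c - b| <= d *+ n.
    have -> : c - b = Num.sg (a - b) * (`|a - b| - d).
      by rewrite /c mulrBr -numEsg; ring.
    rewrite normrM normr_sg ab0 mul1r ger0_norm; last by lra.
    by move: H; rewrite mulrS; lra.
  have -> : f a - f b = (f a - f c) + (f c - f b) by ring.
  by apply: (le_trans (ler_normD _ _)); rewrite mulrS; apply: lerD; [exact: Hf|exact: IH].
move=> a b.
have := truncn_itv (divr_ge0 (normr_ge0 (a - b)) (ltW d0)).
set n := Num.truncn _ => /andP[n1 n2].
have h1 : `|a - b| <= d *+ n.+1.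
  by rewrite -[leRHS]mulr_natl; move: n2; rewrite ltr_pdivrMr // => /ltW.
apply: (le_trans (W _ _ _ h1)).
rewrite mulrS lerD2l -[leLHS]mulr_natr -mulrA ler_wpM2l //.
by rewrite [d^-1 * _]mulrC.
Qed.

End usc.

Section subsol.
Variable R : realType.
Implicit Types (A H W : R -> R) (v phi : R * R -> R) (z : R * R).
Local Notation Q := (@spacetime_pos R).

(** The differential inequality alone: half-relaxed limits are a priori only semicontinuous. *)
Definition subsol A H W v : Prop := forall z0 phi, Q z0 -> Cn 2 Q phi ->
  (\forall z \near z0, v z - phi z <= v z0 - phi z0) ->
  dt phi z0 <= equation_rhs A H W phi z0.

Definition supersol A H W v : Prop := forall z0 phi, Q z0 -> Cn 2 Q phi ->
  (\forall z \near z0, v z0 - phi z0 <= v z - phi z) ->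
  equation_rhs A H W phi z0 <= dt phi z0.

Lemma Cn2_derivable phi z : Cn 2 Q phi -> Q z ->
  [/\ derivable phi z ((1, 0) : R * R), derivable phi z ((0, 1) : R * R) &
      derivable (dx phi) z ((0, 1) : R * R)].
Proof.
by move=> [_ [d _ [_ [d2 _ _]]]] Qz; split; [case: (d z Qz)|case: (d z Qz)|case: (d2 z Qz)].
Qed.

Lemma Cn2_opp phi z : Cn 2 Q phi -> Q z ->
  [/\ Cn 2 Q (fun y => - phi y), dt (fun y => - phi y) z = - dt phi z,
      dx (fun y => - phi y) z = - dx phi z &
      dx (dx (fun y => - phi y)) z = - dx (dx phi) z].
Proof.
move=> C Qz; have [d1 d2 d3] := Cn2_derivable C Qz.
split; first exact: (CnN (@open_spacetime_pos R) C).
- exact: (deriveN d1).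
- exact: (deriveN d2).
rewrite -[RHS](deriveN d3) /dx; apply: (derive_ext (@open_spacetime_pos R) _ Qz) => y Qy.
by have [_ e2 _] := Cn2_derivable C Qy; exact: (deriveN e2).
Qed.

Lemma ler_oppB (a b c d : R) : - a - b <= - c - d -> c - - d <= a - - b.
Proof. by rewrite !opprK -!opprD lerN2. Qed.

Lemma ler_opp_rhs (a b c d e : R) :
  a * - b + c + d <= - e -> e <= a * b + - c + - d.
Proof. by rewrite mulrN; lra. Qed.

Lemma ger_opp_rhs (a b c d e : R) :
  - e <= a * - b + c + d -> a * b + - c + - d <= e.
Proof. by rewrite mulrN; lra. Qed.

(** The class of equations is stable under [u |-> - u], so every one-sided estimate is proved for
    subsolutions only and then applied to [- u]. *)
Lemma supersolN A H W v : supersol A H W v ->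
  subsol A (fun p => - H (- p)) (fun x => - W x) (fun z => - v z).
Proof.
move=> S z0 phi Qz C near0.
have [C' e1 e2 e3] := Cn2_opp C Qz.
have := S z0 _ Qz C'; rewrite /equation_rhs e1 e2 e3 => S'.
apply: ler_opp_rhs; apply: S'.
by apply: filterS near0 => y; exact: ler_oppB.
Qed.

Lemma subsolN A H W v : subsol A H W v ->
  supersol A (fun p => - H (- p)) (fun x => - W x) (fun z => - v z).
Proof.
move=> S z0 phi Qz C near0.
have [C' e1 e2 e3] := Cn2_opp C Qz.
have := S z0 _ Qz C'; rewrite /equation_rhs e1 e2 e3 => S'.
apply: ger_opp_rhs; apply: S'.
by apply: filterS near0 => y; exact: ler_oppB.
Qed.

Lemma Cn2_add phi (k k1 k2 h h1 h2 : R -> R) z : Cn 2 Q phi -> Q z ->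
  (forall x : R, is_derive x 1 k (k1 x)) -> (forall x : R, is_derive x 1 k1 (k2 x)) ->
  continuous k2 ->
  (forall x : R, is_derive x 1 h (h1 x)) -> (forall x : R, is_derive x 1 h1 (h2 x)) ->
  continuous h2 ->
  let psi := fun y : R * R => phi y + (k y.1 + h y.2) in
  [/\ Cn 2 Q psi, dt psi z = dt phi z + k1 z.1, dx psi z = dx phi z + h1 z.2 &
      dx (dx psi) z = dx (dx phi) z + h2 z.2].
Proof.
move=> C Qz dk dk1 ck2 dh dh1 ch2 psi.
have oQ := @open_spacetime_pos R.
have Ck : Cn 2 Q (fun y : R * R => k y.1).
  apply: (@Cn_fst _ _ oQ (fun i => nth k2 [:: k; k1; k2] i) 2) => [[|[|//]] x _|x].
  - exact: dk.
  - exact: dk1.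
  - exact: ck2.
have Ch : Cn 2 Q (fun y : R * R => h y.2).
  apply: (@Cn_snd _ _ oQ (fun i => nth h2 [:: h; h1; h2] i) 2) => [[|[|//]] x _|x].
  - exact: dh.
  - exact: dh1.
  - exact: ch2.
have D y : Q y -> is_derive y ((0, 1) : R * R) psi (dx phi y + h1 y.2).
  move=> Qy; have [d1 d2 d3] := Cn2_derivable C Qy.
  have D1 : is_derive y ((0, 1) : R * R) phi (dx phi y) by split.
  have := is_deriveD D1 (is_deriveD (is_derive_fst0 k y) (is_derive_snd (dh y.2))).
  by rewrite add0r.
split.
- by apply: (CnD oQ C); exact: (CnD oQ Ck Ch).
- have [d1 d2 d3] := Cn2_derivable C Qz.
  have D1 : is_derive z ((1, 0) : R * R) phi (dt phi z) by split.
  have [_ E] := is_deriveD D1 (is_deriveD (is_derive_fst (dk z.1)) (is_derive_snd0 h z)).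
  by rewrite addr0 in E.
- by have [_ E] := D z Qz.
- have [d1 d2 d3] := Cn2_derivable C Qz.
  have D1 : is_derive z ((0, 1) : R * R) (dx phi) (dx (dx phi) z) by split.
  have [_ E] := is_deriveD D1 (is_derive_snd (dh1 z.2)).
  rewrite -E /dx; apply: (derive_ext oQ _ Qz) => y Qy.
  by have [_ ->] := D y Qy.
Qed.

Definition quad (a b : R) : R -> R := fun t => a * t ^+ 2 + b * t.

Lemma is_derive_quad (a b x : R) : is_derive x 1 (quad a b) (2 * a * x + b).
Proof.
rewrite /quad; apply: is_derive_eq.
by rewrite -!/(GRing.scale _ _) /GRing.scale /=; ring.
Qed.

Lemma is_derive_quad1 (a b x : R) : is_derive x 1 (fun t : R => 2 * a * t + b) (2 * a).
Proof.
apply: is_derive_eq.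
by rewrite -!/(GRing.scale _ _) /GRing.scale /=; ring.
Qed.

End subsol.

(** * Comparison and barriers *)

Section comparison.
Variable R : realType.
Local Notation Q := (@spacetime_pos R).

(** The quadratic penalties beat the linear growth of [U - L]. The bound [B] depends neither on [al]
    nor on [del], so that [al] can be chosen after [B], and [del] after [al]. *)
Lemma doubling_bounds (gam al del C t x d1 d2 : R) :
  0 < gam -> 1 <= al -> 0 <= C -> 0 <= del ->
  gam * t ^+ 2 + al * (d1 ^+ 2 + d2 ^+ 2) + del * x ^+ 2 <=
    1 + C * (2 * t + `|d2| + `|d1|) ->
  let B := 1 + 2 * C ^+ 2 / gam + C ^+ 2 in
  [/\ gam * t ^+ 2 <= 2 * B, al * (d1 ^+ 2 + d2 ^+ 2) <= 2 * B & del * x ^+ 2 <= B].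
Proof.
move=> g0 a1 C0 del0 H B.
(* With this [u] one has [2 * C * t = gam * u * t], which Young's inequality splits into
   [gam * t ^+ 2 / 2] and the constant [gam * u ^+ 2 / 2 = 2 * C ^+ 2 / gam] of [B]. *)
pose u := 2 * C / gam.
have Cu : 2 * C = gam * u by rewrite /u [RHS]mulrC divfK // gt_eqF.
have EB : B = 1 + gam * u ^+ 2 / 2 + C ^+ 2.
  by rewrite /B /u; field; rewrite gt_eqF.
have h1 : 0 <= gam * (t - u) ^+ 2 by rewrite mulr_ge0 // ?sqr_ge0 // ltW.
have h2 : 0 <= (`|d1| - C) ^+ 2 by exact: sqr_ge0.
have h3 : 0 <= (`|d2| - C) ^+ 2 by exact: sqr_ge0.
have e1 : `|d1| ^+ 2 = d1 ^+ 2 by rewrite real_normK // num_real.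
have e2 : `|d2| ^+ 2 = d2 ^+ 2 by rewrite real_normK // num_real.
have k1 : 0 <= d1 ^+ 2 + d2 ^+ 2 by rewrite addr_ge0 // sqr_ge0.
have k2 : 0 <= (al - 1) * (d1 ^+ 2 + d2 ^+ 2) by rewrite mulr_ge0 // subr_ge0.
have k3 : 0 <= del * x ^+ 2 by rewrite mulr_ge0 // sqr_ge0.
have k4 : 0 <= gam * t ^+ 2 by rewrite mulr_ge0 // ?sqr_ge0 // ltW.
have Ct : 2 * C * t = gam * u * t by rewrite Cu.
set dd := d1 ^+ 2 + d2 ^+ 2 in H k1 k2 *.
have edd : dd = d1 ^+ 2 + d2 ^+ 2 by [].
have m1 : C * `|d1| <= d1 ^+ 2 / 2 + C ^+ 2 / 2 by nra.
have m2 : C * `|d2| <= d2 ^+ 2 / 2 + C ^+ 2 / 2 by nra.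
have m3 : 2 * C * t <= gam * t ^+ 2 / 2 + gam * u ^+ 2 / 2 by rewrite Ct; nra.
rewrite EB.
set X := gam * t ^+ 2 in H m3 k4 *; set Y := gam * u ^+ 2 in m3 *; set Z := del * x ^+ 2 in H k3 *.
have m4 : al * dd <= 2 * (1 + Y / 2 + C ^+ 2) + 0 * dd.
  by nra.
by split; nra.
Qed.

Lemma sqr_le_abs (x M : R) : x ^+ 2 <= M -> `|x| <= M + 1.
Proof.
move=> H; have e : `|x| ^+ 2 = x ^+ 2 by rewrite real_normK // num_real.
have := sqr_ge0 (`|x| - 1); nra.
Qed.

Lemma near_spacetime_pos (z : R * R) : Q z -> \forall y \near z, Q y.
Proof. by move=> Qz; exact: (open_nbhs_nbhs (conj (@open_spacetime_pos R) Qz)). Qed.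

Lemma doubling_box (a b c r t s x y : R) : 0 <= t -> 0 <= s ->
  `|t| <= a -> `|x| <= b -> `|x - y| <= c -> `|t - s| <= c -> a + c + b <= r ->
  ((`[0, r] `*` `[- r, r]) `*` (`[0, r] `*` `[- r, r])) ((t, x), (s, y)).
Proof.
rewrite !ler_norml => t0 s0 /andP[a1 a2] /andP[b1 b2] /andP[c1 c2] /andP[d1 d2] H.
by split; split; rewrite /= in_itv /=; apply/andP; split; lra.
Qed.

Lemma penalty_continuous (T : topologicalType) (w : T) (t x s y : T -> R)
  (al ka del : R) :
  {for w, continuous t} -> {for w, continuous x} ->
  {for w, continuous s} -> {for w, continuous y} ->
  {for w, continuous (fun z => - (al * (x z - y z) ^+ 2 + al * (t z - s z) ^+ 2 +
     (ka * t z + ka * t z ^+ 2) + del * x z ^+ 2))}.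
Proof.
move=> ct cx cs cy.
have cm (f : T -> R) (c : R) : {for w, continuous f} ->
    c * f z ^+ 2 @[z --> w] --> c * f w ^+ 2.
  move=> cf; apply: cvgM; first exact: cvg_cst.
  by apply: (@continuous_comp _ _ _ f (fun y => y ^+ 2)) => //; exact: exprn_continuous.
apply: cvgN; apply: cvgD; last exact: (cm x).
apply: cvgD; last by apply: cvgD; [apply: cvgM => //; exact: cvg_cst|exact: (cm t)].
apply: cvgD.
  by apply: (cm (fun w => x w - y w)); apply: cvgB.
by apply: (cm (fun w => t w - s w)); apply: cvgB.
Qed.

(** The term [ka * t] makes the subsolution strict, [ka * t ^+ 2] and [del * x ^+ 2] confine the
    maximum, and the [al] terms tie [(s, y)] to [(t, x)]. *)
Definition penalty (al ka del t x s y : R) : R :=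
  al * (x - y) ^+ 2 + al * (t - s) ^+ 2 + (ka * t + ka * t ^+ 2) + del * x ^+ 2.

Lemma penalty_fst (al ka del t x s y t' x' u u' l : R) :
  u' - l - penalty al ka del t' x' s y <= u - l - penalty al ka del t x s y ->
  u' - (0 + (quad (al + ka) (ka - 2 * al * s) t' + quad (al + del) (- 2 * al * y) x')) <=
  u - (0 + (quad (al + ka) (ka - 2 * al * s) t + quad (al + del) (- 2 * al * y) x)).
Proof. by rewrite /penalty /quad; lra. Qed.

Lemma penalty_snd (al ka del t x s y s' y' u l l' : R) :
  u - l' - penalty al ka del t x s' y' <= u - l - penalty al ka del t x s y ->
  l - (0 + (quad (- al) (2 * al * t) s + quad (- al) (2 * al * x) y)) <=
  l' - (0 + (quad (- al) (2 * al * t) s' + quad (- al) (2 * al * x) y')).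
Proof. by rewrite /penalty /quad; lra. Qed.

(** With one pair of variables frozen, the penalty is, up to a constant, a quadratic in time plus a
    quadratic in space, hence an admissible test function. Subtracting the two conclusions bounds
    [ka] by an increment of [H] over a slope change [2 * del * x]. *)
Lemma doubling_interior (H : R -> R) (U L : R * R -> R) (al ka del t x s y : R) :
  subsol (fun=> 0) H (fun=> 0) U -> supersol (fun=> 0) H (fun=> 0) L ->
  0 < t -> 0 < s ->
  (forall t' x' s' y', 0 <= t' -> 0 <= s' ->
     U (t', x') - L (s', y') - penalty al ka del t' x' s' y' <=
     U (t, x) - L (s, y) - penalty al ka del t x s y) ->
  2 * al * (t - s) + ka + 2 * ka * t <= H (2 * al * (x - y) + 2 * del * x) /\
  H (2 * al * (x - y)) <= 2 * al * (t - s).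
Proof.
move=> sU sL t_gt0 s_gt0 Hmax.
have Qcst : Cn 2 Q (fun=> 0 : R) := Cn_cst (@open_spacetime_pos R) 2 0.
have dt0 (z : R * R) : dt (fun=> 0 : R) z = 0 by rewrite /dt derive_cst.
have dx0 : dx (fun=> 0 : R) = (fun=> 0) by apply/funext => z; rewrite /dx derive_cst.
have Ht : Q (t, x) by [].
have Hs : Q (s, y) by [].
have ccst (c : R) : continuous (fun _ : R => c) by move=> ?; exact: cst_continuous.
have [Cphi e1 e2 _] := Cn2_add Qcst Ht
  (is_derive_quad (al + ka) (ka - 2 * al * s)) (is_derive_quad1 (al + ka) (ka - 2 * al * s)) (ccst _)
  (is_derive_quad (al + del) (- 2 * al * y)) (is_derive_quad1 (al + del) (- 2 * al * y)) (ccst _).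
have [Cpsi f1 f2 _] := Cn2_add Qcst Hs
  (is_derive_quad (- al) (2 * al * t)) (is_derive_quad1 (- al) (2 * al * t)) (ccst _)
  (is_derive_quad (- al) (2 * al * x)) (is_derive_quad1 (- al) (2 * al * x)) (ccst _).
have I1 := sU _ _ Ht Cphi.
have I2 := sL _ _ Hs Cpsi.
split.
  have -> : 2 * al * (t - s) + ka + 2 * ka * t =
      dt (fun=> 0) (t, x) + (2 * (al + ka) * (t, x).1 + (ka - 2 * al * s)).
    by rewrite dt0 /=; ring.
  have -> : 2 * al * (x - y) + 2 * del * x =
      dx (fun=> 0) (t, x) + (2 * (al + del) * (t, x).2 + - 2 * al * y).
    by rewrite dx0 /=; ring.
  move: I1; rewrite /equation_rhs e1 e2 mul0r [0 + H _]add0r [H _ + 0]addr0; apply.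
  apply: filterS (near_spacetime_pos Ht) => -[t' x'] t'0; apply: penalty_fst.
  by apply: Hmax; exact: ltW.
have -> : 2 * al * (t - s) = dt (fun=> 0) (s, y) + (2 * - al * (s, y).1 + 2 * al * t).
  by rewrite dt0 /=; ring.
have -> : 2 * al * (x - y) = dx (fun=> 0) (s, y) + (2 * - al * (s, y).2 + 2 * al * x).
  by rewrite dx0 /=; ring.
move: I2; rewrite /equation_rhs f1 f2 mul0r [0 + H _]add0r [H _ + 0]addr0; apply.
apply: filterS (near_spacetime_pos Hs) => -[s' y'] s'0; apply: penalty_snd.
by apply: Hmax; exact: ltW.
Qed.

(** The equation does not depend on [x], so doubling the variables leaves no error from
    coefficients. The growth hypothesis carries at once the initial inequality [U <= L] and the
    uniform continuity of the data. *)
Lemma comparison (H : R -> R) (U L : R * R -> R) : continuous H ->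
  usc U -> usc (fun z => - L z) ->
  subsol (fun=> 0) H (fun=> 0) U -> supersol (fun=> 0) H (fun=> 0) L ->
  (forall eta, 0 < eta -> exists2 C, 0 <= C & forall t s x y, 0 <= t -> 0 <= s ->
     U (t, x) - L (s, y) <= eta + C * (t + s + `|x - y|)) ->
  forall z, 0 <= z.1 -> U z <= L z.
Proof.
move=> Hc uU uL sU sL gr [t1 x1] /= t10.
apply: contrapT => /negP; rewrite -ltNge => lt.
pose sg := (U (t1, x1) - L (t1, x1)) / 4.
have sg0 : 0 < sg by rewrite /sg; move: lt; clear; lra.
have esg : U (t1, x1) - L (t1, x1) = 4 * sg by rewrite /sg; clear; lra.
(* Keeps the time penalty at [(t1, x1)] below [sg]; with the same bound for the [del] term, the
   doubled function is at least [2 * sg] at its maximum. *)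
pose ka := sg / (1 + t1 + t1 ^+ 2).
have den0 : 0 < 1 + t1 + t1 ^+ 2 by have := sqr_ge0 t1; move: t10; clear; lra.
have ka0 : 0 < ka by rewrite divr_gt0.
have eka : ka * t1 + ka * t1 ^+ 2 <= sg.
  have : ka * (1 + t1 + t1 ^+ 2) = sg by rewrite divfK // gt_eqF.
  by move: ka0; clear; lra.
have [C1 C10 HC1] := gr 1 ltr01.
have [C2 C20 HC2] := gr sg sg0.
pose B := 1 + 2 * C1 ^+ 2 / ka + C1 ^+ 2.
have B1 : 1 <= B.
  rewrite /B -addrA lerDl addr_ge0 ?sqr_ge0 //; apply: divr_ge0; last exact: ltW.
  by rewrite mulr_ge0 // sqr_ge0.
(* So large that the maximum point cannot lie at time [0]: there one would have
   [al * sg ^+ 2 <= 4 * C2 ^+ 2 * B]. *)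
pose al := 1 + 4 * C2 ^+ 2 * (2 * B) / sg ^+ 2.
have al1 : 1 <= al.
  by rewrite lerDl divr_ge0 ?sqr_ge0 // !mulr_ge0 ?sqr_ge0 //; move: B1; clear; lra.
have h6 : al * sg ^+ 2 = sg ^+ 2 + 4 * C2 ^+ 2 * (2 * B).
  by rewrite /al mulrDl mul1r divfK // expf_eq0 /= gt_eqF.
pose P := 2 * al * (2 * B + 1).
have [nu nu0 Hnu] := continuous_unif_itv P Hc ka0.
(* Since [del * x ^+ 2 <= B] at the maximum, [(2 * del * x) ^+ 2 <= 4 * del * B <= nu ^+ 2]: the
   slope perturbation is within the modulus [nu] of [H]. The second entry controls the cost of the
   penalty at [x1]. *)
pose del := Num.min (nu ^+ 2 / (4 * B)) (sg / (1 + x1 ^+ 2)).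
have del0 : 0 < del.
  have dx1 : 0 < 1 + x1 ^+ 2 by have := sqr_ge0 x1; clear; lra.
  have dB : 0 < 4 * B by move: B1; clear; lra.
  by rewrite lt_min; apply/andP; split; apply: divr_gt0; rewrite ?exprn_gt0.
have del1 : 4 * del * B <= nu ^+ 2.
  have : del <= nu ^+ 2 / (4 * B) by rewrite ge_min lexx.
  rewrite ler_pdivlMr; last by move: B1; clear; lra.
  by clear; lra.
have del2 : del * x1 ^+ 2 <= sg.
  have : del <= sg / (1 + x1 ^+ 2) by rewrite ge_min lexx orbT.
  rewrite ler_pdivlMr; last by have := sqr_ge0 x1; clear; lra.
  by move: del0; clear; lra.
pose Phi (w : (R * R) * (R * R)) := U w.1 - L w.2 -
  (al * (w.1.2 - w.2.2) ^+ 2 + al * (w.1.1 - w.2.1) ^+ 2 +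
   (ka * w.1.1 + ka * w.1.1 ^+ 2) + del * w.1.2 ^+ 2).
have bounds w : 0 <= w.1.1 -> 0 <= w.2.1 -> 0 <= Phi w ->
  [/\ ka * w.1.1 ^+ 2 <= 2 * B,
      al * ((w.1.2 - w.2.2) ^+ 2 + (w.1.1 - w.2.1) ^+ 2) <= 2 * B &
      del * w.1.2 ^+ 2 <= B].
  move: w => [[t x] [s y]] /= t0 s0; rewrite /Phi /= => ph.
  apply: doubling_bounds => //; first exact: ltW.
  have := HC1 t s x y t0 s0.
  have : C1 * (t + s + `|x - y|) <= C1 * (2 * t + `|t - s| + `|x - y|).
    apply: ler_wpM2l => //.
    by have := ler_norm (s - t); rewrite distrC; clear; lra.
  have : 0 <= ka * t by rewrite mulr_ge0 // ltW.
  by move: ph; clear; lra.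
clearbody del; clearbody al B ka sg.
pose rr := (2 * B / ka + 1) + (2 * B + 1) + (B / del + 1) + t1 + `|x1|.
have p1 : 0 <= 2 * B / ka by apply: divr_ge0; [by move: B1; clear; lra|exact: ltW].
have p2 : 0 <= B / del by apply: divr_ge0; [by move: B1; clear; lra|exact: ltW].
pose K1 : set (R * R) := `[0, rr] `*` `[- rr, rr].
pose K := K1 `*` K1.
have cK : compact K.
  by apply: compact_setX; apply: compact_setX; exact: segment_compact.
have inK w : 0 <= w.1.1 -> 0 <= w.2.1 -> 0 <= Phi w -> K w.
  move=> w1 w2 ph; have [b1 b2 b3] := bounds w w1 w2 ph.
  have a1 : `|w.1.1| <= 2 * B / ka + 1.
    by apply: sqr_le_abs; rewrite ler_pdivlMr // mulrC.
  have a2 : `|w.1.2| <= B / del + 1.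
    by apply: sqr_le_abs; rewrite ler_pdivlMr // mulrC.
  have b2' : (w.1.2 - w.2.2) ^+ 2 + (w.1.1 - w.2.1) ^+ 2 <= 2 * B.
    apply: le_trans b2; rewrite ler_peMl // addr_ge0 // sqr_ge0 //.
  have a3 : `|w.1.2 - w.2.2| <= 2 * B + 1.
    by apply: sqr_le_abs; have := sqr_ge0 (w.1.1 - w.2.1); move: b2'; clear; lra.
  have a4 : `|w.1.1 - w.2.1| <= 2 * B + 1.
    by apply: sqr_le_abs; have := sqr_ge0 (w.1.2 - w.2.2); move: b2'; clear; lra.
  case: w w1 w2 a1 a2 a3 a4 {ph b1 b2 b3 b2'} => -[t x] [s y] /= w1 w2 a1 a2 a3 a4.
  have nx := normr_ge0 x1.
  by apply: (doubling_box w1 w2 a1 a2 a3 a4); rewrite /rr; move: t10 nx; clear; lra.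
pose w1 := ((t1, x1), (t1, x1)).
have Phi1 : 2 * sg <= Phi w1.
  rewrite /Phi /= !subrr expr0n /= !mulr0 esg; move: eka del2; clear; lra.
have uPhi : usc Phi.
  apply: uscD.
    apply: uscD; first by apply: (usc_comp _ uU) => w; exact: cvg_fst.
    by apply: (usc_comp _ uL) => w; exact: cvg_snd.
  apply: continuous_usc => w.
  apply: (@penalty_continuous _ w (fun w : (R * R) * (R * R) => w.1.1)
    (fun w : (R * R) * (R * R) => w.1.2) (fun w : (R * R) * (R * R) => w.2.1)
    (fun w : (R * R) * (R * R) => w.2.2)).
  - by apply: (@continuous_comp _ _ _ fst fst); exact: cvg_fst.
  - by apply: (@continuous_comp _ _ _ fst snd); [exact: cvg_fst|exact: cvg_snd].
  - by apply: (@continuous_comp _ _ _ snd fst); [exact: cvg_snd|exact: cvg_fst].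
  - by apply: (@continuous_comp _ _ _ snd snd); exact: cvg_snd.
have K1w : K w1 by apply: inK => //=; apply: le_trans Phi1; rewrite mulr_ge0 // ltW.
have [w Kw Hw] := usc_max (fun z c _ => uPhi z c) cK (ex_intro _ w1 K1w).
have w10 : 0 <= w.1.1 by case: Kw => -[]; rewrite /= in_itv /= => /andP[].
have w20 : 0 <= w.2.1 by case: Kw => _ []; rewrite /= in_itv /= => /andP[].
have Phiw : 2 * sg <= Phi w by apply: le_trans Phi1 _; exact: Hw.
have Hmax y : 0 <= y.1.1 -> 0 <= y.2.1 -> Phi y <= Phi w.
  move=> y1 y2; have [ph|ph] := leP 0 (Phi y); first by apply: Hw; exact: inK.
  by move: ph Phiw sg0; clear; lra.
have Phiw0 : 0 <= Phi w by move: Phiw sg0; clear; lra.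
have [b1 b2 b3] := bounds w w10 w20 Phiw0.
case: w w10 w20 Phiw Hmax Phiw0 b1 b2 b3 {Kw Hw} => -[t x] [s y] /= t0 s0 Phiw Hmax Phiw0 b1 b2 b3.
have UL : 2 * sg <= U (t, x) - L (s, y).
  move: Phiw; rewrite /Phi /=.
  have := sqr_ge0 (x - y); have := sqr_ge0 (t - s); have := sqr_ge0 t; have := sqr_ge0 x.
  move=> q1 q2 q3 q4.
  have := mulr_ge0 (ltW del0) q1; have := mulr_ge0 (ltW ka0) q2; have := mulr_ge0 (ltW ka0) t0.
  have al0 : 0 <= al by move: al1; clear; lra.
  by have := mulr_ge0 al0 q3; have := mulr_ge0 al0 q4; clear; lra.
(* If [t] or [s] vanished, [t + s] would equal [|t - s|], and the growth bound with [eta = sg] would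
   give [sg <= C2 * (|t - s| + |x - y|)], which the choice of [al] excludes. *)
have pos : 0 < t /\ 0 < s.
  suff : ~ (t + s <= `|t - s|).
    move=> h; split; rewrite lt_neqAle ?t0 ?s0 andbT; apply/eqP => e; apply: h; rewrite -e.
      by rewrite add0r sub0r normrN ler_norm.
    by rewrite addr0 subr0 ler_norm.
  move=> h.
  have h1 := HC2 t s x y t0 s0.
  have h2 : sg <= C2 * (`|t - s| + `|x - y|).
    have : C2 * (t + s + `|x - y|) <= C2 * (`|t - s| + `|x - y|) by apply: ler_wpM2l => //; move: h; clear; lra.
    by move: UL h1; clear; lra.
  have e1 : `|x - y| ^+ 2 = (x - y) ^+ 2 by rewrite real_normK // num_real.
  have e2 : `|t - s| ^+ 2 = (t - s) ^+ 2 by rewrite real_normK // num_real.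
  have h3 : sg ^+ 2 <= C2 ^+ 2 * (2 * ((x - y) ^+ 2 + (t - s) ^+ 2)).
    have h4 : sg ^+ 2 <= (C2 * (`|t - s| + `|x - y|)) ^+ 2 by rewrite ler_sqr ?nnegrE //; [exact: ltW|exact: (le_trans (ltW sg0) h2)].
    apply: (le_trans h4); rewrite exprMn ler_wpM2l ?sqr_ge0 // -e1 -e2.
    by have := sqr_ge0 (`|t - s| - `|x - y|); clear; lra.
  have h5 : al * sg ^+ 2 <= C2 ^+ 2 * 2 * (2 * B).
    have al0 : 0 <= al by move: al1; clear; lra.
    have := ler_wpM2l al0 h3.
    by have := ler_wpM2l (sqr_ge0 C2) b2; clear; lra.
  have h7 : 0 < sg ^+ 2 by rewrite exprn_gt0.
  have h8 : 0 <= C2 ^+ 2 * B by rewrite mulr_ge0 ?sqr_ge0 //; move: B1; clear; lra.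
  by move: h5 h6 h7 h8; clear; lra.
have [t_gt0 s_gt0] := pos.
have [J1 J2] : 2 * al * (t - s) + ka + 2 * ka * t <= H (2 * al * (x - y) + 2 * del * x) /\
    H (2 * al * (x - y)) <= 2 * al * (t - s).
  by apply: (doubling_interior sU sL t_gt0 s_gt0) => t' x' s' y' t'0 s'0; exact: (Hmax ((t', x'), (s', y'))).
have pP : `|2 * al * (x - y)| <= P.
  have al0 : 0 <= 2 * al by move: al1; clear; lra.
  rewrite normrM ger0_norm // ler_wpM2l //.
  apply: sqr_le_abs.
  have : (x - y) ^+ 2 <= al * ((x - y) ^+ 2 + (t - s) ^+ 2).
    have := sqr_ge0 (x - y); have := sqr_ge0 (t - s) => q1 q2.
    have q3 : 0 <= (al - 1) * ((x - y) ^+ 2 + (t - s) ^+ 2) by apply: mulr_ge0; [rewrite subr_ge0|exact: addr_ge0].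
    by move: q1 q2 q3; clear; lra.
  by move: b2; clear; lra.
have eP : `|2 * del * x| <= nu.
  rewrite -ler_sqr ?nnegrE //; last exact: ltW.
  rewrite real_normK ?num_real //; apply: le_trans del1.
  have -> : (2 * del * x) ^+ 2 = 4 * del * (del * x ^+ 2) by ring.
  by rewrite ler_wpM2l // mulr_ge0 // ltW.
have := Hnu _ _ pP eP; have := ler_norm (H (2 * al * (x - y) + 2 * del * x) - H (2 * al * (x - y))).
have : 0 <= 2 * ka * t by rewrite !mulr_ge0 // ltW.
by move: J1 J2; clear; lra.
Qed.

End comparison.

(** * Upper bounds growing linearly in time *)

Section barrier.
Variable R : realType.
Local Notation Q := (@spacetime_pos R).

(** A smooth substitute for [|z|], with slope at most [1] and second derivative between [0] and
    [1 / rho]. *)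
Definition psi (rho z : R) : R := Num.sqrt (rho ^+ 2 + z ^+ 2).

Lemma psi_rad_gt0 (rho z : R) : 0 < rho -> 0 < rho ^+ 2 + z ^+ 2.
Proof. by move=> r0; have := sqr_ge0 z; have : 0 < rho ^+ 2 by [rewrite exprn_gt0]; lra. Qed.

Lemma psi_gt0 (rho z : R) : 0 < rho -> 0 < psi rho z.
Proof. by move=> r0; rewrite sqrtr_gt0 psi_rad_gt0. Qed.

Lemma sqr_psi (rho z : R) : 0 < rho -> psi rho z ^+ 2 = rho ^+ 2 + z ^+ 2.
Proof. by move=> r0; rewrite sqr_sqrtr // ltW // psi_rad_gt0. Qed.

Lemma psi_ge_abs (rho z : R) : 0 < rho -> `|z| <= psi rho z.
Proof.
move=> r0; rewrite -ler_sqr ?nnegrE ?normr_ge0 //; last exact/ltW/psi_gt0.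
by rewrite sqr_psi // real_normK ?num_real // lerDr sqr_ge0.
Qed.

Lemma psi_ge_rho (rho z : R) : 0 < rho -> rho <= psi rho z.
Proof.
move=> r0; rewrite -ler_sqr ?nnegrE ?(ltW r0) //; last exact/ltW/psi_gt0.
by rewrite sqr_psi // lerDl sqr_ge0.
Qed.

Lemma psi0 (rho : R) : 0 < rho -> psi rho 0 = rho.
Proof. by move=> r0; rewrite /psi expr0n /= addr0 sqrtr_sqr gtr0_norm. Qed.

Lemma is_derive_psi (rho z : R) : 0 < rho ->
  is_derive z 1 (psi rho) (z / psi rho z).
Proof.
move=> r0; have h := is_derive1_sqrt (psi_rad_gt0 z r0).
have h2 : is_derive z 1 (fun z : R => rho ^+ 2 + z ^+ 2) (2 * z).
  by apply: is_derive_eq; rewrite -!/(GRing.scale _ _) /GRing.scale /=; ring.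
have := @is_derive1_comp _ Num.sqrt (fun z : R => rho ^+ 2 + z ^+ 2) z _ _ h h2.
rewrite (_ : _ * (2 * z) = z / psi rho z) //.
by rewrite /psi; field; rewrite gt_eqF // sqrtr_gt0 psi_rad_gt0.
Qed.

Lemma is_derive_psi1 (rho z : R) : 0 < rho ->
  is_derive z 1 (fun z : R => z / psi rho z) (rho ^+ 2 / psi rho z ^+ 3).
Proof.
move=> r0; have p0 := psi_gt0 z r0.
have h := is_deriveV (lt0r_neq0 p0) (is_derive_psi z r0).
have := is_deriveM (is_derive_id z (1 : R)) h.
rewrite (_ : _ + _ = rho ^+ 2 / psi rho z ^+ 3) //.
have -> : rho ^+ 2 = psi rho z ^+ 2 - z ^+ 2 by rewrite sqr_psi //; ring.
rewrite -!/(GRing.scale _ _) /GRing.scale /=.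
by field; rewrite gt_eqF.
Qed.

Lemma continuous_psi2 (rho : R) : 0 < rho ->
  continuous (fun z : R => rho ^+ 2 / psi rho z ^+ 3).
Proof.
move=> r0 z; apply: cvgM; first exact: cvg_cst.
apply: cvgV; first by rewrite expf_eq0 /= gt_eqF // psi_gt0.
apply: (@continuous_comp _ _ _ (psi rho) (fun y : R => y ^+ 3)); last exact: exprn_continuous.
exact: is_derive_continuous (is_derive_psi z r0).
Qed.

Lemma psi1_le1 (rho z : R) : 0 < rho -> `|z / psi rho z| <= 1.
Proof.
move=> r0; have p0 := psi_gt0 z r0.
by rewrite normrM normfV (gtr0_norm p0) ler_pdivrMr // mul1r psi_ge_abs.
Qed.

Lemma psi2_bound (rho z : R) : 0 < rho ->
  0 <= rho ^+ 2 / psi rho z ^+ 3 <= rho^-1.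
Proof.
move=> r0; have p0 := psi_gt0 z r0; apply/andP; split.
  by rewrite divr_ge0 // ?sqr_ge0 // exprn_ge0 // ltW.
rewrite ler_pdivrMr ?exprn_gt0 // mulrC ler_pdivlMr //.
rewrite -exprSr lerXn2r ?nnegrE ?(ltW r0) ?(ltW p0) //; exact: psi_ge_rho.
Qed.

Lemma near_fst_gt (t1 : R) (z : R * R) : t1 < z.1 -> \forall y \near z, t1 < y.1.
Proof.
move=> tz; have oQ : open (fst @^-1` [set x : R | t1 < x] : set (R * R)).
  by apply: open_comp => [x _|]; [exact: cvg_fst | exact: open_gt].
exact: (open_nbhs_nbhs (conj oQ tz)).
Qed.

(** Contact points are interior, so values at times [t <= 0] can be modified freely; this allows the
    extension by the initial value. *)
Lemma subsol_ext (A H W : R -> R) (u v : R * R -> R) :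
  (forall z, Q z -> u z = v z) -> subsol A H W u -> subsol A H W v.
Proof.
move=> uv su z0 phi Qz C n; apply: su => //.
have nQ : \forall y \near z0, Q y := open_nbhs_nbhs (conj (@open_spacetime_pos R) Qz).
by apply: filterS2 nQ n => z Qz'; rewrite !uv.
Qed.

(** The penalization by [gam t^2 + del x^2] confines the maximum; its gradient
    at the maximum vanishes with [del]. *)
Lemma barrier (A H W : R -> R) (v : R * R -> R) (t1 y B C rho C0 Hm W0 K : R) :
  usc v -> subsol A H W v -> 0 <= t1 -> 0 < rho -> 0 <= C -> 0 <= C0 ->
  (forall t x, t1 <= t -> v (t, x) <= v (t1, x) + C0 * (1 + t)) ->
  (forall x, v (t1, x) <= B + C * psi rho (x - y)) ->
  (forall x, 0 <= A x <= 1) -> (forall x, W x <= W0) ->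
  (forall p, `|p| <= C + 1 -> H p <= Hm) ->
  K = C / rho + 1 + Hm + W0 -> 0 <= K ->
  forall t x, t1 <= t -> v (t, x) <= B + C * psi rho (x - y) + K * (t - t1).
Proof.
move=> uv sv t10 r0 C_0 C00 gr ini A01 WW HH EK K0 t2 x2 t12.
rewrite leNgt; apply/negP => lt.
pose sg := (v (t2, x2) - (B + C * psi rho (x2 - y) + K * (t2 - t1))) / 2.
have sg0 : 0 < sg by rewrite /sg; move: lt; clear; lra.
have esg : v (t2, x2) = (B + C * psi rho (x2 - y) + K * (t2 - t1)) + 2 * sg.
  by rewrite /sg; clear; lra.
clearbody sg.
pose gam := sg / (2 * (1 + t2 ^+ 2)).
have d1 : 0 < 2 * (1 + t2 ^+ 2) by have := sqr_ge0 t2; clear; lra.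
have gam0 : 0 < gam by rewrite divr_gt0.
have egam : gam * t2 ^+ 2 <= sg / 2.
  have : gam * (2 * (1 + t2 ^+ 2)) = sg by rewrite divfK // gt_eqF.
  by move: gam0; clear; lra.
clearbody gam.
(* The constant for which completing the square gives [C0 * (1 + t) <= gam * t ^+ 2 / 2 + B0], so
   that the time penalty dominates the assumed growth. *)
pose B0 := C0 + C0 ^+ 2 / (2 * gam).
have B00 : 0 <= B0.
  by rewrite addr_ge0 // divr_ge0 // ?sqr_ge0 // mulr_ge0 // ltW.
have HB0 t : C0 * (1 + t) <= gam * t ^+ 2 / 2 + B0.
  have h1 : 0 <= gam * (t - C0 / gam) ^+ 2 by rewrite mulr_ge0 // ?sqr_ge0 // ltW.
  have h2 : gam * (t - C0 / gam) ^+ 2 = gam * t ^+ 2 - 2 * C0 * t + 2 * (C0 ^+ 2 / (2 * gam)).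
    by field; rewrite gt_eqF.
  by move: h1; rewrite h2 /B0; clear; lra.
clearbody B0.
(* As [del * x ^+ 2 <= B0] at the maximum, the first entry bounds the penalty slope [2 * del * x] by
   [1] and its second derivative by [1 / 2]: these are covered by the [1] in [C + 1] and the [1] in
   [K]. The second entry controls the cost at [x2]. *)
pose del := Num.min (1 / (4 * B0 + 4)) (sg / (2 * (1 + x2 ^+ 2))).
have d2 : 0 < 2 * (1 + x2 ^+ 2) by have := sqr_ge0 x2; clear; lra.
have d3 : 0 < 4 * B0 + 4 by move: B00; clear; lra.
have del0 : 0 < del by rewrite lt_min !divr_gt0.
have del1 : del * (4 * B0 + 4) <= 1.
  have : del <= 1 / (4 * B0 + 4) by rewrite ge_min lexx.
  by rewrite ler_pdivlMr.
have del2 : del * x2 ^+ 2 <= sg / 2.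
  have : del <= sg / (2 * (1 + x2 ^+ 2)) by rewrite ge_min lexx orbT.
  by rewrite ler_pdivlMr //; move: del0; clear; lra.
clearbody del.
pose Phi (z : R * R) := v z - (B + C * psi rho (z.2 - y) + K * (z.1 - t1) + gam * z.1 ^+ 2 + del * z.2 ^+ 2).
have bounds t x : t1 <= t -> 0 <= Phi (t, x) ->
    gam * t ^+ 2 <= 2 * B0 /\ del * x ^+ 2 <= B0.
  move=> tt; rewrite /Phi /= => ph.
  have h1 := gr t x tt; have h2 := ini x; have h3 := HB0 t.
  have h4 : 0 <= K * (t - t1) by rewrite mulr_ge0 // subr_ge0.
  have h5 : 0 <= gam * t ^+ 2 by rewrite mulr_ge0 ?sqr_ge0 // ltW.
  have h6 : 0 <= del * x ^+ 2 by rewrite mulr_ge0 ?sqr_ge0 // ltW.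
  by move: ph h1 h2 h3 h4 h5 h6; clear; lra.
pose rr := (2 * B0 / gam + 1) + (B0 / del + 1) + t2 + `|x2|.
pose K1 : set (R * R) := `[t1, rr] `*` `[- rr, rr].
have cK : compact K1 by apply: compact_setX; exact: segment_compact.
have inK t x : t1 <= t -> 0 <= Phi (t, x) -> K1 (t, x).
  move=> tt ph; have [b1 b2] := bounds t x tt ph.
  have a1 : `|t| <= 2 * B0 / gam + 1.
    by apply: sqr_le_abs; rewrite ler_pdivlMr // mulrC.
  have a2 : `|x| <= B0 / del + 1.
    by apply: sqr_le_abs; rewrite ler_pdivlMr // mulrC.
  move: a1 a2; rewrite !ler_norml => /andP[a1 a1'] /andP[a2 a2'].
  have n1 := normr_ge0 x2.
  have p1 : 0 <= 2 * B0 / gam by rewrite divr_ge0 ?mulr_ge0 // ltW.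
  have p2 : 0 <= B0 / del by rewrite divr_ge0 // ltW.
  by split; rewrite /= in_itv /= /rr; apply/andP; split; move: tt a1 a1' a2 a2' n1 p1 p2 t12 t10; clear; lra.
have Phi2 : sg <= Phi (t2, x2).
  by rewrite /Phi /= esg; move: egam del2; clear; lra.
have uPhi : usc Phi.
  apply: uscD => //; apply: continuous_usc => z.
  apply: cvgN.
  apply: cvgD; last first.
    apply: cvgM; first exact: cvg_cst.
    by apply: (@continuous_at_snd _ (fun y => y ^+ 2)); exact: exprn_continuous.
  apply: cvgD; last first.
    apply: cvgM; first exact: cvg_cst.
    by apply: (@continuous_at_fst _ (fun y => y ^+ 2)); exact: exprn_continuous.
  apply: cvgD; last first.
    by apply: cvgM; [exact: cvg_cst|apply: cvgB; [exact: cvg_fst|exact: cvg_cst]].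
  apply: cvgD; first exact: cvg_cst.
  apply: cvgM; first exact: cvg_cst.
  apply: (@continuous_at_snd _ (fun x => psi rho (x - y))).
  apply: (@continuous_comp _ _ _ (fun x : R => x - y) (psi rho)); last exact: is_derive_continuous (is_derive_psi _ r0).
  by apply: cvgB; [exact: cvg_id|exact: cvg_cst].
have Phi20 : 0 <= Phi (t2, x2) by exact: le_trans (ltW sg0) Phi2.
have [[t x] Kw Hw] := usc_max (fun z c _ => uPhi z c) cK (ex_intro _ _ (inK _ _ t12 Phi20)).
have tt1 : t1 <= t by case: Kw; rewrite /= in_itv /= => /andP[].
have Phiw : sg <= Phi (t, x) by apply: le_trans Phi2 _; apply: Hw; exact: inK.
have Hmax t' x' : t1 <= t' -> Phi (t', x') <= Phi (t, x).
  move=> t1'; have [ph|ph] := leP 0 (Phi (t', x')); first by apply: Hw; exact: inK.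
  by apply/ltW/(lt_trans ph); exact: lt_le_trans sg0 Phiw.
have [b1 b2] := bounds t x tt1 (le_trans (ltW sg0) Phiw).
have tt : t1 < t.
  rewrite lt_neqAle tt1 andbT; apply/eqP => e; rewrite -e in Phiw.
  have := Phiw; rewrite /Phi /= subrr mulr0 addr0 => {}Phiw.
  have h5 : 0 <= gam * t1 ^+ 2 by rewrite mulr_ge0 ?sqr_ge0 // ltW.
  have h6 : 0 <= del * x ^+ 2 by rewrite mulr_ge0 ?sqr_ge0 // ltW.
  by have h7 := ini x; move: h5 h6 h7 Phiw sg0; clear; lra.
have t0 : 0 < t by exact: le_lt_trans t10 tt.
have Qz : Q (t, x) by [].
have Qcst : Cn 2 Q (fun=> B - K * t1 : R) := Cn_cst (@open_spacetime_pos R) 2 _.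
have dt0 (z : R * R) : dt (fun=> B - K * t1 : R) z = 0 by rewrite /dt derive_cst.
have dx0 : dx (fun=> B - K * t1 : R) = (fun=> 0) by apply/funext => z; rewrite /dx derive_cst.
have dx00 (z : R * R) : dx (fun=> 0 : R) z = 0 by rewrite /dx derive_cst.
pose h x := C * psi rho (x - y) + quad del 0 x.
pose h1 x := C * ((x - y) / psi rho (x - y)) + (2 * del * x + 0).
pose h2 x := C * (rho ^+ 2 / psi rho (x - y) ^+ 3) + 2 * del.
have sh (f f1 : R -> R) (x' : R) : is_derive (x' - y) 1 f (f1 (x' - y)) ->
    is_derive x' 1 (fun x => C * f (x - y)) (C * f1 (x' - y)).
  move=> df; have d : is_derive x' 1 (fun x : R => x - y) 1.
    by apply: is_derive_eq; rewrite subr0.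
  have := is_deriveZ C (@is_derive1_comp _ f (fun x : R => x - y) x' _ _ df d).
  by rewrite mulr1.
have dh (x' : R) : is_derive x' 1 h (h1 x').
  by apply: is_deriveD (is_derive_quad del 0 x'); apply: (sh _ (fun z => z / psi rho z)); exact: is_derive_psi.
have dh1 (x' : R) : is_derive x' 1 h1 (h2 x').
  apply: is_deriveD (is_derive_quad1 del 0 x').
  by apply: (sh (fun z => z / psi rho z) (fun z => rho ^+ 2 / psi rho z ^+ 3)); exact: is_derive_psi1.
have ch2 : continuous h2.
  move=> x'; apply: cvgD; last exact: cvg_cst.
  apply: cvgM; first exact: cvg_cst.
  apply: (@continuous_comp _ _ _ (fun z : R => z - y) (fun z => rho ^+ 2 / psi rho z ^+ 3)); last exact: continuous_psi2.
  by apply: cvgB; [exact: cvg_id|exact: cvg_cst].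
have ccst (c : R) : continuous (fun _ : R => c) by move=> ?; exact: cst_continuous.
have [Cphi e1 e2 e3] := Cn2_add Qcst Qz
  (is_derive_quad gam K) (is_derive_quad1 gam K) (ccst _) dh dh1 ch2.
have := sv _ _ Qz Cphi.
rewrite /equation_rhs e1 e2 e3 dt0 !dx0 dx00 /= => I.
have {}I : 2 * gam * t + K <= A x * h2 x + H (h1 x) + W x.
  rewrite -[2 * gam * t + K]add0r -[h2 x]add0r -[h1 x]add0r; apply: I.
  have nQ : \forall z \near ((t, x) : R * R), t1 < z.1.
    exact: near_fst_gt.
  apply: filterS nQ => -[t' x'] /= t1'.
  have := Hmax t' x' (ltW t1'); rewrite /Phi /quad /h /quad /=.
  by clear; lra.
have g1 : `|h1 x| <= C + 1.
  rewrite /h1 addr0; apply: (le_trans (ler_normD _ _)); apply: lerD.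
    by rewrite normrM ger0_norm // ler_piMr // psi1_le1.
  rewrite -ler_sqr ?nnegrE // expr1n real_normK ?num_real //.
  have -> : (2 * del * x) ^+ 2 = 4 * del * (del * x ^+ 2) by ring.
  have q : 4 * del * (del * x ^+ 2) <= 4 * del * B0 by rewrite ler_wpM2l // mulr_ge0 // ltW.
  by move: q del1 del0; clear; lra.
have g2 : A x * h2 x <= C / rho + 1 / 2.
  have /andP[a0 a1] := A01 x; have /andP[q0 q1] := psi2_bound (x - y) r0.
  have q2 : h2 x <= C / rho + 1 / 2.
    rewrite /h2; apply: lerD; first by rewrite ler_wpM2l.
    have q : 0 <= del * B0 by rewrite mulr_ge0 // ltW.
    by move: del1 q; clear; lra.
  have q3 : 0 <= h2 x by apply: addr_ge0; apply: mulr_ge0 => //; exact: ltW.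
  by apply: le_trans q2; rewrite ler_piMl.
have g3 := HH _ g1; have g4 := WW x.
have g5 : 0 <= 2 * gam * t by rewrite !mulr_ge0 // ltW.
by move: I g2 g3 g4 g5; rewrite EK; clear; lra.
Qed.

End barrier.

(** * The perturbed test function method *)

Section relaxed_limits.
Variable R : realType.
Local Notation Q := (@spacetime_pos R).
Implicit Types (u : R -> R * R -> R) (z : R * R).

Definition ubound_near u z (M : R) : Prop :=
  \forall y \near z & e \near (0 : R)^'+, u e y <= M.

(** The half-relaxed limit, that is, the limsup of [u e y] as [y] tends to [z] and [e] to [0] from
    the right, jointly. *)
Definition upper_limit u z : R := inf [set M | ubound_near u z M].

(** Ensures that the infimum in [upper_limit] is taken over a nonempty set bounded below. *)
Definition locally_bounded_family u : Prop :=
  forall z, exists M, \forall y \near z & e \near (0 : R)^'+, `|u e y| <= M.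

Lemma has_inf_ubound u z : locally_bounded_family u ->
  has_inf [set M | ubound_near u z M].
Proof.
move=> lb; have [M HM] := lb z; split.
  by exists M; apply: filterS HM => y; exact: le_trans (ler_norm _).
exists (- M) => N /= HN.
have [[y e] /= [h1 h2]] := filter_ex (filterI HM HN).
by apply: le_trans h2; rewrite lerNl; apply: le_trans h1; rewrite -normrN ler_norm.
Qed.

Lemma upper_limit_lt u z c : locally_bounded_family u -> upper_limit u z < c ->
  \forall y \near z & e \near (0 : R)^'+, u e y < c.
Proof.
move=> lb H; have [M /= HM Mc] := inf_lt (proj1 (has_inf_ubound z lb)) H.
by apply: filterS HM => -[y e] /= h; exact: le_lt_trans Mc.
Qed.

Lemma upper_limit_le u z c : locally_bounded_family u -> ubound_near u z c ->
  upper_limit u z <= c.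
Proof. by move=> lb H; apply: ge_inf => //; case: (has_inf_ubound z lb). Qed.

Lemma upper_limit_usc u : locally_bounded_family u -> usc (upper_limit u).
Proof.
move=> lb z c H.
pose c' := (upper_limit u z + c) / 2.
have [h1 h2] : upper_limit u z < c' /\ c' < c by rewrite /c'; split; lra.
have [[N E] /= [HN HE] NE] := upper_limit_lt lb h1.
apply: filterS (nbhs_interior HN) => y Hy; apply: le_lt_trans h2.
apply: upper_limit_le => //; exists (N, E) => //= -[y' e] /= [h3 h4].
by apply: ltW; exact: (NE (y', e)).
Qed.

(** Replaces the extraction of a sequence realizing the half-relaxed limit: a single point and
    parameter satisfying all eventual properties are enough. *)
Lemma upper_limit_gt u z c (P : R * R -> Prop) (P' : R -> Prop) :
  locally_bounded_family u -> c < upper_limit u z ->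
  (\forall y \near z, P y) -> (\forall e \near (0 : R)^'+, P' e) ->
  exists y e, [/\ P y, P' e & c < u e y].
Proof.
move=> lb H HP HP'; apply: contrapT => no.
suff : upper_limit u z <= c by rewrite leNgt H.
apply: upper_limit_le => //; exists (P, P') => // -[y e] /= [Py Pe].
by rewrite leNgt; apply/negP => h; apply: no; exists y, e.
Qed.

(** The upper bound is required only near [x0]: in the flat part of the
    effective Hamiltonian, [e * F (x / e)] has a kink at [x0]. *)
Definition upper_corrector (A H W : R -> R) (hb p x0 : R) : Prop :=
  forall eta : R, 0 < eta -> exists M : R, forall r : R, 0 < r -> exists2 rho : R, 0 < rho &
  \forall e \near (0 : R)^'+, exists F F1 F2 : R -> R,
  [/\ [/\ forall y : R, is_derive y 1 F (F1 y), forall y : R, is_derive y 1 F1 (F2 y) &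
          continuous F2],
      forall y, `|F1 y| <= M,
      forall y, `|A y * F2 y + H (F1 y) + W y - hb| <= eta,
      forall x, `|x - x0| <= 1 -> p * (x - x0) - r <= e * F (x / e) &
      forall x, `|x - x0| <= rho -> e * F (x / e) <= p * (x - x0) + r].

Lemma is_derive_shrink (e x d : R) (F : R -> R) : 0 < e ->
  is_derive (x / e) 1 F d -> is_derive x 1 (fun y => F (y / e)) (d / e).
Proof.
move=> e0 dF; have d2 : is_derive x 1 (fun y : R => y / e) e^-1.
  by apply: is_derive_eq; rewrite -!/(GRing.scale _ _) /GRing.scale /=; ring.
exact: (@is_derive1_comp _ F (fun y : R => y / e) x _ _ dF d2).
Qed.

Lemma near_box z (P : R * R -> Prop) : (\forall y \near z, P y) ->
  exists2 r : R, 0 < r & forall y, `|y.1 - z.1| <= r -> `|y.2 - z.2| <= r -> P y.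
Proof.
move=> [[N E] /= [/nbhs_normP[r1 /= r10 HN] /nbhs_normP[r2 /= r20 HE]] NE].
exists (Num.min r1 r2 / 2); first by rewrite divr_gt0 // lt_min r10 r20.
have m0 : 0 < Num.min r1 r2 by rewrite lt_min r10 r20.
move=> [y1 y2] /= h1 h2; apply: NE; split => /=; [apply: HN|apply: HE] => /=.
- rewrite distrC; apply: (le_lt_trans h1); have : Num.min r1 r2 <= r1 by rewrite ge_min lexx.
  by move: m0; clear; lra.
- rewrite distrC; apply: (le_lt_trans h2); have : Num.min r1 r2 <= r2 by rewrite ge_min lexx orbT.
  by move: m0; clear; lra.
Qed.

Lemma box_near z (r : R) : 0 < r ->
  \forall y \near z, `|y.1 - z.1| < r /\ `|y.2 - z.2| < r.
Proof.
move=> r0; exists (ball z.1 r, ball z.2 r) => /=; first by split; exact: nbhsx_ballx.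
by move=> [y1 y2] [] /=; rewrite /ball /= => h1 h2; split; rewrite distrC.
Qed.


Lemma near_shift_le (f : R * R -> R) z (c d : R) : {for z, continuous f} ->
  `|f z - c| < d -> \forall y \near z, `|f y - c| <= d.
Proof.
move=> fc H; pose e := d - `|f z - c|.
have e0 : 0 < e by rewrite subr_gt0.
have nz := @cvgr_dist_le _ _ _ _ (nbhs_filter z) f (f z) fc e e0.
apply: filterS nz => y Hy.
have -> : f y - c = (f z - c) - (f z - f y) by ring.
apply: (le_trans (ler_normB _ _)); move: Hy; rewrite /e; clear; lra.
Qed.

(** The test function is corrected by [e * F (x / e)] minus its linear part. The second derivative
    of the correction has size [1 / e], which the factor [e] of the diffusion compensates, so that
    at a nearby contact point the equation of [u e] reads [Hb p] up to small errors. The square of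
    the distance to [z0] makes the contact strict. *)
Lemma upper_limit_subsol (A H W Hb : R -> R) u :
  (forall x, 0 <= A x <= 1) -> continuous H ->
  (forall p x0, upper_corrector A H W (Hb p) p x0) ->
  locally_bounded_family u ->
  (forall e, 0 < e -> usc (u e)) ->
  (forall e, 0 < e -> subsol (fun x => e * A (x / e)) H (fun x => W (x / e)) (u e)) ->
  subsol (fun=> 0) Hb (fun=> 0) (upper_limit u).
Proof.
move=> A01 Hc AC lb uu su z0 phi Qz Cphi nmax.
have phic : forall z, Q z -> {for z, continuous phi} := Cphi.1.
have [_ Ct Cx] := Cphi.2.
have phitc : forall z, Q z -> {for z, continuous (dt phi)} := Ct.1.
have phixc : forall z, Q z -> {for z, continuous (dx phi)} := Cx.1.
have phixxc : forall z, Q z -> {for z, continuous (dx (dx phi))}.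
  by have [_ _ Cxx] := Cx.2; exact: Cxx.1.
clear Ct Cx.
rewrite /equation_rhs mul0r add0r addr0 leNgt; apply/negP => lt.
(* Five errors of size at most [eta] are added at the end: the corrector, the modulus of [H], the
   second derivative of [phi], the variation of [dt phi] and the derivative of the square in
   time. *)
pose q := dt phi z0; pose p := dx phi z0; pose eta := (q - Hb p) / 6.
have eta0 : 0 < eta by rewrite /eta divr_gt0 // subr_gt0.
have eq : q = Hb p + 6 * eta by rewrite /eta; clear; lra.
have [M HM] := AC p z0.2 eta eta0.
have [nu nu0 Hnu] := continuous_unif_itv M Hc eta0.
pose D := `|dx (dx phi) z0| + 1.
have D0 : 0 <= D by rewrite addr_ge0.
have nb : \forall z \near z0, [/\ Q z, `|dt phi z - q| <= eta, `|dx phi z - p| <= nu / 2,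
    `|dx (dx phi) z - 0| <= D & upper_limit u z - phi z <= upper_limit u z0 - phi z0].
  have n1 : \forall z \near z0, `|dt phi z - q| <= eta.
    by apply: near_shift_le; [exact: phitc|rewrite subrr normr0].
  have n2 : \forall z \near z0, `|dx phi z - p| <= nu / 2.
    by apply: near_shift_le; [exact: phixc|rewrite subrr normr0 divr_gt0].
  have n3 : \forall z \near z0, `|dx (dx phi) z - 0| <= D.
    by apply: near_shift_le; [exact: phixxc|rewrite subr0 ltrDl].
  have n4 : \forall z \near z0, Q z := open_nbhs_nbhs (conj (@open_spacetime_pos R) Qz).
  apply: filterS3 n1 n2 (filterI n3 (filterI n4 nmax)) => z h1 h2 [h3 [h4 h5]].
  by split.
have [r1 r10 Hr1] := near_box nb.
pose r := Num.min r1 (Num.min 1 (Num.min (eta / 2) (nu / 4))).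
have r0 : 0 < r.
  have h1 : 0 < eta / 2 by rewrite divr_gt0.
  have h2 : 0 < nu / 4 by rewrite divr_gt0.
  by rewrite /r !lt_min r10 ltr01 h1 h2.
have [rr1 [rle1 [reta rnu]]] : r <= r1 /\ (r <= 1 /\ (r <= eta / 2 /\ r <= nu / 4)).
  by rewrite /r !ge_min !lexx !orbT.
clearbody r.
have box z : `|z.1 - z0.1| <= r -> `|z.2 - z0.2| <= r ->
  [/\ Q z, `|dt phi z - q| <= eta, `|dx phi z - p| <= nu / 2,
    `|dx (dx phi) z - 0| <= D & upper_limit u z - phi z <= upper_limit u z0 - phi z0].
  by move=> h1 h2; apply: Hr1; apply: le_trans rr1.
(* The comparison of the competitor [y] with the maximum point [w] will give a squared distance from
   [w] to [z0] below [5 * s], so [w] is interior to the box of radius [r]. *)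
pose s := r ^+ 2 / 8.
have s0 : 0 < s by rewrite divr_gt0 // exprn_gt0.
have es : r ^+ 2 = 8 * s by rewrite /s; clear; lra.
clearbody s.
pose m := upper_limit u z0 - phi z0.
have [rho rho0 Hrho] := HM s s0.
pose K : set (R * R) := `[z0.1 - r, z0.1 + r] `*` `[z0.2 - r, z0.2 + r].
have inK z : K z <-> `|z.1 - z0.1| <= r /\ `|z.2 - z0.2| <= r.
  by rewrite /K /setX /= !in_itv /= !ler_distl.
have cK : compact K by apply: compact_setX; exact: segment_compact.
have bnd : \forall e \near (0 : R)^'+, forall z, K z -> u e z - phi z <= m + s.
  have /compact_near_coveringP ncK := cK.
  apply: (ncK _ _ (fun e z => u e z - phi z <= m + s)) => z /inK [h1 h2].
  have [Qz' _ _ _ hm] := box z h1 h2.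
  have l1 : upper_limit u z < m + phi z + s / 2 by move: hm s0; rewrite /m; clear; lra.
  have n1 := upper_limit_lt lb l1.
  have n2 : \forall y \near z, `|phi y - phi z| <= s / 2.
    by apply: near_shift_le; [exact: phic|rewrite subrr normr0 divr_gt0].
  have n3 : \forall y \near z & e \near (0 : R)^'+, `|phi y - phi z| <= s / 2.
    by exists ([set y | `|phi y - phi z| <= s / 2], setT) => /=; [split => //; exact: filterT|move=> [y e] []].
  apply: filterS2 n1 n3 => -[y e] /= k1 k2.
  have := le_trans (ler_norm _) k2; have : phi z - phi y <= s / 2 by apply: le_trans k2; rewrite distrC ler_norm.
  by move: k1; clear; lra.
(* [D] bounds the second derivative of [phi] in the box and [2] is that of the added square; both
   enter the equation multiplied by [e]. *)
have sml : \forall e \near (0 : R)^'+, 0 < e /\ e * (D + 2) <= eta.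
  near=> e; split; first by near: e; exact: nbhs_right_gt.
  have : e <= eta / (D + 2).
    by near: e; apply: nbhs_right_le; rewrite divr_gt0 // ltr_wpDl.
  by rewrite ler_pdivlMr // ltr_wpDl.
have l2 : upper_limit u z0 - s / 2 < upper_limit u z0 by move: s0; clear; lra.
(* The competitor lies within [rho] of [z0.2]: this is the only place where the upper bound on the
   corrector is used. *)
pose P1 (y : R * R) := [/\ `|y.1 - z0.1| < r /\ `|y.2 - z0.2| < r, `|y.2 - z0.2| <= rho,
  (y.1 - z0.1) ^+ 2 + (y.2 - z0.2) ^+ 2 <= s & phi y <= phi z0 + s / 2].
have nP1 : \forall y \near z0, P1 y.
  have n1 := box_near z0 r0.
  have n2 := box_near z0 rho0.
  pose f (y : R * R) := (y.1 - z0.1) ^+ 2 + (y.2 - z0.2) ^+ 2.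
  have fc : {for z0, continuous f}.
    apply: cvgD.
      apply: (@continuous_at_fst _ (fun t => (t - z0.1) ^+ 2)).
      by apply: is_derive_continuous; apply: is_derive_eq.
    apply: (@continuous_at_snd _ (fun t => (t - z0.2) ^+ 2)).
    by apply: is_derive_continuous; apply: is_derive_eq.
  have n3 : \forall y \near z0, `|f y - 0| <= s.
    by apply: near_shift_le => //; rewrite /f !subrr expr0n /= addr0 subrr normr0.
  have n4 : \forall y \near z0, `|phi y - phi z0| <= s / 2.
    by apply: near_shift_le; [exact: phic|rewrite subrr normr0 divr_gt0].
  apply: filterS3 n1 n2 (filterI n3 n4) => y k1 [_ k2] [k3 k4]; split => //.
  - exact: ltW.
  - by move: k3; rewrite subr0; exact: le_trans (ler_norm _).
  - by have := le_trans (ler_norm _) k4; clear; lra.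
have nP2 : \forall e \near (0 : R)^'+, [/\ 0 < e /\ e * (D + 2) <= eta,
   (forall z, K z -> u e z - phi z <= m + s) &
      exists F F1 F2 : R -> R,
  [/\ [/\ forall y : R, is_derive y 1 F (F1 y), forall y : R, is_derive y 1 F1 (F2 y) &
          continuous F2],
      forall y, `|F1 y| <= M,
      forall y, `|A y * F2 y + H (F1 y) + W y - Hb p| <= eta,
      forall x, `|x - z0.2| <= 1 -> p * (x - z0.2) - s <= e * F (x / e) &
      forall x, `|x - z0.2| <= rho -> e * F (x / e) <= p * (x - z0.2) + s]].
  by apply: filterS3 sml bnd Hrho => e k1 k2 k3; split.
have [y [e [[[yr1 yr2] yrho ys yphi] [[e0 eD] eK [F [F1 [F2 [[dF dF1 cF2] FM Feq Flo Fhi]]]]] ule]]] :=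
  upper_limit_gt lb l2 nP1 nP2.
clear nP1 nP2 sml bnd nb Hr1 Hrho HM.
pose h x := e * F (x / e) - p * x + p * z0.2 + (x ^+ 2 - 2 * z0.2 * x + z0.2 ^+ 2).
pose h1 x := F1 (x / e) - p + (2 * x - 2 * z0.2).
pose h2 x := F2 (x / e) / e + 2.
have dh (x : R) : is_derive x 1 h (h1 x).
  have d1 := is_derive_shrink e0 (dF (x / e)).
  apply: is_derive_eq.
  rewrite -!/(GRing.scale _ _) /GRing.scale /= /h1; field; exact: lt0r_neq0.
have dh1 (x : R) : is_derive x 1 h1 (h2 x).
  have d1 := is_derive_shrink e0 (dF1 (x / e)).
  apply: is_derive_eq.
  rewrite -!/(GRing.scale _ _) /GRing.scale /= /h2; field; exact: lt0r_neq0.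
have ch2 : continuous h2.
  move=> x; apply: cvgD; last exact: cvg_cst.
  apply: cvgM; last exact: cvg_cst.
  apply: (@continuous_comp _ _ _ (fun x : R => x / e) F2); last exact: cF2.
  by apply: cvgM; [exact: cvg_id|exact: cvg_cst].
have ccst (c : R) : continuous (fun _ : R => c) by move=> ?; exact: cst_continuous.
pose k t := quad 1 (- 2 * z0.1) t.
have Qcst : Cn 2 Q (fun=> 0 : R) := Cn_cst (@open_spacetime_pos R) 2 _.
pose c0 := z0.1 ^+ 2.
have dk (t : R) : is_derive t 1 (fun t => k t + c0) (2 * 1 * t + - 2 * z0.1).
  have := is_deriveD (is_derive_quad 1 (- 2 * z0.1) t) (is_derive_cst c0 t 1).
  by rewrite addr0.
have [Cpsi _ _ _] := Cn2_add Cphi Qz dk (is_derive_quad1 1 (- 2 * z0.1)) (ccst _) dh dh1 ch2.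
pose pp (z : R * R) := phi z + (k z.1 + c0 + h z.2).
have ppE z : pp z = phi z + ((z.1 - z0.1) ^+ 2 + (z.2 - z0.2) ^+ 2) + (e * F (z.2 / e) - p * (z.2 - z0.2)).
  by rewrite /pp /k /quad /h /c0; ring.
have uK z c : K z -> u e z - pp z < c -> \forall y \near z, u e y - pp y < c.
  move=> /inK [h3 h4]; have [Qz' _ _ _ _] := box z h3 h4.
  pose d := (c - (u e z - pp z)) / 2 => hc.
  have d0 : 0 < d by rewrite /d; move: hc; clear; lra.
  have ed : c = u e z - pp z + 2 * d by rewrite /d; clear; lra.
  have n1 := uu e e0 z (u e z + d) ltac:(move: d0; clear; lra).
  have n2 : \forall y \near z, `|pp y - pp z| <= d.
    by apply: near_shift_le; [exact: Cpsi.1|rewrite subrr normr0].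
  apply: filterS2 n1 n2 => y' k1 k2; rewrite ed.
  have := ler_norm (pp z - pp y'); rewrite distrC => k3.
  by move: k1 k2 k3; clear; lra.
have yK : K y by apply/inK; split; exact: ltW.
have [w Kw wmax] := usc_max uK cK (ex_intro _ y yK).
have /inK [wr1 wr2] := Kw.
have [Qw wt wx wxx _] := box w wr1 wr2.
have wy := wmax y yK; have wm := eK w Kw; have wF := Flo w.2 (le_trans wr2 rle1).
have yF := Fhi y.2 yrho.
have sq : (w.1 - z0.1) ^+ 2 + (w.2 - z0.2) ^+ 2 < r ^+ 2.
  rewrite es; move: wy wm wF yF ys yphi ule s0; rewrite !ppE /m; clear; lra.
have wi : `|w.1 - z0.1| < r /\ `|w.2 - z0.2| < r.
  have e1 : `|w.1 - z0.1| ^+ 2 = (w.1 - z0.1) ^+ 2 by rewrite real_normK // num_real.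
  have e2 : `|w.2 - z0.2| ^+ 2 = (w.2 - z0.2) ^+ 2 by rewrite real_normK // num_real.
  have q1 := sqr_ge0 (w.1 - z0.1); have q2 := sqr_ge0 (w.2 - z0.2).
  by split; rewrite -ltr_sqr ?nnegrE ?normr_ge0 ?(ltW r0) // ?e1 ?e2; move: sq q1 q2; clear; lra.
have nw : \forall z \near w, K z.
  have w1 : 0 < Num.min (r - `|w.1 - z0.1|) (r - `|w.2 - z0.2|) by rewrite lt_min !subr_gt0 wi.1 wi.2.
  apply: filterS (box_near w w1) => z []; rewrite !lt_min => /andP[a1 _] /andP[_ a2].
  apply/inK; split.
    by rewrite -(subrKA w.1); apply: (le_trans (ler_normD _ _)); move: a1; clear; lra.
  by rewrite -(subrKA w.2); apply: (le_trans (ler_normD _ _)); move: a2; clear; lra.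
have [_ e1 e2 e3] := Cn2_add Cphi Qw dk (is_derive_quad1 1 (- 2 * z0.1)) (ccst _) dh dh1 ch2.
have := su e e0 w _ Qw Cpsi; rewrite /equation_rhs e1 e2 e3 => I.
have {}I := I (@filterS _ _ (nbhs_filter w) _ _ (fun z Kz => wmax z Kz) nw).
have hx1 : `|dx phi w - p + (2 * w.2 - 2 * z0.2)| <= nu.
  have -> : 2 * w.2 - 2 * z0.2 = 2 * (w.2 - z0.2) by ring.
  apply: (le_trans (ler_normD _ _)); rewrite normrM (ger0_norm (ler0n R 2)).
  by move: wx wr2 rnu; clear; lra.
have E1 : dx phi w + h1 w.2 = F1 (w.2 / e) + (dx phi w - p + (2 * w.2 - 2 * z0.2)).
  by rewrite /h1; ring.
have Hd := Hnu _ _ (FM (w.2 / e)) hx1; rewrite -E1 in Hd.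
have E2 : e * A (w.2 / e) * (dx (dx phi) w + h2 w.2) =
   A (w.2 / e) * F2 (w.2 / e) + A (w.2 / e) * (e * (dx (dx phi) w + 2)).
  by rewrite /h2; field; exact: lt0r_neq0.
have /andP[a0 a1] := A01 (w.2 / e).
have g1 : A (w.2 / e) * (e * (dx (dx phi) w + 2)) <= eta.
  have : e * (dx (dx phi) w + 2) <= e * (D + 2).
    rewrite ler_wpM2l ?(ltW e0) // lerD2r; apply: le_trans wxx; rewrite subr0; exact: ler_norm.
  move=> /le_trans /(_ eD) g.
  apply: (le_trans (ler_wpM2l a0 g)); rewrite ler_piMl //; exact: ltW.
have g2 := Feq (w.2 / e).
rewrite E2 in I.
have g3 : - (2 * 1 * w.1 + - 2 * z0.1) <= eta.
  have : - (w.1 - z0.1) <= r by apply: le_trans wr1; rewrite -normrN ler_norm.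
  by move: reta; clear; lra.
have g4 : - (dt phi w - q) <= eta by apply: le_trans wt; rewrite -normrN ler_norm.
have g5 := le_trans (ler_norm _) g2; have g6 := le_lt_trans (ler_norm _) Hd.
by move: I g1 g3 g4 g5 g6 eta0; rewrite eq; clear; lra.
Unshelve. all: by end_near. Qed.

End relaxed_limits.

(** * Uniformly continuous solutions *)

Section uniform.
Variable R : realType.
Implicit Types (u v : R * R -> R) (g : R -> R).

Lemma unif_continuousR g : unif_continuous g <->
  forall e : R, 0 < e -> exists2 d : R, 0 < d &
    forall x y : R, `|x - y| < d -> `|g x - g y| < e.
Proof.
split=> [/unif_continuousP H e e0|H].
  by have [d d0 Hd] := H e e0; exists d => // x y xy; exact: (Hd (x, y)).
apply/unif_continuousP => e e0; have [d d0 Hd] := H e e0.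
by exists d => // -[x y]; exact: Hd.
Qed.

Lemma UC_spacetimeP u : UC_spacetime u <->
  forall e : R, 0 < e -> exists2 d : R, 0 < d &
    forall t s x y : R, 0 <= t -> 0 <= s -> `|t - s| < d -> `|x - y| < d ->
      `|u (t, x) - u (s, y)| < e.
Proof.
split=> [/unif_continuousP H e e0|H].
  have [d d0 Hd] := H e e0; exists d => // t s x y t0 s0 ts xy.
  apply: (Hd ((t, x), (s, y))); rewrite /= /ball /= /subspace_ball.
  by rewrite mem_set.
apply/unif_continuousP => e e0; have [d d0 Hd] := H e e0.
exists d => // -[[t x] [s y]]; rewrite /= [X in X -> _]/ball /= /subspace_ball.
case: ifPn => [/set_mem /= t0 [/= s0 [/= ts xy]]|_ /= [-> ->]].
  exact: Hd.
exact: ballxx.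
Qed.

Lemma UC_growth g : unif_continuous g ->
  forall eta : R, 0 < eta -> exists2 C : R, 0 <= C &
    forall x y : R, `|g x - g y| <= eta + C * `|x - y|.
Proof.
move=> /unif_continuousR H eta eta0; have [d d0 Hd] := H eta eta0.
exists (eta / (d / 2)); first by rewrite divr_ge0 ?divr_ge0 // ltW.
apply: unif_chain; [by rewrite divr_gt0|exact: ltW|].
by move=> a b ab; apply/ltW/Hd; apply: (le_lt_trans ab); move: d0; clear; lra.
Qed.

(** Continuation by the initial value, under which uniform continuity on [spacetime] becomes
    continuity on the whole plane. *)
Definition time_extend u : R * R -> R := fun z => u (Num.max z.1 0, z.2).

Lemma time_extendE u z : 0 <= z.1 -> time_extend u z = u z.
Proof. by case: z => t x /= t0; rewrite /time_extend /= max_l. Qed.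

Lemma dist_max0 (a b : R) : `|Num.max a 0 - Num.max b 0| <= `|a - b|.
Proof.
have [a0|a0] := leP a 0; have [b0|b0] := leP b 0.
- by rewrite subrr normr0.
- by rewrite sub0r normrN ger0_norm ?(ltW b0) // ler_normr; move: a0; clear; lra.
- by rewrite subr0 ger0_norm ?(ltW a0) // ler_normr; move: b0; clear; lra.
- by [].
Qed.

Lemma UC_time_extend u : UC_spacetime u ->
  forall e : R, 0 < e -> exists2 d : R, 0 < d &
    forall z w : R * R, `|z.1 - w.1| < d -> `|z.2 - w.2| < d ->
      `|time_extend u z - time_extend u w| < e.
Proof.
move=> /UC_spacetimeP H e e0; have [d d0 Hd] := H e e0; exists d => // z w h1 h2.
apply: Hd => //; rewrite ?le_max ?lexx ?orbT //; exact: le_lt_trans (dist_max0 _ _) h1.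
Qed.

Lemma UC_time_growth u : UC_spacetime u ->
  forall eta : R, 0 < eta -> exists2 C : R, 0 <= C &
    forall t s x : R, 0 <= t -> 0 <= s -> `|u (t, x) - u (s, x)| <= eta + C * `|t - s|.
Proof.
move=> /UC_time_extend H eta eta0; have [d d0 Hd] := H eta eta0.
exists (eta / (d / 2)); first by rewrite divr_ge0 ?divr_ge0 // ltW.
move=> t s x t0 s0.
rewrite -(time_extendE _ (z := (t, x))) // -(time_extendE _ (z := (s, x))) //.
apply: (@unif_chain _ (fun t => time_extend u (t, x))); [by rewrite divr_gt0|exact: ltW|].
move=> a b ab; apply/ltW/Hd => /=; last by rewrite subrr normr0.
by apply: (le_lt_trans ab); move: d0; clear; lra.
Qed.

Lemma time_extend_continuous u : UC_spacetime u -> continuous (time_extend u).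
Proof.
move=> /UC_time_extend H z; apply/cvgrPdist_lt => e e0; have [d d0 Hd] := H e e0.
exists (ball z.1 d, ball z.2 d) => /=; first by split; exact: nbhsx_ballx.
by move=> w [h1 h2]; exact: Hd.
Qed.

Lemma UC_opp u : UC_spacetime u -> UC_spacetime (fun z => - u z).
Proof.
move=> /UC_spacetimeP H; apply/UC_spacetimeP => e e0; have [d d0 Hd] := H e e0.
exists d => // t s x y t0 s0 ts xy.
by rewrite -opprD normrN; exact: Hd.
Qed.

End uniform.

(** * Scaling, translation and addition of constants *)

Section affine.
Variable R : realType.
Local Notation Q := (@spacetime_pos R).
Implicit Types (A H W : R -> R) (u v phi : R * R -> R) (z : R * R).

Lemma supersol_subsolN A H W v :
  subsol A (fun p => - H (- p)) (fun x => - W x) (fun z => - v z) -> supersol A H W v.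
Proof.
move=> /subsolN; rewrite (_ : (fun p => _) = H); last by apply/funext => p; rewrite !opprK.
rewrite (_ : (fun x => - - W x) = W); last by apply/funext => p; rewrite !opprK.
by rewrite (_ : (fun z => - - v z) = v) //; apply/funext => p; rewrite !opprK.
Qed.

(** One statement for three uses: the scaling [s = eps], the translation by [k] in space, and the
    addition of [c]. The test function is transported by the inverse map [h]. *)
Lemma subsol_affine A H W u (s k c : R) : 0 < s -> subsol A H W u ->
  subsol (fun x => s * A (s^-1 * x + k)) H (fun x => W (s^-1 * x + k))
    (fun z => s * u (s^-1 *: z + (0, k)) + c).
Proof.
move=> s0 su z0 phi Qz C nmax.
have oQ := @open_spacetime_pos R.
have si0 : 0 < s^-1 by rewrite invr_gt0.
have sn0 : s != 0 by exact: lt0r_neq0.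
pose h z : R * R := s *: z + (0, - s * k).
pose h' z : R * R := s^-1 *: z + (0, k).
have hK z : h (h' z) = z.
  case: z => t x; rewrite /h /h' /=; congr pair => /=.
    by rewrite -!/(GRing.scale _ _) /GRing.scale /=; field.
  by rewrite -!/(GRing.scale _ _) /GRing.scale /=; field.
pose psi y := s^-1 * phi (h y).
have Ch : Cn 2 Q (fun y => phi (h y)) := Cn_affine (- s * k) s0 C.
have Cpsi : Cn 2 Q psi := CnM_cst oQ s^-1 Ch.
have Qh' : Q (h' z0) by exact: spacetime_pos_affine.
have Dv (f : R * R -> R) z (v : R * R) : derivable f (h z) v ->
    is_derive z v (fun y => s^-1 * f (h y)) ('D_v f (h z)).
  move=> df; have d0 : is_derive (h z) v f ('D_v f (h z)) by split.
  have := is_deriveZ s^-1 (is_derive_affine d0).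
  by rewrite -[X in is_derive _ _ _ X]/(s^-1 * ('D_v f (h z) * s)) mulrCA mulVf ?mulr1.
have [d1 d2 d3] := Cn2_derivable C Qz.
have e1 : dt psi (h' z0) = dt phi z0.
  by rewrite /dt; have [_ ->] := Dv phi (h' z0) (1, 0) ltac:(by rewrite hK); rewrite hK.
have e2 y : Q y -> dx psi y = dx phi (h y).
  move=> Qy; have Qhy : Q (h y) by exact: spacetime_pos_affine.
  have [_ c2 _] := Cn2_derivable C Qhy.
  by rewrite /dx; have [_ ->] := Dv phi y (0, 1) c2.
have e3 : dx (dx psi) (h' z0) = s * dx (dx phi) z0.
  rewrite {1}/dx (derive_ext oQ _ Qh' e2).
  have d0 : is_derive (h (h' z0)) ((0, 1) : R * R) (dx phi) (dx (dx phi) z0).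
    by rewrite hK; split.
  by have [_ ->] := is_derive_affine d0; rewrite mulrC.
have := su (h' z0) psi Qh' Cpsi.
rewrite /equation_rhs e1 e3 (e2 _ Qh') hK => I.
have -> : s * A (s^-1 * z0.2 + k) * dx (dx phi) z0 = A (h' z0).2 * (s * dx (dx phi) z0).
  by rewrite mulrA [A _ * s]mulrC.
apply: I.
have nm : \forall y \near h' z0, s * u (s^-1 *: h y + (0, k)) + c - phi (h y) <=
    s * u (s^-1 *: z0 + (0, k)) + c - phi z0.
  have hc : h y @[y --> h' z0] --> z0.
    by have := @affine_continuous _ s (0, - s * k) (h' z0); rewrite /continuous_at -/(h (h' z0)) hK.
  exact: hc _ nmax.
apply: filterS nm => y.
rewrite -/(h' (h y)) -/(h' z0) /psi hK.
have -> : h' (h y) = y.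
  case: y => t x; rewrite /h /h' /=; congr pair => /=.
    by rewrite -!/(GRing.scale _ _) /GRing.scale /=; field.
  by rewrite -!/(GRing.scale _ _) /GRing.scale /=; field.
move=> Hy; rewrite -(ler_pM2l s0) !mulrBr !mulrA mulfV // !mul1r.
by move: Hy; clear; lra.
Qed.

Lemma supersol_affine A H W u (s k c : R) : 0 < s -> supersol A H W u ->
  supersol (fun x => s * A (s^-1 * x + k)) H (fun x => W (s^-1 * x + k))
    (fun z => s * u (s^-1 *: z + (0, k)) + c).
Proof.
move=> s0 /supersolN su; have H1 := @subsol_affine _ _ _ _ s k (- c) s0 su.
apply: supersol_subsolN; move: H1; congr subsol.
by apply/funext => z; ring.
Qed.

End affine.

(** * Behaviour at the initial time, and uniqueness for the effective equation *)

Section estimates.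
Variable R : realType.
Implicit Types (A H W g : R -> R) (u v : R * R -> R).

Lemma continuous_bounded_itv H (P : R) : continuous H ->
  exists2 M : R, 0 <= M & forall p : R, `|p| <= P -> `|H p| <= M.
Proof.
move=> Hc; have [P0|P0] := ltP P 0.
  by exists 0 => // p; rewrite leNgt (lt_le_trans P0).
have uH : usc (fun p => `|H p|) by apply: continuous_usc => p; apply: cvg_norm; exact: Hc.
have cK : compact `[- P, P] by exact: segment_compact.
have K0 : `[- P, P]%classic 0 by rewrite /= in_itv /= lerNl oppr0 P0.
have [p Kp Hp] := usc_max (fun z c _ => uH z c) cK (ex_intro _ 0 K0).
exists `|H p| => // p' Pp'; apply: Hp.
by rewrite /= in_itv /= -ler_norml.
Qed.

(** A barrier is centred at each [x]. The quantifiers matter: [K] is chosen before [A], [W] and [u],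
    so it will be the same at all scales. *)
Lemma initial_upper H g (W0 eta : R) : continuous H -> 0 <= W0 ->
  unif_continuous g -> 0 < eta ->
  exists2 K : R, 0 <= K & forall A W u,
    (forall x, 0 <= A x <= 1) -> (forall x, W x <= W0) ->
    UC_spacetime u -> subsol A H W u -> (forall x, u (0, x) = g x) ->
    forall t x : R, 0 <= t -> u (t, x) <= g x + eta + K * t.
Proof.
move=> Hc W00 gu eta0; have eta2 : 0 < eta / 2 by rewrite divr_gt0.
have [C C0 HC] := UC_growth gu eta2.
(* The smoothed cone has height [C * rho] at its tip; this choice makes it at most [eta / 2]. *)
pose rho := eta / 2 / (C + 1).
have C1 : 0 < C + 1 by rewrite ltr_wpDl.
have rho0 : 0 < rho by rewrite divr_gt0.
have Crho : C * rho <= eta / 2.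
  have : rho * (C + 1) = eta / 2 by rewrite /rho divfK // lt0r_neq0.
  by move: rho0; clear; lra.
have [Hm Hm0 HH] := continuous_bounded_itv (C + 1) Hc.
have K0 : 0 <= C / rho + 1 + Hm + W0.
  by rewrite !addr_ge0 // divr_ge0 // ltW.
exists (C / rho + 1 + Hm + W0) => // A W u A01 WW uc su ug t x t0.
have [C2 C20 HC2] := UC_time_growth uc ltr01.
pose v := time_extend u.
have vE s y : 0 <= s -> v (s, y) = u (s, y) by move=> s0; exact: time_extendE.
have sv : subsol A H W v.
  by apply: subsol_ext su => z z0; rewrite /v time_extendE // ltW.
have uv : usc v by apply: continuous_usc; exact: time_extend_continuous.
have gr s y : 0 <= s -> v (s, y) <= v (0, y) + (1 + C2) * (1 + s).
  move=> s0; rewrite !vE //; have := HC2 s 0 y s0 (lexx 0); rewrite subr0 (ger0_norm s0) => h.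
  have := le_trans (ler_norm _) h; have : 0 <= C2 * s by rewrite mulr_ge0.
  by move: C20 s0; clear; lra.
have ini y : v (0, y) <= (g x + eta / 2) + C * psi rho (y - x).
  rewrite vE // ug; have h := le_trans (ler_norm _) (HC y x).
  have : C * `|y - x| <= C * psi rho (y - x) by rewrite ler_wpM2l // psi_ge_abs.
  by move: h; clear; lra.
have Hle p : `|p| <= C + 1 -> H p <= Hm by move=> /HH; exact: le_trans (ler_norm _).
have := barrier uv sv (lexx 0) rho0 C0 (addr_ge0 ler01 C20) gr ini A01 WW Hle erefl K0 x t0.
by rewrite vE // subrr psi0 // subr0; move: Crho; clear; lra.
Qed.

Lemma UC_oppR g : unif_continuous g -> unif_continuous (fun x => - g x).
Proof.
move=> /unif_continuousR H; apply/unif_continuousR => e e0; have [d d0 Hd] := H e e0.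
by exists d => // x y xy; rewrite -opprD normrN; exact: Hd.
Qed.

Lemma continuous_opp2 H : continuous H -> continuous (fun p => - H (- p)).
Proof.
move=> Hc p; apply: cvgN; apply: (@continuous_comp _ _ _ -%R H); last exact: Hc.
exact: opp_continuous.
Qed.

Lemma initial_estimate H g (W0 eta : R) : continuous H -> 0 <= W0 ->
  unif_continuous g -> 0 < eta ->
  exists2 K : R, 0 <= K & forall A W u,
    (forall x, 0 <= A x <= 1) -> (forall x, `|W x| <= W0) ->
    UC_viscosity_solution A H W u -> (forall x, u (0, x) = g x) ->
    forall t x : R, 0 <= t -> `|u (t, x) - g x| <= eta + K * t.
Proof.
move=> Hc W00 gu eta0.
have [K1 K10 H1] := initial_upper Hc W00 gu eta0.
have [K2 K20 H2] := initial_upper (continuous_opp2 Hc) W00 (UC_oppR gu) eta0.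
exists (K1 + K2); first by rewrite addr_ge0.
move=> A W u A01 WW [uc [[_ su] [_ Su]]] ug t x t0.
have W1 y : W y <= W0 by apply: le_trans (WW y); exact: ler_norm.
have W2 y : - W y <= W0 by apply: le_trans (WW y); rewrite -normrN ler_norm.
have h1 := H1 A W u A01 W1 uc su ug t x t0.
have h2 := H2 A _ _ A01 W2 (UC_opp uc) (supersolN Su) (fun x => congr1 -%R (ug x)) t x t0.
have k1 : 0 <= K1 * t by rewrite mulr_ge0.
have k2 : 0 <= K2 * t by rewrite mulr_ge0.
by rewrite ler_norml; apply/andP; split; move: h1 h2 k1 k2; clear; lra.
Qed.

(** The common constant [K] near time [0] and the growth of [g] produce the hypothesis of
    [comparison] for [L + M]. Taking for [g'] a translate of [g] turns comparison into a modulus of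
    continuity in space. *)
Lemma comparison_initial (H g g' : R -> R) U L (M : R) : continuous H ->
  usc U -> usc (fun z => - L z) ->
  subsol (fun=> 0) H (fun=> 0) U -> supersol (fun=> 0) H (fun=> 0) L ->
  unif_continuous g -> (forall x, g' x <= g x + M) ->
  (forall eta : R, 0 < eta -> exists2 K : R, 0 <= K & forall t x : R, 0 <= t ->
     U (t, x) <= g' x + eta + K * t /\ g x - eta - K * t <= L (t, x)) ->
  forall z, 0 <= z.1 -> U z <= L z + M.
Proof.
move=> Hc uU uL sU sL gu gg est.
pose L' z := L z + M.
suff : forall z, 0 <= z.1 -> U z <= L' z by [].
apply: (comparison Hc uU) => //.
- move=> z c /= h.
  have : - L z < c + M by move: h; rewrite /L'; clear; lra.
  by move=> /uL; apply: filterS => y; rewrite /L'; clear; lra.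
- have := @supersol_affine _ _ _ _ L 1 0 M ltr01 sL.
  congr supersol; apply/funext => z //=; rewrite ?mul1r // invr1 scale1r.
  by rewrite (_ : z + (0, 0) = z) //; case: z => t x; congr pair => /=; rewrite addr0.
- move=> eta eta0; have e3 : 0 < eta / 3 by rewrite divr_gt0.
  have [K K0 HK] := est _ e3; have [C C0 HC] := UC_growth gu e3.
  exists (K + C); first by rewrite addr_ge0.
  move=> t s x y t0 s0; rewrite /L'.
  have [h1 _] := HK t x t0; have [_ h2] := HK s y s0.
  have h3 := le_trans (ler_norm _) (HC x y); have h4 := gg x.
  have k1 : 0 <= K * `|x - y| by rewrite mulr_ge0.
  have k2 : 0 <= C * (t + s) by rewrite mulr_ge0 // addr_ge0.
  by move: h1 h2 h3 h4 k1 k2; clear; lra.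
Qed.

Lemma UC_solution_unique (H g : R -> R) u v : continuous H -> unif_continuous g ->
  cauchy_solution (fun=> 0) H (fun=> 0) g u ->
  cauchy_solution (fun=> 0) H (fun=> 0) g v ->
  forall z, spacetime z -> v z = u z.
Proof.
move=> Hc gu.
suff W u1 u2 : cauchy_solution (fun=> 0) H (fun=> 0) g u1 ->
    cauchy_solution (fun=> 0) H (fun=> 0) g u2 ->
    forall z, spacetime z -> u1 z <= u2 z.
  by move=> hu hv z z0; apply/eqP; rewrite eq_le !W.
move=> [s1 i1] [s2 i2] z z0.
have [uc1 [[_ sub1] _]] := s1; have [uc2 [_ [_ sup2]]] := s2.
rewrite -(time_extendE u1 z0) -(time_extendE u2 z0) -[leRHS]addr0.
apply: (@comparison_initial H g g) => //.
- by apply: continuous_usc; exact: time_extend_continuous.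
- by apply: continuous_usc => y; apply: cvgN; exact: time_extend_continuous.
- by apply: subsol_ext sub1 => y y0; rewrite time_extendE // ltW.
- apply: supersol_subsolN; apply: subsol_ext (supersolN sup2) => y y0.
  by rewrite time_extendE // ltW.
- by move=> x; rewrite addr0.
- move=> eta eta0; have [K K0 HK] := initial_estimate Hc (lexx 0) gu eta0.
  have z01 (x : R) : 0 <= (0 : R) <= 1 by rewrite lexx ler01.
  have n0 (x : R) : `|0 : R| <= 0 by rewrite normr0.
  exists K => // t x t0; rewrite !time_extendE //.
  have := HK _ _ _ z01 n0 s1 i1 t x t0; have := HK _ _ _ z01 n0 s2 i2 t x t0.
  rewrite !ler_norml => /andP[h1 h2] /andP[h3 h4].
  by split; move: h1 h2 h3 h4; clear; lra.
Qed.

End estimates.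

(** * Homogenization from approximate correctors *)

Section scaling.
Variable R : realType.
Implicit Types (A H W g : R -> R) (u v : R * R -> R).
Local Notation Q := (@spacetime_pos R).

Lemma UC_viscosity_scale A H W u (s : R) : 0 < s ->
  UC_viscosity_solution A H W u ->
  UC_viscosity_solution (fun x => s * A (x / s)) H (fun x => W (x / s))
    (fun z : R * R => s * u (s^-1 *: z)).
Proof.
move=> s0 [uc [[cu su] [_ Su]]]; have si0 : 0 < s^-1 by rewrite invr_gt0.
have E : (fun z : R * R => s * u (s^-1 *: z)) = (fun z => s * u (s^-1 *: z + (0, 0)) + 0).
  apply/funext => z; rewrite addr0; congr (_ * u _).
  by case: z => t x; congr pair => /=; rewrite addr0.
have EA : (fun x => s * A (x / s)) = (fun x => s * A (s^-1 * x + 0)).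
  by apply/funext => x; rewrite addr0 mulrC [x / s]mulrC mulrC.
have EW : (fun x => W (x / s)) = (fun x => W (s^-1 * x + 0)).
  by apply/funext => x; rewrite addr0 [x / s]mulrC.
have cv z : Q z -> {for z, continuous (fun z : R * R => s * u (s^-1 *: z))}.
  move=> Qz; apply: cvgM; first exact: cvg_cst.
  apply: (@continuous_comp _ _ _ (fun y : R * R => s^-1 *: y) u); first exact: scaler_continuous.
  by apply: cu; rewrite /spacetime_pos /= mulr_gt0.
split.
  apply/UC_spacetimeP => e e0; have [d d0 Hd] := (UC_spacetimeP u).1 uc (e / s) (divr_gt0 e0 s0).
  exists (d * s); first by rewrite mulr_gt0.
  move=> t r x y t0 r0 tr xy; rewrite -mulrBr normrM (gtr0_norm s0) mulrC -ltr_pdivlMr //.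
  apply: Hd; rewrite /= -?[_ *: _]/(_ * _) ?mulr_ge0 ?(ltW si0) //.
    by rewrite -mulrBr normrM (gtr0_norm si0) mulrC ltr_pdivrMr.
  by rewrite -mulrBr normrM (gtr0_norm si0) mulrC ltr_pdivrMr.
split; (split; [exact: cv|]).
- suff : subsol (fun x => s * A (x / s)) H (fun x => W (x / s)) (fun z : R * R => s * u (s^-1 *: z)) by [].
  by rewrite E EA EW; exact: subsol_affine.
- suff : supersol (fun x => s * A (x / s)) H (fun x => W (x / s)) (fun z : R * R => s * u (s^-1 *: z)) by [].
  by rewrite E EA EW; exact: supersol_affine.
Qed.

Lemma cauchy_scale A H W g u (s : R) : 0 < s ->
  cauchy_solution A H W g u ->
  cauchy_solution (fun x => s * A (x / s)) H (fun x => W (x / s))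
    (fun x => s * g (x / s)) (fun z : R * R => s * u (s^-1 *: z)).
Proof.
move=> s0 [su iu]; split; first exact: UC_viscosity_scale.
move=> x; rewrite -iu; congr (_ * u _); congr pair => /=; first by rewrite scaler0.
by rewrite -[_ *: _]/(_ * _) mulrC.
Qed.

Lemma ereal_sup_dist_le0 (T : Type) (B : set T) (f : T -> R) :
  (ereal_sup [set (`|f z|)%:E | z in B] <= 0)%E -> forall z, B z -> f z = 0.
Proof.
move=> h z Bz; have : ((`|f z|)%:E <= 0)%E.
  by apply: le_trans h; apply: ereal_sup_ubound; exists z.
by rewrite lee_fin normr_le0 => /eqP.
Qed.

(** Existence scales up a solution with the unscaled data [g1]. For uniqueness, a competitor [v] is
    scaled back, where the contraction property in [well_posed] compares it with [u1]. *)
Lemma well_posed_scale A H W g (s : R) : well_posed A H W -> 0 < s ->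
  unif_continuous g -> exists u,
  unique_cauchy_solution (fun x => s * A (x / s)) H (fun x => W (x / s)) g u.
Proof.
move=> [wp1 wp2] s0 gu; have sn0 : s != 0 by exact: lt0r_neq0.
have si0 : 0 < s^-1 by rewrite invr_gt0.
pose g1 x := s^-1 * g (x / s^-1).
have g1u : unif_continuous g1.
  apply/unif_continuousR => e e0.
  have [d d0 Hd] := (unif_continuousR g).1 gu (e * s) (mulr_gt0 e0 s0).
  exists (d / s); first by rewrite divr_gt0.
  move=> x y xy; rewrite -mulrBr normrM (gtr0_norm si0) mulrC ltr_pdivrMr //.
  by apply: Hd; rewrite -mulrBl normrM invrK (gtr0_norm s0) -ltr_pdivlMr.
have [u1 Hu1] := wp1 g1 g1u.
have Hu := cauchy_scale s0 Hu1.
have Eg : (fun x => s * g1 (x / s)) = g.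
  by apply/funext => x; rewrite /g1 mulrA mulfV // mul1r invrK divfK.
rewrite Eg in Hu; exists (fun z => s * u1 (s^-1 *: z)); split=> // v Hv z z0.
have := cauchy_scale si0 Hv.
have -> : (fun x => s^-1 * (s * A (x / s^-1 / s))) = A.
  by apply/funext => x; rewrite mulrA mulVf // mul1r invrK mulfK.
have -> : (fun x => W (x / s^-1 / s)) = W.
  by apply/funext => x; rewrite invrK mulfK.
rewrite -/g1 invrK => -[sv iv].
have Z : (ereal_sup [set (`|u1 z - (s^-1 * v (s *: z))|)%:E | z in @spacetime R] <= 0)%E.
  rewrite (wp2 u1 _ Hu1.1 sv); apply: ge_ereal_sup => _ [x _ <-].
  by rewrite Hu1.2 iv subrr normr0.
have z0' : spacetime (s^-1 *: z) by rewrite /spacetime /= mulr_ge0 // ltW.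
have := ereal_sup_dist_le0 Z z0'.
rewrite scalerA mulfV // scale1r => /eqP; rewrite subr_eq0 => /eqP ->.
by rewrite mulrA mulfV // mul1r.
Qed.

End scaling.

(** The barrier is restarted at time [t], with the spatial modulus as its initial bound. The growth
    constant [C0] only confines the maximum and does not enter [K], which is therefore uniform in
    [t]. *)
Lemma time_modulus (R : realType) (H : R -> R) (V : R * R -> R) (C0 : R) :
  continuous H -> usc V -> subsol (fun=> 0) H (fun=> 0) V -> 0 <= C0 ->
  (forall t s x : R, 0 <= t -> t <= s -> V (s, x) <= V (t, x) + C0 * (1 + s)) ->
  (forall eta : R, 0 < eta -> exists2 C : R, 0 <= C & forall t x y : R, 0 <= t ->
     V (t, x) - V (t, y) <= eta + C * `|x - y|) ->
  forall eta : R, 0 < eta -> exists2 K : R, 0 <= K & forall t s x : R,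
    0 <= t -> t <= s -> V (s, x) - V (t, x) <= eta + K * (s - t).
Proof.
move=> Hc uV sV C00 gr mod eta eta0; have eta2 : 0 < eta / 2 by rewrite divr_gt0.
have [C C_0 HC] := mod _ eta2.
pose rho := eta / 2 / (C + 1).
have C1 : 0 < C + 1 by rewrite ltr_wpDl.
have rho0 : 0 < rho by rewrite divr_gt0.
have Crho : C * rho <= eta / 2.
  have : rho * (C + 1) = eta / 2 by rewrite /rho divfK // lt0r_neq0.
  by move: rho0; clear; lra.
have [Hm Hm0 HH] := continuous_bounded_itv (C + 1) Hc.
have K0 : 0 <= C / rho + 1 + Hm + 0.
  by rewrite !addr_ge0 // divr_ge0 // ltW.
exists (C / rho + 1 + Hm + 0) => // t s x t0 ts.
have ini y : V (t, y) <= (V (t, x) + eta / 2) + C * psi rho (y - x).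
  have h := HC t y x t0.
  have : C * `|y - x| <= C * psi rho (y - x) by rewrite ler_wpM2l // psi_ge_abs.
  by move: h; clear; lra.
have Hle p : `|p| <= C + 1 -> H p <= Hm by move=> /HH; exact: le_trans (ler_norm _).
have z01 (y : R) : 0 <= (0 : R) <= 1 by rewrite lexx ler01.
have := barrier uV sV t0 rho0 C_0 C00 (fun s x => gr t s x t0) ini z01 (fun=> lexx 0) Hle erefl K0 x ts.
by rewrite subrr psi0 //; move: Crho; clear; lra.
Qed.

(** * The half-relaxed limits coincide and solve the effective problem *)

Section homogenization.
Variable R : realType.
Implicit Types (u v : R * R -> R) (z : R * R).
Local Notation Q := (@spacetime_pos R).
Variables (A H W Hb : R -> R) (W0 : R).
Hypothesis A01 : forall x, 0 <= A x <= 1.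
Hypothesis Hc : continuous H.
Hypothesis W00 : 0 <= W0.
Hypothesis WW : forall x, `|W x| <= W0.
Hypothesis Hbc : continuous Hb.
Hypothesis ACp : forall p x0, upper_corrector A H W (Hb p) p x0.
Hypothesis ACm : forall p x0,
  upper_corrector A (fun q => - H (- q)) (fun x => - W x) (- Hb (- p)) p x0.
Variables (g : R -> R) (u : R -> R * R -> R).
Hypothesis gu : unif_continuous g.
Hypothesis uS : forall eps, 0 < eps ->
  cauchy_solution (fun x => eps * A (x / eps)) H (fun x => W (x / eps)) g (u eps).

Let v eps : R * R -> R := time_extend (u eps).

Let vE eps z : 0 <= z.1 -> v eps z = u eps z.
Proof. exact: time_extendE. Qed.

Let v_sub eps : 0 < eps ->
  subsol (fun x => eps * A (x / eps)) H (fun x => W (x / eps)) (v eps).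
Proof.
move=> e0; have [[_ [[_ s] _]] _] := uS e0.
by apply: subsol_ext s => y y0; rewrite vE // ltW.
Qed.

Let v_sup eps : 0 < eps ->
  subsol (fun x => eps * A (x / eps)) (fun p => - H (- p)) (fun x => - W (x / eps)) (fun z => - v eps z).
Proof.
move=> e0; have [[_ [_ [_ s]]] _] := uS e0.
by apply: subsol_ext (supersolN s) => y y0; rewrite vE // ltW.
Qed.

Let v_cont eps : 0 < eps -> continuous (v eps).
Proof. by move=> e0; apply: time_extend_continuous; exact: (uS e0).1.1. Qed.

(** The restriction [eps <= 1] keeps [eps * A] in [[0, 1]], so that a single [K] serves for all
    these scales. *)
Let v_est eta : 0 < eta -> exists2 K : R, 0 <= K &
  forall eps t x, 0 < eps -> eps <= 1 -> `|v eps (t, x) - g x| <= eta + K * Num.max t 0.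
Proof.
move=> eta0; have [K K0 HK] := initial_estimate Hc W00 gu eta0.
exists K => // eps t x e0 e1; have t0 : 0 <= Num.max t 0 by rewrite le_max lexx orbT.
have Ae y : 0 <= eps * A (y / eps) <= 1.
  have /andP[a0 a1] := A01 (y / eps); rewrite mulr_ge0 ?(ltW e0) //=.
  by rewrite mulr_ile1 // ltW.
exact: (HK _ _ _ Ae (fun y => WW (y / eps)) (uS e0).1 (uS e0).2).
Qed.

Let gc : continuous g.
Proof.
move=> x; apply/cvgrPdist_lt => e e0; have [d d0 Hd] := (unif_continuousR g).1 gu e e0.
by apply: filterS (nbhsx_ballx x d d0) => y; exact: Hd.
Qed.

Let near_le1 : \forall e \near (0 : R)^'+, 0 < e /\ e <= 1.
Proof. by near=> e; split; near: e; [exact: nbhs_right_gt|exact: nbhs_right_le]. Unshelve. all: by end_near. Qed.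

Let near_est eta : 0 < eta -> exists2 K : R, 0 <= K &
  forall t x, \forall y \near ((t, x) : R * R) & e \near (0 : R)^'+,
    `|v e y - g x| <= eta + K * Num.max t 0.
Proof.
move=> eta0; have e4 : 0 < eta / 4 by rewrite divr_gt0.
have [K K0 HK] := v_est e4; exists K => // t x.
pose d := eta / 4 / (K + 1).
have K1 : 0 < K + 1 by rewrite ltr_wpDl.
have d0 : 0 < d by rewrite divr_gt0.
have Kd : K * d <= eta / 4.
  have : d * (K + 1) = eta / 4 by rewrite /d divfK // lt0r_neq0.
  by move: d0; lra.
have n1 : \forall y \near ((t, x) : R * R), `|g y.2 - g x| <= eta / 4.
  apply: (@near_shift_le _ (fun y => g y.2)); last by rewrite subrr normr0.
  by apply: continuous_at_snd; exact: gc.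
have n2 : \forall y \near ((t, x) : R * R), `|Num.max y.1 0 - Num.max t 0| <= d.
  apply: filterS (box_near (t, x) d0) => y [/= h _].
  by apply: (le_trans (dist_max0 _ _)); exact: ltW.
exists ([set y | `|g y.2 - g x| <= eta / 4 /\ `|Num.max y.1 0 - Num.max t 0| <= d], [set e | 0 < e /\ e <= 1]) => /=.
  by split; [exact: filterI|exact: near_le1].
move=> [[t' x'] e] /= [[h1 h2] [e0 e1]].
have h3 := HK e t' x' e0 e1.
have h4 : K * Num.max t' 0 <= K * Num.max t 0 + K * d.
  rewrite -mulrDr ler_wpM2l //; have := le_trans (ler_norm _) h2.
  by lra.
move: h1 h3; rewrite !ler_norml => /andP[a1 a2] /andP[b1 b2].
by apply/andP; split; move: a1 a2 b1 b2 h4 Kd eta0; lra.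
Qed.

Let lb : locally_bounded_family v.
Proof.
move=> [t x]; have [K K0 HK] := near_est ltr01.
exists (`|g x| + (1 + K * Num.max t 0)); apply: filterS (HK t x) => -[y e] /= h.
rewrite -(subrK (g x) (v e y)) addrC; apply: (le_trans (ler_normD _ _)).
by rewrite lerD2l.
Qed.

Let lbN : locally_bounded_family (fun e z => - v e z).
Proof. by move=> z; have [M HM] := lb z; exists M; apply: filterS HM => y; rewrite normrN. Qed.

Let U := upper_limit v.
Let L z := - upper_limit (fun e z => - v e z) z.

Let U_usc : usc U. Proof. exact: upper_limit_usc. Qed.
Let L_usc : usc (fun z => - L z).
Proof.
rewrite (_ : (fun z => - L z) = upper_limit (fun e z => - v e z)); first exact: upper_limit_usc.
by apply/funext => z; rewrite opprK.
Qed.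

Let U_sub : subsol (fun=> 0) Hb (fun=> 0) U.
Proof.
apply: (upper_limit_subsol A01 Hc ACp lb) => e e0; last exact: v_sub.
exact/continuous_usc/v_cont.
Qed.

Let L_sup : supersol (fun=> 0) Hb (fun=> 0) L.
Proof.
apply: supersol_subsolN.
rewrite (_ : (fun z => - L z) = upper_limit (fun e z => - v e z)); last first.
  by apply/funext => z; rewrite opprK.
rewrite (_ : (fun=> - 0) = (fun=> 0)); last by apply/funext => x; rewrite oppr0.
apply: (upper_limit_subsol A01 (continuous_opp2 Hc) ACm lbN) => e e0; last exact: v_sup.
by apply: continuous_usc => z; apply: cvgN; exact: v_cont.
Qed.

Let LU z : L z <= U z.
Proof.
rewrite leNgt; apply/negP => h; pose c := (L z + U z) / 2.
have h1 : U z < c by rewrite /c; move: h; lra.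
have h2 : upper_limit (fun e z => - v e z) z < - c.
  by rewrite -ltrN2 opprK -/(L z) /c; move: h; lra.
have [[y e] /= [k1 k2]] := filter_ex (filterI (upper_limit_lt lb h1) (upper_limit_lt lbN h2)).
by move: k1 k2; lra.
Qed.

Let UL_est eta : 0 < eta -> exists2 K : R, 0 <= K & forall t x : R, 0 <= t ->
     U (t, x) <= g x + eta + K * t /\ g x - eta - K * t <= L (t, x).
Proof.
move=> eta0; have [K K0 HK] := near_est eta0; exists K => // t x t0.
have mt : Num.max t 0 = t by rewrite max_l.
split.
  apply: upper_limit_le => //; apply: filterS (HK t x) => -[y e] /=.
  by rewrite mt => h; have := le_trans (ler_norm _) h; lra.
rewrite lerNr; apply: upper_limit_le => //; apply: filterS (HK t x) => -[y e] /=.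
by rewrite mt -normrN => h; have := le_trans (ler_norm _) h; lra.
Qed.

Let UL z : 0 <= z.1 -> U z = L z.
Proof.
move=> z0; apply/eqP; rewrite eq_le LU andbT -[leRHS]addr0.
apply: (comparison_initial Hbc U_usc L_usc U_sub L_sup gu _ UL_est z0) => x.
by rewrite addr0.
Qed.

Let U_est eta : 0 < eta -> exists2 K : R, 0 <= K & forall t x : R, 0 <= t ->
  `|U (t, x) - g x| <= eta + K * t.
Proof.
move=> /UL_est [K K0 HK]; exists K => // t x t0; have [h1 h2] := HK t x t0.
rewrite -(UL (z := (t, x)) t0) in h2.
by rewrite ler_norml; apply/andP; split; move: h1 h2; lra.
Qed.

Let U0 x : U (0, x) = g x.
Proof.
apply/eqP; rewrite -subr_eq0 -normr_le0; apply/ler_addgt0Pl => e e0.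
have [K K0 HK] := U_est e0; have := HK 0 x (lexx 0).
by rewrite mulr0.
Qed.

(** The effective equation is invariant under translations in [x]: the translate of [U] by
    [k = x - y] is a subsolution whose data exceed [g] by at most [eta + C * |k|], and comparison
    propagates this to all times. *)
Let U_space eta : 0 < eta -> exists2 C : R, 0 <= C & forall t x y : R, 0 <= t ->
  `|U (t, x) - U (t, y)| <= eta + C * `|x - y|.
Proof.
move=> eta0; have [C C0 HC] := UC_growth gu eta0; exists C => //.
suff W1 t x y : 0 <= t -> U (t, x) - U (t, y) <= eta + C * `|x - y|.
  move=> t x y t0; rewrite ler_norml W1 // andbT lerNl opprB.
  by rewrite distrC; exact: W1.
move=> t0; rewrite lerBlDl; pose k := x - y.
pose U' z := 1 * U (1^-1 *: z + (0, k)) + 0.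
have U'E (s z : R) : U' (s, z) = U (s, z + k).
  by rewrite /U' mul1r invr1 addr0 scale1r; congr U; congr pair => /=; rewrite addr0.
have cK := @affine_continuous R 1^-1 (0, k).
have uU' : usc U'.
  have := usc_comp cK U_usc.
  by congr usc; apply/funext => z; rewrite /U' mul1r addr0.
have sU' : subsol (fun=> 0) Hb (fun=> 0) U'.
  have := @subsol_affine _ _ _ _ U 1 k 0 ltr01 U_sub.
  by congr subsol; apply/funext => z; rewrite mul1r.
have := @comparison_initial _ Hb g (fun x => g (x + k)) U' L (eta + C * `|k|) Hbc uU' L_usc sU' L_sup gu.
move=> /(_ _ _ (t, y) t0).
rewrite U'E -UL // /k subrKC; apply.
  move=> z; have := le_trans (ler_norm _) (HC (z + (x - y)) z); rewrite [X in `|X|]addrAC subrr add0r.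
  by lra.
move=> e e0; have [K K0 HK] := UL_est e0; exists K => // s z s0; rewrite U'E.
by split; [exact: (HK s (z + k) s0).1|exact: (HK s z s0).2].
Qed.

Let gr (V : R * R -> R) (h : R -> R) : (forall eta : R, 0 < eta -> exists2 K : R, 0 <= K &
    forall t x : R, 0 <= t -> `|V (t, x) - h x| <= eta + K * t) ->
  exists2 C0 : R, 0 <= C0 &
    forall t s x : R, 0 <= t -> t <= s -> V (s, x) <= V (t, x) + C0 * (1 + s).
Proof.
move=> /(_ 1 ltr01) [K K0 HK]; exists (2 + 2 * K).
  by rewrite addr_ge0 // mulr_ge0.
move=> t s x t0 ts; have h1 := HK t x t0; have h2 := HK s x (le_trans t0 ts).
move: h1 h2; rewrite !ler_norml => /andP[h1 _] /andP[_ h2].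
have k1 : K * t <= K * s by rewrite ler_wpM2l.
by move: h1 h2 k1 K0 t0 ts; lra.
Qed.

(** [time_modulus] bounds increments from above only. Applied to [- L], which equals [- U] at
    nonnegative times, it also bounds them from below. *)
Let U_time eta : 0 < eta -> exists2 K : R, 0 <= K & forall t s x : R,
    0 <= t -> t <= s -> `|U (s, x) - U (t, x)| <= eta + K * (s - t).
Proof.
move=> eta0.
have [C0 C00 HC0] := gr U_est.
have N_est e : 0 < e -> exists2 K : R, 0 <= K & forall t x : R, 0 <= t ->
    `|(- L (t, x)) - (- g x)| <= e + K * t.
  move=> /U_est [K K0 HK]; exists K => // t x t0.
  by rewrite -opprD normrN -(UL (z := (t, x)) t0); exact: HK.
have [C1 C10 HC1] := @gr (fun z => - L z) (fun x => - g x) N_est.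
have m1 e : 0 < e -> exists2 C : R, 0 <= C & forall t x y : R, 0 <= t ->
     U (t, x) - U (t, y) <= e + C * `|x - y|.
  move=> /U_space [C C_0 HC]; exists C => // t x y t0.
  exact: le_trans (ler_norm _) (HC t x y t0).
have m2 e : 0 < e -> exists2 C : R, 0 <= C & forall t x y : R, 0 <= t ->
     - L (t, x) - - L (t, y) <= e + C * `|x - y|.
  move=> /U_space [C C_0 HC]; exists C => // t x y t0.
  have := le_trans (ler_norm _) (HC t y x t0).
  by rewrite [`|y - x|]distrC (UL (z := (t, y)) t0) (UL (z := (t, x)) t0); lra.
have NL : subsol (fun=> 0) (fun p => - Hb (- p)) (fun=> 0) (fun z => - L z).
  have := supersolN L_sup.
  by congr subsol; apply/funext => x; rewrite oppr0.
have [K1 K10 HK1] := time_modulus Hbc U_usc U_sub C00 HC0 m1 eta0.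
have [K2 K20 HK2] := time_modulus (continuous_opp2 Hbc) L_usc NL C10 HC1 m2 eta0.
exists (K1 + K2); first by rewrite addr_ge0.
move=> t s x t0 ts; have h1 := HK1 t s x t0 ts; have h2 := HK2 t s x t0 ts.
rewrite -(UL (z := (t, x)) t0) -(UL (z := (s, x)) (le_trans t0 ts)) in h2.
have k1 : 0 <= K1 * (s - t) by rewrite mulr_ge0 // subr_ge0.
have k2 : 0 <= K2 * (s - t) by rewrite mulr_ge0 // subr_ge0.
by rewrite ler_norml; apply/andP; split; move: h1 h2 k1 k2; lra.
Qed.

Let U_UC : UC_spacetime U.
Proof.
apply/UC_spacetimeP => e e0; have e8 : 0 < e / 8 by rewrite divr_gt0.
have [C C0 HC] := U_space e8; have [K K0 HK] := U_time e8.
have CK : 0 < C + K + 1 by rewrite ltr_wpDl // addr_ge0.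
exists (e / 8 / (C + K + 1)); first by rewrite divr_gt0.
set d := e / 8 / _.
have d0 : 0 < d by rewrite divr_gt0.
have dE : d * (C + K + 1) = e / 8 by rewrite /d divfK // lt0r_neq0.
have Cd : C * d <= e / 8.
  have : 0 <= K * d by rewrite mulr_ge0 // ltW.
  by move: d0 dE; lra.
have Kd : K * d <= e / 8.
  have : 0 <= C * d by rewrite mulr_ge0 // ltW.
  by move: d0 dE; lra.
have T t s x : 0 <= t -> 0 <= s -> `|t - s| < d -> `|U (t, x) - U (s, x)| <= e / 4.
  wlog ts : t s / t <= s.
    move=> IH; have [/IH//|/ltW/IH h t0 s0] := leP t s.
    by rewrite distrC [`|U _ - _|]distrC; exact: h.
  move=> t0 s0; rewrite distrC [`|U _ - _|]distrC ger0_norm ?subr_ge0 // => st.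
  apply: (le_trans (HK t s x t0 ts)).
  have : K * (s - t) <= K * d by rewrite ler_wpM2l // ltW.
  by move: Kd; lra.
move=> t s x y t0 s0 ts xy.
rewrite -(subrKA (U (s, x)) (U (t, x)) (- U (s, y))).
apply: (le_lt_trans (ler_normD _ _)).
have h1 := T t s x t0 s0 ts; have h2 := HC s x y s0.
have h3 : C * `|x - y| <= C * d by rewrite ler_wpM2l // ltW.
by move: h1 h2 h3 Cd e0; lra.
Qed.

Let U_solution : cauchy_solution (fun=> 0) Hb (fun=> 0) g U.
Proof.
have cU z : Q z -> {for z, continuous U}.
  move=> z0; apply: (continuous_ext_open (@open_spacetime_pos R) z0 _ (@time_extend_continuous _ _ U_UC z)) => y y0.
  by rewrite time_extendE // ltW.
split=> //; split; first exact: U_UC.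
split; (split; [exact: cU|]).
  exact: U_sub.
suff : supersol (fun=> 0) Hb (fun=> 0) U by [].
apply: supersol_subsolN; apply: subsol_ext (supersolN L_sup) => z z0.
by rewrite UL // ltW.
Qed.

(** Where the upper and lower half-relaxed limits agree, each point has a neighbourhood and a range
    of [e] on which [v e] is close to [U]; compactness makes the range of [e] common. *)
Let U_cvg : {family compactly_in (@spacetime R), u eps @[eps --> 0^'+] --> U}.
Proof.
apply/fam_cvgP => K [Ksub cK]; move=> P /uniform_nbhs [E [entE EP]].
have [eps /= eps0 Heps] : exists2 eps : R, 0 < eps & forall a b : R, `|a - b| < eps -> E (a, b).
  by move: entE; rewrite -entourage_ballE => -[eps /= eps0 H1]; exists eps => // a b; exact: (H1 (a, b)).
have [d d0 Hd] := UC_time_extend U_UC (divr_gt0 eps0 (ltr0Sn R 3)).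
have : \forall e \near (0 : R)^'+, forall z, K z -> `|time_extend U z - v e z| < eps.
  have /compact_near_coveringP ncK := cK.
  apply: (ncK _ _ (fun e z => `|time_extend U z - v e z| < eps)) => z Kz.
  have z0 : 0 <= z.1 := Ksub z Kz.
  have e4 : 0 < eps / 4 by rewrite divr_gt0.
  have l1 : U z < U z + eps / 4 by rewrite ltrDl.
  have l2 : upper_limit (fun e z => - v e z) z < - U z + eps / 4.
    by rewrite UL // /L opprK ltrDl.
  have n1 := upper_limit_lt lb l1; have n2 := upper_limit_lt lbN l2.
  have n3 : \forall y \near z & e \near (0 : R)^'+, `|time_extend U z - time_extend U y| < eps / 4.
    exists ([set y | `|y.1 - z.1| < d /\ `|y.2 - z.2| < d], setT) => /=.
      by split; [exact: box_near|exact: filterT].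
    by move=> [y e] /= [[h1 h2] _]; apply: Hd; rewrite distrC.
  apply: filterS3 n1 n2 n3 => -[y e] /= h1 h2; rewrite (time_extendE U z0) !ltr_norml.
  by move=> /andP[h3 h4]; apply/andP; split; move: h1 h2 h3 h4; lra.
move=> near1; apply: filterS near1 => e He; apply: EP => y Ky.
have y0 : 0 <= y.1 := Ksub y Ky.
by apply: Heps; have := He y Ky; rewrite time_extendE // vE.
Qed.

Lemma homogenization_limit : exists ubar,
  unique_cauchy_solution (fun=> 0) Hb (fun=> 0) g ubar /\
  {family compactly_in (@spacetime R), u eps @[eps --> 0^'+] --> ubar}.
Proof.
exists U; split; last exact: U_cvg.
split; first exact: U_solution.
by move=> w Hw; exact: (UC_solution_unique Hbc gu U_solution Hw).
Qed.

End homogenization.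

(** Purely deterministic: the random medium enters only through the approximate correctors of one
    fixed realization. *)
Theorem homogenization (R : realType) (A H W Hb : R -> R) (W0 : R) :
  (forall x, 0 <= A x <= 1) -> continuous H -> (forall x, `|W x| <= W0) ->
  continuous Hb ->
  (forall p x0, upper_corrector A H W (Hb p) p x0) ->
  (forall p x0, upper_corrector A (fun q => - H (- q)) (fun x => - W x)
     (- Hb (- p)) p x0) ->
  well_posed A H W ->
  forall g : R -> R, unif_continuous g ->
  exists (u : R -> R * R -> R) (ubar : R * R -> R),
    [/\ forall eps : R, 0 < eps ->
          unique_cauchy_solution (fun x => eps * A (x / eps)) H
            (fun x => W (x / eps)) g (u eps),
        unique_cauchy_solution (fun=> 0) Hb (fun=> 0) g ubar &
        {family compactly_in (@spacetime R),
           u eps @[eps --> 0^'+] --> ubar}].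
Proof.
move=> A01 Hc WW Hbc ACp ACm wp g gu.
have /choice [u Hu] : forall eps : R, exists w : R * R -> R, 0 < eps -> unique_cauchy_solution
    (fun x => eps * A (x / eps)) H (fun x => W (x / eps)) g w.
  move=> eps; have [e0|e0] := boolP (0 < eps); last by exists (fun=> 0).
  by have [w Hw] := well_posed_scale wp e0 gu; exists w.
have W00 : 0 <= W0 by exact: le_trans (normr_ge0 _) (WW 0).
have [ubar [h1 h2]] := homogenization_limit A01 Hc W00 WW Hbc ACp ACm gu (fun e e0 => (Hu e e0).1).
by exists u, ubar; split.
Qed.

(** * Correctors *)

Section ode_tools.
Variable R : realType.
Implicit Types (f d S : R -> R).

Lemma is_derive_within f f' (a b : R) : (forall x : R, is_derive x 1 f (f' x)) ->
  {within `[a, b], continuous f}.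
Proof.
move=> df; apply: continuous_subspaceT => x; exact: is_derive_continuous (df x).
Qed.

Lemma derive_le_mono f f' (a b : R) : a <= b ->
  (forall x : R, is_derive x 1 f (f' x)) ->
  (forall x, a < x < b -> f' x <= 0) -> f b <= f a.
Proof.
rewrite le_eqVlt => /predU1P[->//|ab] df f'0.
have [x] := MVT ab (fun x _ => df x) (is_derive_within df).
rewrite in_itv /= => xab E; rewrite -subr_le0 E.
by rewrite mulr_le0_ge0 ?subr_ge0 ?(ltW ab) // f'0.
Qed.

(** Going backwards from [x], [d] cannot fall to [c]: to the right of the last point [y0] where
    [d <= c] it is nonincreasing, so [d y0 >= d x > c]. [S] is the clock in which the decay is
    measured, either the identity or the primitive of the inverse diffusion. *)
Lemma backward_barrier d d' S S' (l x c m : R) : l <= x ->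
  (forall y : R, is_derive y 1 d (d' y)) -> (forall y : R, is_derive y 1 S (S' y)) ->
  0 <= m -> (forall y, 0 <= S' y) ->
  (forall y, l <= y <= x -> c < d y -> d' y <= - m * S' y) ->
  c < d x -> forall y, l <= y <= x -> d x + m * (S x - S y) <= d y.
Proof.
move=> lx dd dS m0 S0 H dx.
suff above y : l <= y <= x -> c < d y.
  move=> y /andP[ly yx].
  have dh (z : R) : is_derive z 1 (fun z => d z + m * S z) (d' z + m * S' z).
    by have := is_deriveD (dd z) (is_deriveZ m (dS z)).
  suff : d x + m * S x <= d y + m * S y by clear; lra.
  apply: (derive_le_mono yx dh).
  move=> z /andP[/ltW yz /ltW zx].
  have lz : l <= z <= x by rewrite (le_trans ly yz) zx.
  by have := H z lz (above z lz); lra.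
move=> /andP[ly yx]; rewrite ltNge; apply/negP => dy.
pose E := [set z | z <= x /\ d z <= c].
have hs : has_sup E by split; [exists y; split | exists x => z []].
set y0 := sup E.
have yy0 : y <= y0 by apply: ub_le_sup; [case: hs | split].
have y0x : y0 <= x by apply: ge_sup; [case: hs | move=> z []].
have dc : continuous d by move=> z; exact: is_derive_continuous (dd z).
have dy0 : d y0 <= c.
  rewrite leNgt; apply/negP => h.
  have /nbhs_normP [e /= e0 He] : \forall z \near y0, c < d z by exact: (cvgr_gt _ (dc y0)).
  have [z [zx dz] hz] := sup_adherent e0 hs.
  have zy0 : z <= y0 by apply: ub_le_sup; [case: hs | split].
  have : c < d z by apply: He => /=; rewrite ger0_norm ?subr_ge0 // -/y0 in hz *; move: hz; clear; lra.
  by rewrite ltNge dz.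
suff : d x <= d y0 by rewrite leNgt (le_lt_trans dy0 dx).
apply: (@derive_le_mono d d') => // z /andP[y0z /ltW zx].
have dz : c < d z.
  rewrite ltNge; apply/negP => dz; have : z <= y0 by apply: ub_le_sup; [case: hs | split].
  by rewrite leNgt y0z.
have lz : l <= z <= x by rewrite zx andbT (le_trans ly) // (le_trans yy0) // ltW.
apply: (le_trans (H z lz dz)).
by rewrite mulNr oppr_le0 mulr_ge0.
Qed.

(** Above the level [c], [d] would blow up backwards in [x]. *)
Lemma backward_bound d d' (B c m : R) :
  (forall y : R, is_derive y 1 d (d' y)) -> (forall y, d y <= B) -> 0 < m ->
  (forall y, c < d y -> d' y <= - m) -> forall x, d x <= c.
Proof.
move=> dd dB m0 H x; rewrite leNgt; apply/negP => cd.
pose y := x - (`|B - d x| + 1) / m.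
have yx : y <= x.
  by rewrite /y gerBl divr_ge0 ?addr_ge0 // ltW.
have := @backward_barrier d d' id (fun=> 1) y x c m yx dd (fun z => is_derive_id z 1)
  (ltW m0) (fun=> ler01) _ cd y _.
rewrite lexx yx => /(_ _ isT) h.
have : d x + m * (id x - id y) <= d y.
  by apply: h => z _ /H; rewrite mulr1.
have -> : m * (id x - id y) = `|B - d x| + 1.
  by rewrite /= /y opprB addrCA subrr addr0 mulrC divfK // gt_eqF.
have := dB y; have := ler_norm (B - d x); clear; lra.
Qed.

Lemma lipschitz_derive f f' (M : R) : (forall x : R, is_derive x 1 f (f' x)) ->
  (forall x, `|f' x| <= M) -> forall x y, `|f x - f y| <= M * `|x - y|.
Proof.
move=> df fM x y; wlog yx : x y / y <= x.
  by move=> h; have [/h//|/ltW/h] := leP y x; rewrite distrC [`|y - x|]distrC.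
have [z _ ->] := MVT_segment yx (fun x _ => df x) (is_derive_within df).
by rewrite normrM ler_wpM2r.
Qed.

Lemma derive_unique f g h : (forall x : R, is_derive x 1 f (h x)) ->
  (forall x : R, is_derive x 1 g (h x)) -> forall x y, f x - f y = g x - g y.
Proof.
move=> df dg x y.
have dfg (z : R) : is_derive z 1 (fun z => f z - g z) 0.
  by have := is_deriveB (df z) (dg z); rewrite subrr.
by have := is_derive_0_is_cst x y dfg; clear; lra.
Qed.

Lemma is_derive_comp_opp f (x d : R) : is_derive (- x) 1 f d ->
  is_derive x 1 (fun y => f (- y)) (- d).
Proof.
move=> df; have d2 : is_derive x 1 (fun y : R => - y) (- 1) by exact: is_deriveN.
by have := @is_derive1_comp _ f (fun y : R => - y) x _ _ df d2; rewrite mulrN1.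
Qed.

Lemma is_derive_comp_shift f (s x d : R) : is_derive (s + x) 1 f d ->
  is_derive x 1 (fun y => f (s + y)) d.
Proof.
move=> df; have d2 : is_derive x 1 (fun y : R => s + y) 1.
  by have := is_deriveD (is_derive_cst s x 1) (is_derive_id x (1 : R)); rewrite add0r.
by have := @is_derive1_comp _ f (fun y : R => s + y) x _ _ df d2; rewrite mulr1.
Qed.

End ode_tools.

(** * Oriented primitives vanishing at the origin *)

Section primitive.
Variable R : realType.
Local Notation mu := (@lebesgue_measure R).
Implicit Types (f : R -> R).

(** The oriented integral from [0] to [x]: according to the sign of [x], one of the two terms
    vanishes. *)
Definition prim f (x : R) : R :=
  \int[mu]_(y in `[0, x]) f y - \int[mu]_(y in `[x, 0]) f y.

Lemma prim0 f : prim f 0 = 0.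
Proof. by rewrite /prim subrr. Qed.

Lemma integrable_itv f (a b : R) : continuous f -> mu.-integrable `[a, b] (EFin \o f).
Proof.
move=> cf; apply: continuous_compact_integrable; first exact: segment_compact.
exact: continuous_subspaceT.
Qed.

(** A base point to the left of both [0] and [x] removes the distinction on the sign of [x], as
    required to differentiate near [x = 0]. *)
Lemma prim_base f (a x : R) : continuous f -> a < 0 -> a < x ->
  prim f x = \int[mu]_(y in `[a, x]) f y - \int[mu]_(y in `[a, 0]) f y.
Proof.
move=> cf a0 ax; have ic u v := @integrable_itv f u v cf.
have cat (u v w : R) : u <= v -> v <= w -> \int[mu]_(y in `[u, w]) f y =
    \int[mu]_(y in `[u, v]) f y + \int[mu]_(y in `[v, w]) f y.
  move=> uv vw.
  have := @Rintegral_itvB R f (BLeft u) (BRight w) v (ic u w) uv vw.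
  rewrite Rintegral_itv_obnd_cbnd; last first.
    apply: (@integrableS _ _ _ mu `[v, w]) => //.
    exact: subset_itv_oc_cc.
  by move=> <-; ring.
rewrite /prim; have [x0|x0] := leP x 0.
  rewrite (cat a x 0 (ltW ax) x0).
  have -> : \int[mu]_(y in `[0, x]) f y = 0.
    move: x0; rewrite le_eqVlt => /predU1P[->|x0].
      by rewrite set_itv1 Rintegral_set1.
    by rewrite set_itv_ge ?Rintegral_set0 // bnd_simp -ltNge.
  by ring.
rewrite (cat a 0 x (ltW a0) (ltW x0)).
have -> : \int[mu]_(y in `[x, 0]) f y = 0.
  by rewrite set_itv_ge ?Rintegral_set0 // bnd_simp -ltNge.
by ring.
Qed.

Lemma is_derive_prim f (x : R) : continuous f -> is_derive x 1 (prim f) (f x).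
Proof.
move=> cf; pose a := Num.min 0 x - 1.
have a0 : a < 0 by rewrite /a ltrBlDr add0r gt_min ltr01.
have ax : a < x by rewrite /a ltrBlDr gt_min ltrDl ltr01 orbT.
have xu : x < x + 1 by rewrite ltrDl.
have [d1 d2] := continuous_FTC1_closed xu (@integrable_itv f a (x + 1) cf) ax (cf x).
set F := fun _ => _ in d1 d2.
have dF : is_derive x 1 (fun y => F y - F 0) (f x).
  have dF : is_derive x 1 F (f x) by split; [exact: d1|rewrite -derive1E; exact: d2].
  by have := is_deriveB dF (is_derive_cst (F 0) x 1); rewrite subr0.
have nx : \forall y \near x, F y - F 0 = prim f y.
  near=> y; rewrite (@prim_base f a) //; near: y; exact: lt_nbhsr.
case: dF => e1 e2; split.
  by apply: near_eq_derivable nx e1; exact: oner_neq0.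
by rewrite -(near_eq_derive (1 : R) nx) e2.
Unshelve. all: by end_near. Qed.

Lemma prim_unique f F : continuous f -> (forall x : R, is_derive x 1 F (f x)) ->
  forall x, F x - F 0 = prim f x.
Proof.
move=> cf dF x; rewrite (derive_unique dF (fun x => is_derive_prim x cf)).
by rewrite prim0 subr0.
Qed.

End primitive.

(** * The resolvent of a linear first-order equation on the line *)

Section resolvent.
Variable R : realType.
Local Notation mu := (@lebesgue_measure R).
Variables (c : R -> R) (ka : R).
Hypothesis cc : continuous c.
Hypothesis c1 : forall x, 1 <= c x.
Hypothesis ka0 : 0 < ka.

Let S := prim c.
Let E (y : R) := c y * expR (ka * S y).

Let dS (x : R) : is_derive x 1 S (c x). Proof. exact: is_derive_prim. Qed.

Let dexpS (x : R) : is_derive x 1 (fun y => expR (ka * S y)) (ka * E x).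
Proof.
have d1 : is_derive x 1 (fun y => ka * S y) (ka * c x) := is_deriveZ ka (dS x).
have := @is_derive1_comp _ expR (fun y => ka * S y) x _ _ (is_derive_expR _) d1.
by rewrite /E mulrC mulrA.
Qed.

Let expS_cont : continuous (fun y => expR (ka * S y)).
Proof. by move=> x; exact: is_derive_continuous (dexpS x). Qed.

Let E_cont : continuous E.
Proof. by move=> x; apply: cvgM; [exact: cc|exact: expS_cont]. Qed.

Let c0 x : 0 < c x. Proof. exact: lt_le_trans ltr01 (c1 x). Qed.

Let E0 x : 0 <= E x. Proof. by rewrite mulr_ge0 ?expR_ge0 // ltW. Qed.

(** This is where [c >= 1] acts: it makes [E] decay exponentially, hence integrable, at [-oo]. *)
Let S_neg x : x <= 0 -> S x <= x.
Proof.
move=> x0; have dd (z : R) : is_derive z 1 (fun z => z - S z) (1 - c z).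
  exact: is_deriveB (is_derive_id z (1 : R)) (dS z).
have : 0 - S 0 <= x - S x.
  by apply: (derive_le_mono x0 dd) => y _; rewrite subr_le0.
by rewrite /S prim0 subr0 subr_ge0.
Qed.

Let expS_cvg : - (ka^-1 * expR (ka * S (- y))) @[y --> +oo] --> (0 : R).
Proof.
apply/cvgrPdist_lt => e e0.
have kae : 0 < ka * e by rewrite mulr_gt0.
near=> y.
have y0 : 0 < y by near: y; exact: nbhs_pinfty_gt.
rewrite sub0r opprK ger0_norm; last by rewrite mulr_ge0 ?expR_ge0 ?invr_ge0 // ltW.
rewrite mulrC ltr_pdivrMr //.
have h1 : expR (ka * S (- y)) <= expR (- (ka * y)).
  rewrite ler_expR -mulrN ler_pM2l //; apply: S_neg; rewrite oppr_le0; exact: ltW.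
apply: (le_lt_trans h1); rewrite expRN invf_plt ?posrE ?expR_gt0 //; last by rewrite mulrC.
apply: (lt_le_trans _ (expR_ge1Dx _)).
suff : (e * ka)^-1 < ka * y by move/lt_trans; apply; rewrite ltrDr.
rewrite -ltr_pdivrMl //.
by near: y; apply: nbhs_pinfty_gt; rewrite num_real.
Unshelve. all: by end_near. Qed.

Lemma integral_E x : (\int[mu]_(y in `]-oo, x]) (E y)%:E = (expR (ka * S x) / ka)%:E)%E.
Proof.
have := @ge0_integration_by_substitutionNy R E (- x).
rewrite opprK => ->; last 2 first.
- exact: continuous_subspaceT.
- by move=> y _; exact: E0.
pose F (y : R) := - (ka^-1 * expR (ka * S (- y))).
have dF (y : R) : is_derive y 1 F (E (- y)).
  have h := is_deriveN (is_deriveZ ka^-1 (is_derive_comp_opp (dexpS (- y)))).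
  have e : - (ka^-1 * - (ka * E (- y))) = E (- y) by field; exact: lt0r_neq0.
  by rewrite -[X in is_derive _ _ _ X]e; exact: h.
rewrite (@ge0_continuous_FTC2y R (E \o -%R) F (- x) 0).
- by rewrite /F opprK -EFinB sub0r opprK mulrC.
- by move=> y _; exact: E0.
- apply: continuous_subspaceT => y; apply: continuous_comp; first exact: opp_continuous.
  exact: E_cont.
- exact: expS_cvg.
- by move=> y _; case: (dF y).
- exact/cvg_at_right_filter/(is_derive_continuous (dF _)).
- by move=> y _; rewrite derive1E; have [_ ->] := dF y.
Qed.

Lemma integrable_E (r : R -> R) (M u : R) : continuous r -> (forall y, `|r y| <= M) ->
  mu.-integrable `]-oo, u] (EFin \o (fun y => E y * r y)).
Proof.
move=> rc rM; have M0 : 0 <= M by exact: le_trans (normr_ge0 _) (rM 0).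
have iE : mu.-integrable `]-oo, u] (EFin \o (fun y => E y * M)).
  apply/integrableP; split.
    apply/measurable_EFinP; apply: measurable_funTS; apply: continuous_measurable_fun.
    by move=> y; apply: cvgM; [exact: E_cont|exact: cvg_cst].
  under eq_integral => y _ do rewrite /= (ger0_norm (mulr_ge0 (E0 y) M0)) mulrC EFinM.
  rewrite ge0_integralZl //=.
  - by rewrite integral_E -EFinM ltry.
  - by apply/measurable_EFinP; apply: measurable_funTS; apply: continuous_measurable_fun.
  - by move=> y _; rewrite lee_fin.
apply: le_integrable iE => //.
  apply/measurable_EFinP; apply: measurable_funTS; apply: continuous_measurable_fun.
  by move=> y; apply: cvgM; [exact: E_cont|exact: rc].
move=> y _ /=; rewrite lee_fin [`|E y * r y|]normrM [`|E y * M|]normrM (ger0_norm (E0 y)) (ger0_norm M0).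
by rewrite ler_wpM2l.
Qed.

(** Variation of constants from [-oo]: a solution on the whole line of [f' = c (r - ka f)], bounded
    when [r] is. It is monotone in [r], the property that the iteration exploits. *)
Definition resolvent (r : R -> R) (x : R) : R :=
  expR (- (ka * S x)) * \int[mu]_(y in `]-oo, x]) (E y * r y).

Lemma resolvent_cst (M x : R) : 0 <= M -> resolvent (fun=> M) x = M / ka.
Proof.
move=> M0; rewrite /resolvent /Rintegral.
under eq_integral => y _ do rewrite mulrC EFinM.
rewrite ge0_integralZl //=; last 2 first.
- by apply/measurable_EFinP; apply: measurable_funTS; apply: continuous_measurable_fun.
- by move=> y _; rewrite lee_fin.
rewrite integral_E -EFinM /= expRN; field.
by rewrite lt0r_neq0 //= lt0r_neq0 // expR_gt0.
Qed.

Lemma resolvent_mono (r1 r2 : R -> R) (M x : R) : continuous r1 -> continuous r2 ->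
  (forall y, `|r1 y| <= M) -> (forall y, `|r2 y| <= M) ->
  (forall y, r1 y <= r2 y) -> resolvent r1 x <= resolvent r2 x.
Proof.
move=> c1' c2' b1 b2 r12; rewrite ler_wpM2l ?expR_ge0 //.
apply: le_Rintegral => //.
- exact: integrable_E c1' b1.
- exact: integrable_E c2' b2.
- by move=> y _; rewrite ler_wpM2l.
Qed.

Lemma is_derive_resolvent (r : R -> R) (M x : R) : continuous r ->
  (forall y, `|r y| <= M) ->
  is_derive x 1 (resolvent r) (c x * (r x - ka * resolvent r x)).
Proof.
move=> rc rM; pose F x := \int[mu]_(y in `]-oo, x]) (E y * r y).
have dF : is_derive x 1 F (E x * r x).
  have xu : x < x + 1 by rewrite ltrDl.
  have cEr : {for x, continuous (fun y => E y * r y)}.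
    by apply: cvgM; [exact: E_cont|exact: rc].
  have [d1 d2] := continuous_FTC1 xu (@integrable_E r M (x + 1) rc rM) (ltNyr _) cEr.
  by split; [exact: d1|rewrite -derive1E; exact: d2].
have dN : is_derive x 1 (fun y => expR (- (ka * S y))) (- (ka * c x) * expR (- (ka * S x))).
  have d1 : is_derive x 1 (fun y => - (ka * S y)) (- (ka * c x)).
    exact: is_deriveN (is_deriveZ ka (dS x)).
  have := @is_derive1_comp _ expR (fun y => - (ka * S y)) x _ _ (is_derive_expR _) d1.
  by rewrite mulrC.
have h := is_deriveM dN dF.
have e : expR (- (ka * S x)) * (E x * r x) + F x * (- (ka * c x) * expR (- (ka * S x))) =
   c x * (r x - ka * resolvent r x).
  have ee : expR (- (ka * S x)) * expR (ka * S x) = 1 by rewrite -expRD addNr expR0.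
  rewrite /resolvent -/(F x) /E.
  transitivity ((expR (- (ka * S x)) * expR (ka * S x)) * (c x * r x) - ka * c x * (expR (- (ka * S x)) * F x)); first by ring.
  by rewrite ee; ring.
by rewrite -[X in is_derive _ _ _ X]e; exact: h.
Qed.

Lemma resolvent_cvg (r : (R -> R)^nat) (r' : R -> R) (M x : R) :
  (forall n, continuous (r n)) -> continuous r' ->
  (forall n y, `|r n y| <= M) -> (forall y, `|r' y| <= M) ->
  (forall y, r ^~ y @ \oo --> r' y) ->
  resolvent (r n) x @[n --> \oo] --> resolvent r' x.
Proof.
move=> rc rc' rM rM' cv.
apply: cvgM; first exact: cvg_cst.
have iM : mu.-integrable `]-oo, x] (EFin \o (fun y => E y * M)).
  by apply: (@integrable_E _ `|M|) => //; exact: cst_continuous.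
have mE n : measurable_fun `]-oo, x] (fun y => (E y * r n y)%:E).
  apply/measurable_EFinP; apply: measurable_funTS; apply: continuous_measurable_fun.
  by move=> y; apply: cvgM; [exact: E_cont|exact: rc].
have mE' : measurable_fun `]-oo, x] (fun y => (E y * r' y)%:E).
  apply/measurable_EFinP; apply: measurable_funTS; apply: continuous_measurable_fun.
  by move=> y; apply: cvgM; [exact: E_cont|exact: rc'].
have [] := @dominated_convergence _ _ R mu `]-oo, x] (measurable_itv _) (fun n y => (E y * r n y)%:E)
  (fun y => (E y * r' y)%:E) (fun y => (E y * M)%:E) mE mE' _ iM _.
- apply: nearW => y _; apply/fine_cvgP; split; first by apply: nearW.
  by apply: cvgM; [exact: cvg_cst|exact: cv].
- by apply: nearW => y n _ /=; rewrite lee_fin [`|E y * _|]normrM (ger0_norm (E0 y)) ler_wpM2l.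
move=> i1 _ i2.
apply: fine_cvg; rewrite fineK //; exact: integrable_fin_num.
Qed.

End resolvent.

(** * Existence for the slope equation by monotone iteration *)

Section monotone_iteration.
Variable R : realType.
Variables (G : R -> R) (lam ka p q : R).
Hypothesis Gc : continuous G.
Hypothesis ka0 : 0 < ka.
Hypothesis p0 : 0 <= p.
Hypothesis pq : p <= q.
Hypothesis mono : forall s t, p <= s -> s <= t -> t <= q -> ka * s - G s <= ka * t - G t.

Definition source (W f : R -> R) (y : R) : R := lam - W y + (ka * f y - G (f y)).

(** The equation [f' = c (lam - W - G f)] reads
    [f = resolvent (lam - W + (ka f - G f))], whose right-hand side is
    nondecreasing in [f]. *)
Fixpoint iterate (c W : R -> R) n : R -> R :=
  if n is m.+1 then resolvent c ka (source W (iterate c W m)) else fun=> p.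

Section fixed.
Variables (c W : R -> R).
Hypothesis cc : continuous c.
Hypothesis c1 : forall x, 1 <= c x.
Hypothesis Wc : continuous W.
Hypothesis WG : forall y, G p <= lam - W y <= G q.

Let source_cont f : continuous f -> continuous (source W f).
Proof.
move=> fc y; apply: cvgD; first by apply: cvgB; [exact: cvg_cst|exact: Wc].
apply: cvgB; first by apply: cvgM; [exact: cvg_cst|exact: fc].
by apply: (@continuous_comp _ _ _ f G); [exact: fc|exact: Gc].
Qed.

Lemma source_bound f y : p <= f y <= q -> ka * p <= source W f y <= ka * q.
Proof.
move=> /andP[pf fq]; have /andP[w1 w2] := WG y.
have m1 := mono (lexx p) pf fq; have m2 := mono pf fq (lexx q).
by rewrite /source; apply/andP; split; move: w1 w2 m1 m2; lra.
Qed.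

Let source_norm f y : p <= f y <= q -> `|source W f y| <= ka * q.
Proof.
move=> /source_bound /andP[h1 h2]; rewrite ger0_norm //.
by apply: le_trans h1; rewrite mulr_ge0 // ltW.
Qed.

(** The resolvent maps the constants [ka * p] and [ka * q] to [p] and [q]. By [source_bound], a
    function with values in [[p, q]] has its source between these constants, so monotonicity of the
    resolvent preserves both the interval and the order of the iterates. *)
Lemma iterate_props n : [/\ continuous (iterate c W n),
  forall y, p <= iterate c W n y <= q & forall y, iterate c W n y <= iterate c W n.+1 y].
Proof.
have kp0 : 0 <= ka * p by rewrite mulr_ge0 // ltW.
have kpq : ka * p <= ka * q by rewrite ler_pM2l.
have kq0 : 0 <= ka * q by exact: le_trans kpq.
have nkq : `|ka * q| <= ka * q by rewrite ger0_norm.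
have nkp : `|ka * p| <= ka * q by rewrite ger0_norm.
have rp y : resolvent c ka (fun=> ka * p) y = p.
  by rewrite resolvent_cst // mulrC mulKf // gt_eqF.
have rq y : resolvent c ka (fun=> ka * q) y = q.
  by rewrite resolvent_cst // mulrC mulKf // gt_eqF.
have step f : continuous f -> (forall y, p <= f y <= q) ->
    forall y, p <= resolvent c ka (source W f) y <= q.
  move=> fc fb y; have sc := source_cont fc.
  have sn z : `|source W f z| <= ka * q by exact: source_norm.
  apply/andP; split.
    rewrite -[leLHS](rp y); apply: (@resolvent_mono _ c ka cc c1 ka0 (fun=> ka * p) (source W f) (ka * q) y _ sc _ sn).
    - by move=> ?; exact: cst_continuous.
    - by move=> z.
    - by move=> z; have /andP[] := source_bound (fb z).
  rewrite -[leRHS](rq y); apply: (@resolvent_mono _ c ka cc c1 ka0 (source W f) (fun=> ka * q) (ka * q) y sc _ sn).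
  - by move=> ?; exact: cst_continuous.
  - by move=> z.
  - by move=> z; have /andP[] := source_bound (fb z).
elim: n => [|n [IHc IHb IHm]] /=.
  have c0 : continuous (fun _ : R => p) by move=> ?; exact: cst_continuous.
  have b0 (y : R) : p <= p <= q by rewrite lexx pq.
  split => // y; by have /andP[] := step _ c0 b0 y.
have sn f z : (forall y, p <= f y <= q) -> `|source W f z| <= ka * q.
  by move=> fb; exact: source_norm.
have c1' : continuous (resolvent c ka (source W (iterate c W n))).
  move=> y; apply: is_derive_continuous (is_derive_resolvent cc c1 ka0 y (source_cont IHc) _).
  by move=> z; exact: sn.
have b1 := step _ IHc IHb.
split => // y; apply: (@resolvent_mono _ c ka cc c1 ka0 _ _ (ka * q) y (source_cont IHc) (source_cont c1')).
- by move=> z; exact: sn.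
- by move=> z; exact: sn.
- move=> z; rewrite /source lerD2l.
  have /andP[h1 h2] := IHb z; have /andP[h3 h4] := b1 z; exact: mono (IHm z) h4.
Qed.

Definition ode_solution (y : R) : R := limn (fun n => iterate c W n y).

Let sol := ode_solution.

Lemma ode_solution_cvg y : iterate c W n y @[n --> \oo] --> ode_solution y.
Proof.
apply: nondecreasing_is_cvgn.
  by apply/nondecreasing_seqP => n; have [] := iterate_props n.
by exists q => _ [n _ <-]; have [_ /(_ y)/andP[]] := iterate_props n.
Qed.

Lemma ode_solution_bound y : p <= ode_solution y <= q.
Proof.
have cv := @ode_solution_cvg y; rewrite -(cvg_lim _ cv) //.
apply/andP; split.
  apply: limr_ge; first by apply/cvg_ex; exists (sol y).
  by apply: nearW => n; have [_ /(_ y)/andP[]] := iterate_props n.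
apply: limr_le; first by apply/cvg_ex; exists (sol y).
by apply: nearW => n; have [_ /(_ y)/andP[]] := iterate_props n.
Qed.

Let iterate_derive (n : nat) (x : R) : is_derive x 1 (iterate c W n.+1)
  (c x * (source W (iterate c W n) x - ka * iterate c W n.+1 x)).
Proof.
have [h1 h2 _] := iterate_props n.
apply: (is_derive_resolvent cc c1 ka0 x (source_cont h1)) => z.
exact: source_norm.
Qed.

(** Continuity must precede the equation, since [is_derive_resolvent] asks for a continuous source.
    On [[x - 1, x + 1]], where [c] is bounded by its maximum, the iterates share a Lipschitz
    constant, which the pointwise limit inherits. *)
Let sol_cont : continuous sol.
Proof.
move=> x.
have uc : usc c by exact: continuous_usc.
have [z _ Cz] := usc_max (fun z r _ => uc z r) (segment_compact (a := x - 1) (b := x + 1))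
  (ex_intro _ x (ltac:(rewrite /= in_itv /= gerBl lerDl ler01; done) : `[x - 1, x + 1]%classic x)).
pose L := c z * (ka * (q - p)).
have kq0 : 0 <= ka * (q - p) by rewrite mulr_ge0 ?subr_ge0 // ltW.
have cz0 : 0 <= c z by exact: le_trans ler01 (c1 z).
have L0 : 0 <= L by rewrite mulr_ge0.
have itL n y1 y2 : x - 1 <= y1 -> y1 <= y2 -> y2 <= x + 1 ->
    `|iterate c W n.+1 y2 - iterate c W n.+1 y1| <= L * `|y2 - y1|.
  move=> a1 a2 a3.
  have [w] := MVT_segment a2 (fun y _ => iterate_derive n y) (is_derive_within (iterate_derive n)).
  rewrite in_itv /= => /andP[w1 w2] ->; rewrite normrM ler_wpM2r //.
  have wz : c w <= c z by apply: Cz; rewrite /= in_itv /= (le_trans a1 w1) (le_trans w2 a3).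
  have cw0 : 0 <= c w by exact: le_trans ler01 (c1 w).
  have [_ hb _] := iterate_props n; have [_ hb1 _] := iterate_props n.+1.
  have /andP[s1 s2] := source_bound (hb w); have /andP[i1 i2] := hb1 w.
  have k1 : ka * p <= ka * iterate c W n.+1 w by rewrite ler_pM2l.
  have k2 : ka * iterate c W n.+1 w <= ka * q by rewrite ler_pM2l.
  rewrite /= in k1 k2; rewrite normrM (ger0_norm cw0); apply: ler_pM => //=.
  rewrite ler_norml; apply/andP; split; move: s1 s2 k1 k2; lra.
have solL y : x - 1 <= y <= x + 1 -> `|sol y - sol x| <= L * `|y - x|.
  move=> /andP[y1 y2].
  have cv : `|iterate c W n.+1 y - iterate c W n.+1 x| @[n --> \oo] --> `|sol y - sol x|.
    apply: cvg_norm; apply: cvgB.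
      by have := @ode_solution_cvg y; rewrite -(cvg_shiftS (fun n => iterate c W n y)).
    by have := @ode_solution_cvg x; rewrite -(cvg_shiftS (fun n => iterate c W n x)).
  rewrite -(cvg_lim _ cv) //; apply: limr_le; first by apply/cvg_ex; eexists; exact: cv.
  apply: nearW => n; have [yx|/ltW xy] := leP y x.
    by rewrite distrC [`|y - x|]distrC; apply: itL => //; rewrite lerDl.
  by apply: itL => //; rewrite gerBl.
apply/cvgrPdist_lt => e e0.
have L1 : 0 < L + 1 by rewrite ltr_wpDl.
have eL : 0 < e / (L + 1) by rewrite divr_gt0.
near=> y.
have ny : x - 1 <= y <= x + 1.
  by near: y; apply: filterS (nbhsx_ballx x 1 ltr01) => y; rewrite /ball /= ltr_distl => /andP[h1 h2]; apply/andP; split; move: h1 h2; lra.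
rewrite distrC; apply: (le_lt_trans (solL y ny)).
have : `|y - x| < e / (L + 1).
  near: y; apply: filterS (nbhsx_ballx x (e / (L + 1)) eL) => y.
  by rewrite /ball /= distrC.
rewrite ltr_pdivlMr // => h; apply: le_lt_trans h.
by rewrite mulrC ler_wpM2l // lerDl.
Unshelve. all: by end_near. Qed.

(** Dominated convergence passes to the limit in the fixed-point relation, and differentiating the
    resolvent cancels the terms [ka * f]. *)
Lemma is_derive_ode_solution (x : R) :
  is_derive x 1 ode_solution (c x * (lam - W x - G (ode_solution x))).
Proof.
have sb y : p <= sol y <= q := ode_solution_bound y.
have E : sol = resolvent c ka (source W sol).
  apply/funext => y.
  have cv1 : iterate c W n.+1 y @[n --> \oo] --> sol y.
    by have := @ode_solution_cvg y; rewrite -(cvg_shiftS (fun n => iterate c W n y)).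
  have cv2 : iterate c W n.+1 y @[n --> \oo] --> resolvent c ka (source W sol) y.
    apply: (@resolvent_cvg _ c ka cc c1 ka0 (fun n => source W (iterate c W n)) _ (ka * q)).
    - by move=> n; apply: source_cont; have [] := iterate_props n.
    - exact: source_cont.
    - by move=> n z; apply: source_norm; have [_ h _] := iterate_props n.
    - by move=> z; exact: source_norm.
    - move=> z; apply: cvgD; first exact: cvg_cst.
      apply: cvgB; first by apply: cvgM; [exact: cvg_cst|exact: ode_solution_cvg].
      by apply: continuous_cvg; [exact: Gc|exact: ode_solution_cvg].
  exact: cvg_unique cv1 cv2.
have := is_derive_resolvent cc c1 ka0 x (source_cont sol_cont) (fun y => source_norm (sb y)).
rewrite -E; set a := (X in is_derive _ _ _ X -> _); set b := (X in _ -> is_derive _ _ _ X).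
by have -> : a = b by rewrite /a /b /source -/sol; ring.
Qed.

End fixed.
End monotone_iteration.

(** * Measurable dependence of the slopes on the medium *)

Section measurable_parameters.
Variable R : realType.
Local Notation mu := (@lebesgue_measure R).
Local Notation RR := (measurableTypeR R).

Lemma measurable_set_le d (T : measurableType d) (f g : T -> R) :
  measurable_fun setT f -> measurable_fun setT g -> measurable [set t | f t <= g t].
Proof.
move=> mf mg; have mh : measurable_fun setT (fun t => g t - f t) by exact: measurable_funB.
have := mh measurableT _ (measurable_itv `[0, +oo[).
rewrite setTI; congr measurable; apply/seteqP; split => t /=.
  by rewrite in_itv /= andbT subr_ge0.
by rewrite in_itv /= andbT subr_ge0.
Qed.

(** Tonelli's theorem for [f] extended by [0] outside [D]; as [fine] is measurable, integrability is
    not at stake. *)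
Lemma measurable_parametric_integral d (T : measurableType d) (D : set (T * RR))
    (f : T * RR -> R) : measurable D -> measurable_fun setT f ->
  (forall z, 0 <= f z) ->
  measurable_fun setT (fun t => \int[mu]_(y in [set y | D (t, y)]) f (t, y)).
Proof.
move=> mD mf f0; pose F : T * RR -> \bar R := (EFin \o f) \_ D.
have mF : measurable_fun setT F.
  by apply/(measurable_restrictT _ mD); apply: measurable_funTS; exact/measurable_EFinP.
have F0 z : (0 <= F z)%E by rewrite /F patchE; case: ifP => // _; rewrite lee_fin.
have := @measurable_fun_fubini_tonelli_F _ _ T RR R mu F mF F0.
move=> m1; have := measurableT_comp (fine_measurable measurableT) m1.
apply: eq_measurable_fun => t _; rewrite /= /Rintegral [in RHS]integral_mkcond; congr fine.
Qed.

Section ode.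
Variables (d : measure_display) (Omega : measurableType d).
Local Notation T := (RR * Omega)%type.

Let measurable_swap : measurable_fun setT (fun z : T * RR => (z.2, z.1.2) : T).
Proof.
apply: measurable_fun_pair; first exact: measurable_snd.
exact: measurableT_comp measurable_snd measurable_fst.
Qed.

Lemma measurable_prim (c : R -> Omega -> R) :
  measurable_fun setT (fun z : T => c z.1 z.2) -> (forall x w, 0 <= c x w) ->
  measurable_fun setT (fun z : T => prim (c ^~ z.2) z.1).
Proof.
move=> mc c0; rewrite /prim.
have mc' : measurable_fun setT (fun z : T * RR => c z.2 z.1.2) := measurableT_comp mc measurable_swap.
have mx : measurable_fun setT (fun z : T * RR => z.1.1 : R).
  exact: measurableT_comp measurable_fst measurable_fst.
have my : measurable_fun setT (fun z : T * RR => z.2 : R) by exact: measurable_snd.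
have m0 : measurable_fun setT (fun z : T * RR => 0 : R) by exact: measurable_cst.
have mD1 := measurableI _ _ (measurable_set_le m0 my) (measurable_set_le my mx).
have mD2 := measurableI _ _ (measurable_set_le mx my) (measurable_set_le my m0).
have h1 := measurable_parametric_integral mD1 mc' (fun z => c0 z.2 z.1.2).
have h2 := measurable_parametric_integral mD2 mc' (fun z => c0 z.2 z.1.2).
have := measurable_funB h1 h2.
apply: eq_measurable_fun => -[x w] _ /=; congr (_ - _); congr Rintegral.
  by apply/seteqP; split => y /=; rewrite in_itv /= => /andP[].
by apply/seteqP; split => y /=; rewrite in_itv /= => /andP[].
Qed.

Lemma measurable_resolvent (c r : R -> Omega -> R) (ka : R) :
  measurable_fun setT (fun z : T => c z.1 z.2) -> (forall x w, 0 <= c x w) ->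
  measurable_fun setT (fun z : T => r z.1 z.2) -> (forall x w, 0 <= r x w) ->
  measurable_fun setT (fun z : T => resolvent (c ^~ z.2) ka (r ^~ z.2) z.1).
Proof.
move=> mc c0 mr r0; rewrite /resolvent.
have mS := measurable_prim mc c0.
have mE : measurable_fun setT (fun z : T => c z.1 z.2 * expR (ka * prim (c ^~ z.2) z.1) * r z.1 z.2).
  apply: measurable_funM => //; apply: measurable_funM => //.
  apply: measurableT_comp; first exact: measurable_expR.
  exact: measurable_funM.
have mE' : measurable_fun setT (fun z : T * RR =>
    c z.2 z.1.2 * expR (ka * prim (c ^~ z.1.2) z.2) * r z.2 z.1.2).
  exact: (measurableT_comp mE measurable_swap).
have mx : measurable_fun setT (fun z : T * RR => z.1.1 : R).
  exact: measurableT_comp measurable_fst measurable_fst.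
have my : measurable_fun setT (fun z : T * RR => z.2 : R) by exact: measurable_snd.
have h0 (z : T * RR) : 0 <= c z.2 z.1.2 * expR (ka * prim (c ^~ z.1.2) z.2) * r z.2 z.1.2.
  by move: z => [[x w] y] /=; rewrite !mulr_ge0 ?expR_ge0.
have h1 := measurable_parametric_integral (measurable_set_le my mx) mE' h0.
have h2 : measurable_fun setT (fun z : T => expR (- (ka * prim (c ^~ z.2) z.1))).
  apply: measurableT_comp; first exact: measurable_expR.
  by apply: measurableT_comp => //; exact: measurable_funM.
have := measurable_funM h2 h1.
apply: eq_measurable_fun => -[x w] _ /=; congr (_ * _); congr Rintegral.
Qed.

(** Each iterate is a parametric integral of the previous one, and pointwise limits preserve
    measurability. Tonelli needs a nonnegative source, which [p >= 0] guarantees. *)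
Lemma measurable_ode_solution (c W : R -> Omega -> R) (G : R -> R) (lam ka p q : R) :
  continuous G -> 0 < ka -> 0 <= p -> p <= q ->
  (forall s t, p <= s -> s <= t -> t <= q -> ka * s - G s <= ka * t - G t) ->
  (forall w, continuous (c ^~ w)) -> (forall x w, 1 <= c x w) ->
  (forall w, continuous (W ^~ w)) -> (forall y w, G p <= lam - W y w <= G q) ->
  measurable_fun setT (fun z : T => c z.1 z.2) ->
  measurable_fun setT (fun z : T => W z.1 z.2) ->
  measurable_fun setT (fun z : T => ode_solution G lam ka p (c ^~ z.2) (W ^~ z.2) z.1).
Proof.
move=> Gc ka0 p0 pq mono cc c1 Wc WG mc mW.
have c0 x w : 0 <= c x w by exact: le_trans ler01 (c1 x w).
apply: (@measurable_fun_cvg _ _ _ setT (fun n z => iterate G lam ka p (c ^~ z.2) (W ^~ z.2) n z.1)); last first.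
  move=> [x w] _ /=.
  exact: (@ode_solution_cvg _ G lam ka p q Gc ka0 p0 pq mono _ _ (cc w) (c1 ^~ w) (Wc w) (WG ^~ w)).
elim=> [|n IH] /=; first exact: measurable_cst.
have ms : measurable_fun setT (fun z : T => source G lam ka (W ^~ z.2) (iterate G lam ka p (c ^~ z.2) (W ^~ z.2) n) z.1).
  apply: measurable_funD; first exact: measurable_funB.
  apply: measurable_funB; first exact: measurable_funM.
  by apply: measurableT_comp => //; exact: continuous_measurable_fun.
apply: (@measurable_resolvent c (fun x w => source G lam ka (W ^~ w) (iterate G lam ka p (c ^~ w) (W ^~ w) n) x)) => //.
move=> x w; have WGw y : G p <= lam - W y w <= G q by exact: WG.
have [_ hb _] := @iterate_props _ G lam ka p q Gc ka0 p0 pq mono _ _ (cc w) (c1 ^~ w) (Wc w) WGw n.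
have /andP[h _] := @source_bound _ G lam ka p q mono (W ^~ w) WGw _ x (hb x).
by apply: le_trans h; rewrite mulr_ge0 // ltW.
Qed.

End ode.
End measurable_parameters.

(** * Quantitative properties of the Hamiltonian on its increasing branch *)

Section hamiltonian.
Variable R : realType.
Variable G : R -> R.

Lemma locally_lipschitz_continuous : locally_lipschitz G -> continuous G.
Proof.
move=> Glip p; have [U pU LU] := Glip p.
have [k [k0 HL]] : exists k : R, 0 < k /\ forall x, U x -> `|G p - G x| <= k * `|p - x|.
  move: LU; rewrite /lipschitz_on => -[M [Mr HM]].
  exists (`|M| + 1); split; first by rewrite ltr_wpDl.
  move=> x Ux; have /HM/(_ (p, x)) : M < `|M| + 1 by rewrite (le_lt_trans (ler_norm M)) // ltrDl.
  by apply; split => //=; exact: nbhs_singleton pU.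
apply/cvgrPdist_lt => e e0; near=> x.
have xU : U x by near: x.
apply: (le_lt_trans (HL x xU)); rewrite mulrC -ltr_pdivlMr //.
near: x; have ek : 0 < e / k by rewrite divr_gt0.
exact: (nbhsx_ballx p _ ek).
Unshelve. all: by end_near. Qed.

(** Compactness gives one constant [k] for pairs closer than [k^-1]. For the others the bound [B] on
    [|G|] is enough, since then [2 * B <= 2 * B * k * |s - t|]. *)
Lemma locally_lipschitz_itv (q : R) : locally_lipschitz G ->
  exists2 k : R, 0 < k & forall s t, `|s| <= q -> `|t| <= q -> `|G s - G t| <= k * `|s - t|.
Proof.
move=> Glip; have Gc := locally_lipschitz_continuous Glip.
have cK : compact `[- q, q] by exact: segment_compact.
have /compact_near_coveringP ncK := cK.
have : \forall k \near +oo, forall s, `[- q, q]%classic s ->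
    forall t, `|s - t| < k^-1 -> `|G s - G t| <= k * `|s - t|.
  apply: (ncK _ (pinfty_nbhs R) (fun k s => forall t, `|s - t| < k^-1 -> `|G s - G t| <= k * `|s - t|)).
  move=> p Kp; have [U pU [M [Mr HM]]] := Glip p.
  have [r r0 rU] : exists2 r : R, 0 < r & forall x, `|p - x| < r -> U x.
    by move: pU; rewrite -nbhs_ballE => -[r r0 rU]; exists r => // x h; exact: rU.
  have r2 : 0 < r / 2 by rewrite divr_gt0.
  near=> s k => t st.
  have ps : `|p - s| < r / 2 by near: s; exact: (nbhsx_ballx p _ r2).
  have k0 : 0 < k by near: k; apply: nbhs_pinfty_gt.
  have kr : k^-1 < r / 2.
    by rewrite invf_plt ?posrE //; near: k; apply: nbhs_pinfty_gt; rewrite num_real.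
  have kM : M < k by near: k; apply: nbhs_pinfty_gt.
  have Us : U s by apply: rU; rewrite (lt_trans ps) // gtr_pMr // invf_lt1 ?ltr1n.
  have Ut : U t.
    apply: rU; have -> : p - t = (p - s) + (s - t) by ring.
    apply: le_lt_trans (ler_normD _ _) _.
    by rewrite [ltRHS]splitr ltrD // (lt_trans st kr).
  by apply: (HM k kM (s, t)).
case=> M [Mr HM]; pose k := `|M| + 1.
have k0 : 0 < k by rewrite ltr_wpDl.
have Mk : M < k by rewrite (le_lt_trans (ler_norm M)) // ltrDl.
have [B B0 HB] := continuous_bounded_itv q Gc.
exists (k + 2 * B * k).
  by rewrite ltr_pwDl // mulr_ge0 ?(ltW k0) // mulr_ge0.
move=> s t sq tq; have [st|st] := ltP `|s - t| k^-1.
  have Ks : `[- q, q]%classic s by rewrite /= in_itv /= -ler_norml.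
  apply: (le_trans (HM k Mk s Ks t st)); rewrite ler_wpM2r // lerDl.
  by rewrite mulr_ge0 ?(ltW k0) // mulr_ge0.
have h1 : `|G s - G t| <= 2 * B.
  by apply: le_trans (ler_normB _ _) _; have := HB s sq; have := HB t tq; lra.
apply: (le_trans h1); have h2 : 1 <= k * `|s - t|.
  by rewrite -(mulfV (lt0r_neq0 k0)) ler_pM2l.
have h3 : 0 <= 2 * B by rewrite mulr_ge0.
have h4 : 2 * B <= 2 * B * (k * `|s - t|) by rewrite ler_peMr.
move: h2 h4; clear; lra.
Unshelve. all: by end_near. Qed.

Hypothesis Glip : locally_lipschitz G.
Hypothesis G00 : G 0 = 0.
Hypothesis Gincr : forall p q : R, 0 <= p -> p < q -> G p < G q.

Let Gc : continuous G := locally_lipschitz_continuous Glip.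

Lemma hamiltonian_le p q : 0 <= p -> p <= q -> G p <= G q.
Proof. by move=> p0; rewrite le_eqVlt => /predU1P[->//|/(Gincr p0)/ltW]. Qed.

(** [m] is the minimum of [G (s + e) - G s] over [[0, Q]], positive by strict monotonicity. It plays
    the part of a lower bound on the derivative of [G], which need not exist. *)
Lemma hamiltonian_gap (Q e : R) : 0 < e -> exists2 m : R, 0 < m &
  forall s t, 0 <= s -> s + e <= t -> t <= Q -> m <= G t - G s.
Proof.
move=> e0; have [Q0|Q0] := ltP Q 0.
  exists 1 => // s t s0 st tQ; exfalso; move: s0 st tQ Q0 e0; clear; lra.
pose D s := G (s + e) - G s.
have Dc : continuous D.
  move=> s; apply: cvgB; last exact: Gc.
  apply: (@continuous_comp _ _ _ (fun s => s + e) G); last exact: Gc.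
  by apply: cvgD; [exact: cvg_id|exact: cvg_cst].
have [s /[!in_itv]/= /andP[s0 _] Hs] := EVT_min Q0 (continuous_subspaceT Dc).
exists (D s); first by rewrite subr_gt0 Gincr // ltrDl.
move=> u t u0 ut tQ; apply: le_trans (Hs u _) _.
  by rewrite in_itv /= u0 /=; move: ut tQ e0; clear; lra.
by rewrite lerD2r; apply: hamiltonian_le => //; rewrite addr_ge0 // ltW.
Qed.

Hypothesis Gpinfty : G p @[p --> +oo] --> +oo.

Lemma G2inv_spec (lam : R) : 0 <= lam -> 0 <= G2inv G lam /\ G (G2inv G lam) = lam.
Proof.
move=> lam0.
have [t t0 Gt] : exists2 t : R, 0 <= t & lam <= G t.
  have /cvgryPge/(_ lam) [M [Mr HM]] := Gpinfty.
  exists (`|M| + 1); first by rewrite addr_ge0.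
  by apply: HM; rewrite (le_lt_trans (ler_norm M)) // ltrDl.
have : Num.min (G 0) (G t) <= lam <= Num.max (G 0) (G t).
  by rewrite ge_min le_max G00 lam0 Gt /= orbT.
move=> /(IVT t0 (continuous_subspaceT Gc)) [c /[!in_itv]/= /andP[c0 _] Gcl].
have inj : {in [set p : R | 0 <= p] &, injective G}.
  move=> x y /set_mem /= x0 /set_mem /= y0 E; have [xy|yx|//] := ltgtP x y.
    by have := Gincr x0 xy; rewrite E ltxx.
  by have := Gincr y0 yx; rewrite E ltxx.
have -> : G2inv G lam = c by rewrite /G2inv -Gcl pinvKV // inE.
by split.
Qed.

Lemma G2inv_ge0 (lam : R) : 0 <= lam -> 0 <= G2inv G lam.
Proof. by case/G2inv_spec. Qed.

Lemma G2invK (lam : R) : 0 <= lam -> G (G2inv G lam) = lam.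
Proof. by case/G2inv_spec. Qed.

Lemma G2inv_le (lam mu : R) : 0 <= lam -> lam <= mu -> G2inv G lam <= G2inv G mu.
Proof.
move=> lam0 lm; have mu0 := le_trans lam0 lm; rewrite leNgt; apply/negP => h.
by have := Gincr (G2inv_ge0 mu0) h; rewrite !G2invK // ltNge lm.
Qed.

End hamiltonian.

(** * The first-order equation of the corrector slopes *)

Section slope_equation.
Variable R : realType.
Variable G : R -> R.

(** The corrector equation divided by the diffusion coefficient and written for [f = F'], with
    [c = 1 / a]. *)
Definition slope_equation (c W : R -> R) (lam : R) (f : R -> R) :=
  forall x : R, is_derive x 1 f (c x * (lam - W x - G (f x))).

Lemma corrector_slope (A W : R -> R) (lam p q : R) (F : R -> R) : (forall x, 0 < A x) -> corrector A G W lam p q F ->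
  [/\ forall x : R, is_derive x 1 F (derive1 F x),
      slope_equation (fun x => (A x)^-1) W lam (derive1 F) &
      forall x, p <= derive1 F x <= q].
Proof.
move=> A0 [[d1 d2 _] eqF _ b]; split => //.
  by move=> x; split; [exact: d1|rewrite derive1E].
move=> x; split; first exact: d2.
have := eqF x; rewrite -derive1E => <-.
rewrite (_ : derive1n 2 F x = derive1 (derive1 F) x) //.
by field; rewrite lt0r_neq0.
Qed.

Lemma slope_corrector (A W : R -> R) (lam p q : R) (f : R -> R) : continuous G -> (forall x, 0 < A x) ->
  continuous (fun x => (A x)^-1) -> continuous W ->
  slope_equation (fun x => (A x)^-1) W lam f -> (forall x, p <= f x <= q) ->
  corrector A G W lam p q (prim f).
Proof.
move=> Gc A0 cA cW df b.
have cf : continuous f by move=> x; exact: is_derive_continuous (df x).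
have dF (x : R) : is_derive x 1 (prim f) (f x) by exact: is_derive_prim.
have E1 : derive1 (prim f) = f by apply/funext => x; rewrite derive1E; have [_ ->] := dF x.
have E2 x : derive1 f x = (A x)^-1 * (lam - W x - G (f x)).
  by rewrite derive1E; have [_ ->] := df x.
have E3 : derive1n 2 (prim f) = derive1 f by rewrite -{2}E1.
split.
- split; first by move=> x; case: (dF x).
    by rewrite E1 => x; case: (df x).
  rewrite E3 => x; have -> : derive1 f = fun x => (A x)^-1 * (lam - W x - G (f x)) by apply/funext.
  apply: cvgM; first exact: cA.
  apply: cvgB; first by apply: cvgB; [exact: cvg_cst|exact: cW].
  by apply: (@continuous_comp _ _ _ f G); [exact: cf|exact: Gc].
- by move=> x; rewrite E3 E1 E2; field; rewrite lt0r_neq0.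
- exact: prim0.
- by move=> x; rewrite E1.
Qed.

Lemma corrector_opp (A W : R -> R) (lam p q : R) (F : R -> R) : corrector A G W lam p q F ->
  corrector (fun x => A (- x)) (fun p => G (- p)) (fun x => W (- x)) lam (- q) (- p) (fun x => F (- x)).
Proof.
move=> [[d1 d2 c2] eqF F0 b].
have dF (x : R) : is_derive x 1 F (derive1 F x) by split; [exact: d1|rewrite derive1E].
have ddF (x : R) : is_derive x 1 (derive1 F) (derive1n 2 F x) by split; [exact: d2|rewrite -derive1E].
have dO (x : R) : is_derive x 1 (fun x => F (- x)) (- derive1 F (- x)).
  exact: is_derive_comp_opp.
have E1 : derive1 (fun x => F (- x)) = fun x => - derive1 F (- x).
  by apply/funext => x; rewrite derive1E; have [_ ->] := dO x.
have ddO (x : R) : is_derive x 1 (fun x => - derive1 F (- x)) (derive1n 2 F (- x)).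
  have h := is_deriveN (is_derive_comp_opp (ddF (- x))).
  by rewrite -[X in is_derive _ _ _ X]opprK; exact: h.
have E2 : derive1n 2 (fun x => F (- x)) = fun x => derive1n 2 F (- x).
  apply/funext => x; transitivity (derive1 (derive1 (fun x : R => F (- x))) x); first by [].
  by rewrite E1 derive1E; have [_ ->] := ddO x.
split.
- split; first by move=> x; case: (dO x).
    by rewrite E1 => x; case: (ddO x).
  rewrite E2 => x; apply: (@continuous_comp _ _ _ (fun x : R => - x) (derive1n 2 F)); last exact: c2.
  exact: opp_continuous.
- by move=> x; rewrite E2 E1 opprK eqF.
- by rewrite oppr0.
- by move=> x; rewrite E1 !lerN2 andbC b.
Qed.

Variables (c W : R -> R).
Hypothesis c1 : forall x, 1 <= c x.

(** Wherever [g - f > e], the gap [m] of [G] outweighs [mu - lam] and, as [c >= 1], [g - f]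
    decreases at rate at least [m - (mu - lam)]: impossible for bounded slopes. Equal levels give
    uniqueness, close levels the continuity of theta. *)
Lemma slope_upper (lam mu Q e m : R) f g : slope_equation c W lam f -> slope_equation c W mu g ->
  (forall x, 0 <= f x) -> (forall x, g x <= Q) -> (forall x, f x <= Q) -> (forall x, 0 <= g x) ->
  (forall s t, 0 <= s -> s + e <= t -> t <= Q -> m <= G t - G s) -> mu - lam < m ->
  forall x, g x - f x <= e.
Proof.
move=> df dg f0 gQ fQ g0 Hm lm.
have dd (x : R) : is_derive x 1 (fun x => g x - f x)
  (c x * (mu - W x - G (g x)) - c x * (lam - W x - G (f x))) := is_deriveB (dg x) (df x).
apply: (@backward_bound _ _ _ Q _ (m - (mu - lam)) dd).
- by move=> x; have := gQ x; have := f0 x; clear; lra.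
- by rewrite subr_gt0.
move=> x ex; have := Hm (f x) (g x) (f0 x) _ (gQ x) => H.
have {}H : m <= G (g x) - G (f x) by apply: H; move: ex; clear; lra.
have h1 : 0 <= m - (mu - lam) by rewrite subr_ge0 ltW.
have h2 : m - (mu - lam) <= c x * (m - (mu - lam)) by rewrite ler_peMl.
have h3 : c x * (m - (mu - lam)) <= c x * (G (g x) - G (f x) - (mu - lam)).
  by rewrite ler_wpM2l ?lerB // (le_trans ler01) // c1.
move: h2 h3; clear; lra.
Qed.

(** If [g - f] were below [(mu - lam) / (2 * k)], the Lipschitz bound would leave at least half of
    [mu - lam] in the equation of [f - g], which would then blow up backwards. Integrated, this
    makes the inverse of theta locally Lipschitz. *)
Lemma slope_lower (lam mu Q k : R) f g : slope_equation c W lam f -> slope_equation c W mu g ->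
  (forall x, 0 <= f x <= Q) -> (forall x, 0 <= g x <= Q) ->
  (forall p q : R, 0 <= p -> p <= q -> G p <= G q) -> 0 < k ->
  (forall s t, `|s| <= Q -> `|t| <= Q -> `|G s - G t| <= k * `|s - t|) -> lam < mu ->
  forall x, mu - lam <= 2 * k * (g x - f x).
Proof.
move=> df dg fb gb Gi k0 HL lm.
have dd (x : R) : is_derive x 1 (fun x => f x - g x)
  (c x * (lam - W x - G (f x)) - c x * (mu - W x - G (g x))) := is_deriveB (df x) (dg x).
have D0 : 0 < mu - lam by rewrite subr_gt0.
have k2 : 0 < 2 * k by rewrite mulr_gt0.
suff H x : f x - g x <= - ((mu - lam) / (2 * k)).
  move=> x; have := H x; rewrite lerNr opprB ler_pdivrMr // => h; by rewrite mulrC.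
apply: (@backward_bound _ _ _ Q _ ((mu - lam) / 2) dd).
- by move=> y; have /andP[_ h1] := fb y; have /andP[h2 _] := gb y; move: h1 h2; clear; lra.
- by rewrite divr_gt0.
move=> y ex.
have /andP[f0 fQ] := fb y; have /andP[g0 gQ] := gb y.
have GG : G (g y) - G (f y) <= (mu - lam) / 2.
  have [gf|/ltW fg] := leP (g y) (f y).
    have := Gi _ _ g0 gf; move: D0; clear; lra.
  have h1 : `|G (g y) - G (f y)| <= k * `|g y - f y| by apply: HL; rewrite ger0_norm.
  apply: (le_trans (ler_norm _)); apply: (le_trans h1).
  rewrite ger0_norm ?subr_ge0 //.
  have : g y - f y <= (mu - lam) / (2 * k) by move: ex; clear; lra.
  rewrite ler_pdivlMr // ler_pdivlMr //; clear; lra.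
have h1 : 0 <= (mu - lam) / 2 by rewrite divr_ge0 // ltW.
have h2 : (mu - lam) / 2 <= c y * ((mu - lam) / 2) by rewrite ler_peMl.
have h3 : c y * ((mu - lam) / 2) <= c y * (mu - lam - (G (g y) - G (f y))).
  rewrite ler_wpM2l //; first by rewrite (le_trans ler01).
  by move: GG; clear; lra.
move: h2 h3; clear; lra.
Qed.

End slope_equation.

(** * The maps [theta_1] and [theta_2] *)

Section bounded.
Variables (R : realType) (d : measure_display) (Omega : measurableType d).
Variable P : probability Omega R.

Lemma bounded_integrable (f : Omega -> R) (M : R) : measurable_fun setT f ->
  (forall w, `|f w| <= M) -> P.-integrable setT (EFin \o f).
Proof.
move=> mf fM; apply: measurable_bounded_integrable => //.
  by apply: le_lt_trans (probability_le1 P measurableT) _; rewrite ltry.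
by exists M; split; [exact: num_real|move=> x Mx w _; exact: le_trans (fM w) (ltW Mx)].
Qed.

Lemma Rintegral_probability_cst (r : R) : \int[P]_w r = r.
Proof.
transitivity (r * fine (P setT)); first exact: Rintegral_cst.
by rewrite probability_setT mulr1.
Qed.

End bounded.

Lemma clamp_increment (R : realType) (b L u v : R) : b <= L -> u <= v ->
  0 <= Num.max b (Num.min v L) - Num.max b (Num.min u L) <= v - u.
Proof.
move=> bL uv.
case: (leP v L) => vL; case: (leP u L) => uL.
- case: (leP b v) => bv; case: (leP b u) => bu; apply/andP; split; move: bL uv vL uL bv bu; clear; lra.
- exfalso; move: uv vL uL; clear; lra.
- rewrite (max_r bL); case: (leP b u) => bu; apply/andP; split; move: bL uv vL uL bu; clear; lra.
- by rewrite subrr lexx subr_ge0.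
Qed.

Lemma measure_preserving_group_opp (R : realType) (d : measure_display) (Omega : measurableType d)
    (P : probability Omega R) (tau : R -> Omega -> Omega) :
  measure_preserving_group P tau -> measure_preserving_group P (fun x => tau (- x)).
Proof.
move=> [t0 tD tm tP]; split.
- by rewrite oppr0.
- by move=> x y; rewrite opprD tD.
- have mo : measurable_fun setT (fun z : measurableTypeR R * Omega => (- z.1, z.2) : measurableTypeR R * Omega).
    apply: measurable_fun_pair; last exact: measurable_snd.
    apply: measurableT_comp; last exact: measurable_fst.
    by apply: continuous_measurable_fun => x; exact: opp_continuous.
  exact: (measurableT_comp tm mo).
- by move=> x; exact: tP.
Qed.

(** Only the branch [p >= 0] of [G] is constrained: the branch [p <= 0] is that
    of the medium reflected by [x |-> - x], [p |-> - p]. *)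
Record medium (R : realType) (d : measure_display) (Omega : measurableType d)
    (P : probability Omega R) (tau : R -> Omega -> Omega) (beta : R)
    (G : R -> R) (a V : R -> Omega -> R) : Prop := Medium {
  medium_group : measure_preserving_group P tau;
  medium_beta : 0 < beta;
  medium_lip : locally_lipschitz G;
  medium_G0 : G 0 = 0;
  medium_incr : forall p q : R, 0 <= p -> p < q -> G p < G q;
  medium_pinfty : G p @[p --> +oo] --> +oo;
  medium_a : forall x w, 0 < a x w <= 1;
  medium_V : forall x w, 0 <= V x w <= 1;
  medium_a_meas : measurable_fun setT (a 0);
  medium_V_meas : measurable_fun setT (V 0);
  medium_a_stat : stationary tau a;
  medium_V_stat : stationary tau V;
  medium_a_cont : forall w, continuous (a ^~ w);
  medium_V_cont : forall w, continuous (V ^~ w) }.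

(** * Correctors and mean slopes on the branch of nonnegative slopes *)

Section medium.
Variables (R : realType) (d : measure_display) (Omega : measurableType d).
Variables (P : probability Omega R) (tau : R -> Omega -> Omega) (beta : R).
Variables (G : R -> R) (a V : R -> Omega -> R).
Hypothesis M : medium P tau beta G a V.
Local Notation T := (measurableTypeR R * Omega)%type.

Let W w x := beta * V x w.
Let c w x := (a x w)^-1.

Let Gc : continuous G := locally_lipschitz_continuous (medium_lip M).
Let a0 x w : 0 < a x w. Proof. by have /andP[] := medium_a M x w. Qed.
Let Gle := hamiltonian_le (medium_incr M).
Let Gspec := G2inv_spec (medium_lip M) (medium_G0 M) (medium_incr M) (medium_pinfty M).
Let inv_le := G2inv_le (medium_lip M) (medium_G0 M) (medium_incr M) (medium_pinfty M).

Let W_cont w : continuous (W w).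
Proof. by move=> x; apply: cvgM; [exact: cvg_cst|exact: (medium_V_cont M)]. Qed.

Lemma medium_cinv_cont w : continuous (fun x => (a x w)^-1).
Proof. by move=> x; apply: cvgV; [exact: lt0r_neq0|exact: (medium_a_cont M)]. Qed.

Lemma medium_cinv_ge1 w x : 1 <= (a x w)^-1.
Proof. by have /andP[h1 h2] := medium_a M x w; rewrite invf_ge1. Qed.

Lemma medium_stat_measurable (f : R -> Omega -> R) : stationary tau f ->
  measurable_fun setT (f 0) -> measurable_fun setT (fun z : T => f z.1 z.2).
Proof.
move=> fs mf; have -> : (fun z : T => f z.1 z.2) = f 0 \o (fun z : T => tau z.1 z.2).
  by apply/funext => z; rewrite fs.
by apply: measurableT_comp => //; have [] := medium_group M.
Qed.

Lemma medium_tauD x y w : tau (x + y) w = tau x (tau y w).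
Proof. by have [_ -> _ _] := medium_group M. Qed.

Definition slope2 (lam : R) (w : Omega) (x : R) : R := derive1 (F2 G a V beta lam w) x.

Section level.
Variable lam : R.
Hypothesis blam : beta <= lam.
Let b0 : 0 < beta := medium_beta M.
Let p := G2inv G (lam - beta).
Let q := G2inv G lam.

Let lam0 : 0 <= lam. Proof. exact: le_trans (ltW b0) blam. Qed.
Let lamb0 : 0 <= lam - beta. Proof. by rewrite subr_ge0. Qed.
Let p0 : 0 <= p. Proof. by have [] := Gspec lamb0. Qed.
Let pq : p <= q. Proof. by apply: inv_le => //; rewrite lerBlDr lerDl ltW. Qed.

Let Gpq y w : G p <= lam - W w y <= G q.
Proof.
have [_ ->] := Gspec lamb0; have [_ ->] := Gspec lam0.
have /andP[h1 h2] := medium_V M y w; rewrite lerD2l lerN2 ler_piMr ?(ltW b0) //=.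
by rewrite gerBl mulr_ge0 // ltW.
Qed.

Lemma slope_solution : exists f : Omega -> R -> R,
  [/\ forall w, slope_equation G (c w) (W w) lam (f w),
      forall w x, G2inv G (lam - beta) <= f w x <= G2inv G lam &
      measurable_fun setT (f ^~ 0)].
Proof.
(* A Lipschitz constant of [G] on [[- q, q]] makes [ka * s - G s] nondecreasing on [[p, q]], as the
   iteration requires. *)
have [ka ka0 HL] := locally_lipschitz_itv q (medium_lip M).
have mono s t : p <= s -> s <= t -> t <= q -> ka * s - G s <= ka * t - G t.
  move=> ps st tq; have h : `|G t - G s| <= ka * `|t - s|.
    have s0 := le_trans p0 ps; have t0 := le_trans s0 st.
    by apply: HL; rewrite ger0_norm // (le_trans st).
  have := le_trans (ler_norm _) h; rewrite ger0_norm ?subr_ge0 //; lra.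
exists (fun w x => ode_solution G lam ka p (c w) (W w) x); split.
- move=> w x; exact: (@is_derive_ode_solution _ G lam ka p q Gc ka0 p0 pq mono _ _
    (@medium_cinv_cont w) (@medium_cinv_ge1 w) (@W_cont w) (Gpq ^~ w)).
- move=> w x; exact: (@ode_solution_bound _ G lam ka p q Gc ka0 p0 pq mono _ _
    (@medium_cinv_cont w) (@medium_cinv_ge1 w) (@W_cont w) (Gpq ^~ w)).
have ms := @measurable_ode_solution R d Omega (fun x w => c w x) (fun x w => W w x) G lam ka p q
  Gc ka0 p0 pq mono medium_cinv_cont (fun x w => medium_cinv_ge1 w x) W_cont Gpq.
have m1 : measurable_fun setT (fun z : T => c z.2 z.1).
  have -> : (fun z : T => c z.2 z.1) = (fun r => r `^ (-1)) \o (fun z : T => a z.1 z.2).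
    by apply/funext => z; rewrite /= powR_inv1 // ltW.
  apply: measurableT_comp; first exact: measurable_powR.
  exact: medium_stat_measurable (medium_a_stat M) (medium_a_meas M).
have m2 : measurable_fun setT (fun z : T => W z.2 z.1).
  apply: measurable_funM; first exact: measurable_cst.
  exact: medium_stat_measurable (medium_V_stat M) (medium_V_meas M).
by have := measurableT_comp (ms m1 m2) (measurable_pair1 (0 : measurableTypeR R)).
Qed.

Lemma slope_unique w f g : slope_equation G (c w) (W w) lam f -> slope_equation G (c w) (W w) lam g ->
  (forall x, p <= f x <= q) -> (forall x, p <= g x <= q) -> f = g.
Proof.
move=> df dg fb gb.
have le e f1 g1 x : 0 < e -> slope_equation G (c w) (W w) lam f1 -> slope_equation G (c w) (W w) lam g1 ->
  (forall x, p <= f1 x <= q) -> (forall x, p <= g1 x <= q) -> g1 x - f1 x <= e.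
  move=> e0 df1 dg1 fb1 gb1; have [m m0 Hm] := hamiltonian_gap (medium_lip M) (medium_incr M) q e0.
  apply: (slope_upper (@medium_cinv_ge1 w) df1 dg1 (Q := q) (m := m)) => //.
  - by move=> y; have /andP[h _] := fb1 y; exact: le_trans h.
  - by move=> y; have /andP[] := gb1 y.
  - by move=> y; have /andP[] := fb1 y.
  - by move=> y; have /andP[h _] := gb1 y; exact: le_trans h.
  - by rewrite subrr.
apply/funext => x; apply: le_anti; apply/andP; split.
  by apply/ler_addgt0Pr => e e0; rewrite addrC -lerBlDr; apply: (@le e g f).
by apply/ler_addgt0Pr => e e0; rewrite addrC -lerBlDr; apply: (@le e f g).
Qed.

Lemma F2_corrector w : corrector (a ^~ w) G (fun x => beta * V x w) lam
  (G2inv G (lam - beta)) (G2inv G lam) (F2 G a V beta lam w).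
Proof.
apply: (@xgetPex _ (fun=> 0) [set F | corrector (a ^~ w) G (fun x => beta * V x w) lam
               (G2inv G (lam - beta)) (G2inv G lam) F]).
have [f [df bf _]] := slope_solution.
exists (prim (f w)); apply: slope_corrector => //.
- exact: medium_cinv_cont.
- exact: W_cont.
- exact: df.
Qed.

Lemma slope2_equation w : slope_equation G (fun x => (a x w)^-1) (fun x => beta * V x w) lam (slope2 lam w).
Proof. by have [] := corrector_slope (fun x => a0 x w) (F2_corrector w). Qed.

Lemma slope2_bound w x : G2inv G (lam - beta) <= slope2 lam w x <= G2inv G lam.
Proof. by have [_ _ ->] := corrector_slope (fun x => a0 x w) (F2_corrector w). Qed.

Lemma is_derive_F2 w (x : R) : is_derive x 1 (F2 G a V beta lam w) (slope2 lam w x).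
Proof. by have [] := corrector_slope (fun x => a0 x w) (F2_corrector w). Qed.

Lemma F2_0 w : F2 G a V beta lam w 0 = 0.
Proof. by have [_ _ -> _] := F2_corrector w. Qed.

Lemma F2_unique w F : corrector (a ^~ w) G (fun x => beta * V x w) lam
  (G2inv G (lam - beta)) (G2inv G lam) F -> F = F2 G a V beta lam w.
Proof.
move=> cF; have [dF eF bF] := corrector_slope (fun x => a0 x w) cF.
have E : derive1 F = slope2 lam w.
  apply: (@slope_unique w _ _ eF _ bF); [exact: slope2_equation|exact: slope2_bound].
apply/funext => x; have [_ _ F0 _] := cF.
rewrite E in dF; have := derive_unique dF (is_derive_F2 w) x 0.
by rewrite F0 F2_0 !subr0.
Qed.

(** The translate by [x] of the slope in [w] solves the slope equation of the medium [tau x w],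
    within the same bounds; uniqueness identifies the two. *)
Lemma slope2_stationary w x : slope2 lam w x = slope2 lam (tau x w) 0.
Proof.
have E : (fun y => slope2 lam w (x + y)) = slope2 lam (tau x w).
  have sE f : stationary tau f -> forall y, f (x + y) w = f y (tau x w).
    by move=> fs y; rewrite fs [RHS]fs addrC medium_tauD.
  apply: (@slope_unique (tau x w)).
  - move=> y; have := is_derive_comp_shift (slope2_equation w (x + y)).
    by rewrite (sE _ (medium_a_stat M)) (sE _ (medium_V_stat M)).
  - exact: slope2_equation.
  - by move=> y; exact: slope2_bound.
  - by move=> y; exact: slope2_bound.
by rewrite -E addr0.
Qed.

(** The choice made by [xget] carries no measurability of its own; uniqueness identifies its slope
    with the limit of the measurable iterates. *)
Lemma slope2_measurable : measurable_fun setT (slope2 lam ^~ 0).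
Proof.
have [f [df bf mf]] := slope_solution.
have -> : slope2 lam ^~ 0 = f ^~ 0; last by [].
apply/funext => w; have -> // : slope2 lam w = f w.
apply: (@slope_unique w _ _ _ (df w) _ (bf w)); [exact: slope2_equation|exact: slope2_bound].
Qed.

Lemma slope2_ge0 w x : 0 <= slope2 lam w x.
Proof. by have /andP[h _] := slope2_bound w x; exact: le_trans h. Qed.

Lemma slope2_integrable : P.-integrable setT (EFin \o (slope2 lam ^~ 0)).
Proof.
apply: (@bounded_integrable _ _ _ _ _ q slope2_measurable) => w.
by rewrite ger0_norm ?slope2_ge0 //; have /andP[] := slope2_bound w 0.
Qed.

End level.

Let th := theta2 P G a V beta.

Lemma theta2E lam : theta2 P G a V beta lam = \int[P]_w slope2 lam w 0.
Proof. by rewrite /theta2 unlock. Qed.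

Lemma theta2_bound lam : beta <= lam -> G2inv G (lam - beta) <= th lam <= G2inv G lam.
Proof.
move=> bl; rewrite /th theta2E; have i := slope2_integrable bl.
have ic r : P.-integrable setT (EFin \o (fun=> r)).
  by apply: (@bounded_integrable _ _ _ _ _ `|r|) => //; exact: measurable_cst.
apply/andP; split.
  rewrite -[leLHS](Rintegral_probability_cst P); apply: le_Rintegral => // w _.
  by have /andP[] := slope2_bound bl w 0.
rewrite -[leRHS](Rintegral_probability_cst P); apply: le_Rintegral => // w _.
by have /andP[] := slope2_bound bl w 0.
Qed.

(** The expectation of [slope_lower], with a constant uniform for levels up to [Lam]: the source of
    both the strict monotonicity of theta and the continuity of the effective Hamiltonian. *)
Lemma theta2_increment Lam : exists2 k : R, 0 < k & forall lam mu, beta <= lam -> lam < mu ->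
  mu <= Lam -> mu - lam <= k * (th mu - th lam).
Proof.
have [bL|Lb] := leP beta Lam; last first.
  exists 1 => // lam mu bl lm mL; exfalso; move: bl lm mL Lb; lra.
pose Q := G2inv G Lam.
have [k k0 HL] := locally_lipschitz_itv Q (medium_lip M).
exists (2 * k); first by rewrite mulr_gt0.
move=> lam mu bl lm mL; have bm := le_trans bl (ltW lm).
have l0 := le_trans (ltW (medium_beta M)) bl; have m0 := le_trans (ltW (medium_beta M)) bm.
have bQ nu w x : beta <= nu -> nu <= Lam -> 0 <= slope2 nu w x <= Q.
  move=> bn nL; rewrite slope2_ge0 //=; have /andP[_ h] := slope2_bound bn w x.
  by apply: le_trans h _; apply: inv_le => //; exact: le_trans (ltW (medium_beta M)) bn.
have H w : mu - lam <= 2 * k * (slope2 mu w 0 - slope2 lam w 0).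
  apply: (slope_lower (@medium_cinv_ge1 w) (slope2_equation bl w) (slope2_equation bm w) (Q := Q)) => //.
  - by move=> x; apply: bQ => //; exact: le_trans (ltW lm) mL.
  - by move=> x; exact: bQ.
have i1 := slope2_integrable bl; have i2 := slope2_integrable bm.
have i3 : P.-integrable setT (EFin \o (fun w => slope2 mu w 0 - slope2 lam w 0)).
  exact: (@integrableB _ _ _ P setT measurableT _ _ i2 i1).
rewrite /th !theta2E -RintegralB // -RintegralZl // -[leLHS](Rintegral_probability_cst P).
apply: le_Rintegral => //.
- by apply: (@bounded_integrable _ _ _ _ _ `|mu - lam|) => //; exact: measurable_cst.
- by have := @integrableZl _ _ _ P setT measurableT (2 * k) _ i3; under eq_fun do rewrite -EFinM.
Qed.

Lemma theta2_modulus Lam (e : R) : 0 < e -> exists2 m : R, 0 < m & forall lam mu, beta <= lam -> beta <= mu ->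
  lam <= Lam -> mu <= Lam -> mu - lam < m -> th mu - th lam <= e.
Proof.
move=> e0; pose Q := G2inv G Lam.
have [m m0 Hm] := hamiltonian_gap (medium_lip M) (medium_incr M) Q e0.
exists m => // lam mu bl bm lL mL lm.
have bQ nu w x : beta <= nu -> nu <= Lam -> 0 <= slope2 nu w x <= Q.
  move=> bn nL; rewrite slope2_ge0 //=; have /andP[_ h] := slope2_bound bn w x.
  by apply: le_trans h _; apply: inv_le => //; exact: le_trans (ltW (medium_beta M)) bn.
have H w : slope2 mu w 0 - slope2 lam w 0 <= e.
  apply: (slope_upper (@medium_cinv_ge1 w) (slope2_equation bl w) (slope2_equation bm w) (Q := Q) (m := m)) => //.
  - by move=> x; have /andP[] := bQ lam w x bl lL.
  - by move=> x; have /andP[] := bQ mu w x bm mL.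
  - by move=> x; have /andP[] := bQ lam w x bl lL.
  - by move=> x; have /andP[] := bQ mu w x bm mL.
have i1 := slope2_integrable bl; have i2 := slope2_integrable bm.
rewrite /th !theta2E -RintegralB // -[leRHS](Rintegral_probability_cst P).
apply: le_Rintegral => //.
- exact: (@integrableB _ _ _ P setT measurableT _ _ i2 i1).
- by apply: (@bounded_integrable _ _ _ _ _ `|e|) => //; exact: measurable_cst.
Qed.

Lemma theta2_lt lam mu : beta <= lam -> lam < mu -> th lam < th mu.
Proof.
move=> bl lm; have [k k0 H] := theta2_increment mu.
have := H lam mu bl lm (lexx _) => h; rewrite -subr_gt0.
have : 0 < k * (th mu - th lam) by apply: lt_le_trans h; rewrite subr_gt0.
by rewrite pmulr_rgt0.
Qed.

Lemma theta2_inj : {in [set lam : R | beta <= lam] &, injective th}.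
Proof.
move=> x y /set_mem /= x0 /set_mem /= y0 E; have [xy|yx|//] := ltgtP x y.
  by have := theta2_lt x0 xy; rewrite E ltxx.
by have := theta2_lt y0 yx; rewrite E ltxx.
Qed.

Lemma theta2_surj p : th beta <= p -> exists2 lam, beta <= lam & th lam = p.
Proof.
move=> bp; have b0 := medium_beta M.
have p0 : 0 <= p.
  have /andP[h _] := theta2_bound (lexx beta); apply: le_trans (le_trans h bp).
  by rewrite subrr; have [] := Gspec (lexx 0).
(* At this level every slope is at least [G2inv G (G p + 1)], which exceeds [p]; the mean slope is
   then at least [p]. *)
pose Lam := beta + G p + 1.
have Gp0 : 0 <= G p by rewrite -(medium_G0 M); exact: Gle.
have bL : beta <= Lam by rewrite /Lam -addrA lerDl addr_ge0.
have pL : p <= th Lam.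
  have /andP[h _] := theta2_bound bL; apply: le_trans h.
  have [h1 h2] := @Gspec (Lam - beta) (ltac:(rewrite subr_ge0; exact: bL)).
  rewrite leNgt; apply/negP => h3; have := medium_incr M h1 h3; rewrite h2 /Lam.
by lra.
(* The modulus of theta is available on [[beta, Lam]] only; clamping the argument gives a continuous
   function on the line, for the intermediate value theorem. *)
pose f x := th (Num.max beta (Num.min x Lam)).
have fc : continuous f.
  move=> x; apply/cvgrPdist_lt => e e0; have e2 : 0 < e / 2 by rewrite divr_gt0.
  have [m m0 Hm] := theta2_modulus Lam e2.
  near=> y.
  have xy : `|x - y| < m by near: y; exact: (nbhsx_ballx x _ m0).
  pose X (z : R) := Num.max beta (Num.min z Lam).
  have bX z : beta <= X z by rewrite /X le_max lexx.
  have XL z : X z <= Lam by rewrite /X ge_max bL ge_min lexx orbT.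
  have LX (u v : R) : u <= v -> 0 <= X v - X u <= v - u.
    by move=> uv; exact: clamp_increment.
  have XX : X x - X y < m /\ X y - X x < m.
    move: xy; rewrite ltr_norml => /andP[x1 x2]; have [xy|/ltW yx] := leP x y.
      by have /andP[l1 l2] := LX _ _ xy; split; lra.
    by have /andP[l1 l2] := LX _ _ yx; split; lra.
  have [h1 h2] := XX.
  have l1 := Hm _ _ (bX y) (bX x) (XL y) (XL x) h1.
  have l2 := Hm _ _ (bX x) (bX y) (XL x) (XL y) h2.
  have e2e : e / 2 < e by rewrite gtr_pMr // invf_lt1 // ltr1n.
  have H : `|th (X x) - th (X y)| <= e / 2 by rewrite ler_norml lerNl opprB l1 l2.
  exact: le_lt_trans H e2e.
have fb : f beta = th beta by rewrite /f min_l // maxxx.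
have fL : f Lam = th Lam by rewrite /f minxx max_r.
have : Num.min (f beta) (f Lam) <= p <= Num.max (f beta) (f Lam).
  by rewrite ge_min le_max fb fL bp pL orbT.
move=> /(IVT bL (continuous_subspaceT fc)) [x /[!in_itv]/= /andP[x1 x2] fx].
exists x; first exact: x1.
by rewrite -fx /f (min_l x2) (max_r x1).
Unshelve. all: by end_near. Qed.

End medium.

(** * The branch of nonpositive slopes, by reflection *)

Section reflection.
Variables (R : realType) (d : measure_display) (Omega : measurableType d).
Variables (P : probability Omega R) (tau : R -> Omega -> Omega) (beta : R).
Variables (G : R -> R) (a V : R -> Omega -> R).
Local Notation T := (measurableTypeR R * Omega)%type.

Let Gr p := G (- p).
Let ar x := a (- x).
Let Vr x := V (- x).

Lemma locally_lipschitz_opp : locally_lipschitz G -> locally_lipschitz (fun p => G (- p)).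
Proof.
move=> Gl p; have [U pU [M [Mr HM]]] := Gl (- p).
exists (-%R @^-1` U).
  have oc : {for p, continuous (-%R : R -> R)} by exact: opp_continuous.
  exact: oc.
exists M; split=> // k Mk [x y] [/= Ux Uy].
have /= := HM k Mk (- x, - y) (conj Ux Uy).
have -> : - x - - y = - (x - y) by ring.
by rewrite normrN.
Qed.

Lemma medium_reflect : medium P tau beta G a V ->
  (forall p q : R, p < q -> q <= 0 -> G q < G p) -> G p @[p --> -oo] --> +oo ->
  medium P (fun x => tau (- x)) beta Gr ar Vr.
Proof.
move=> M Gd Gn.
split.
- exact: measure_preserving_group_opp (medium_group M).
- exact: medium_beta M.
- exact/locally_lipschitz_opp/(medium_lip M).
- by rewrite /Gr oppr0 (medium_G0 M).
- by move=> p q p0 pq; apply: Gd; rewrite ?ltrN2 // oppr_le0.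
- apply: (cvg_comp _ _ _ Gn).
  by rewrite -ninfty.
- by move=> x w; exact: medium_a M _ _.
- by move=> x w; exact: medium_V M _ _.
- by rewrite /ar oppr0; exact: medium_a_meas M.
- by rewrite /Vr oppr0; exact: medium_V_meas M.
- by move=> x w; rewrite /ar oppr0; exact: medium_a_stat M _ _.
- by move=> x w; rewrite /Vr oppr0; exact: medium_V_stat M _ _.
- move=> w x; apply: (@continuous_comp _ _ _ (fun x : R => - x) (a ^~ w)); first exact: opp_continuous.
  exact: medium_a_cont M _ _.
- move=> w x; apply: (@continuous_comp _ _ _ (fun x : R => - x) (V ^~ w)); first exact: opp_continuous.
  exact: medium_V_cont M _ _.
Qed.

Hypothesis M : medium P (fun x => tau (- x)) beta Gr ar Vr.

Lemma G1inv_reflect (mu : R) : 0 <= mu -> G1inv G mu = - G2inv Gr mu.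
Proof.
move=> mu0; have [h1 h2] := G2inv_spec (medium_lip M) (medium_G0 M) (medium_incr M) (medium_pinfty M) mu0.
have inj : {in [set p : R | p <= 0] &, injective G}.
  move=> x y /set_mem /= x0 /set_mem /= y0 E; have [xy|yx|//] := ltgtP x y.
    have := @medium_incr _ _ _ _ _ _ _ _ _ M (- y) (- x); rewrite /Gr !opprK E ltxx ltrN2 oppr_ge0.
    by move=> /(_ y0 xy).
  have := @medium_incr _ _ _ _ _ _ _ _ _ M (- x) (- y); rewrite /Gr !opprK E ltxx ltrN2 oppr_ge0.
  by move=> /(_ x0 yx).
have -> : G1inv G mu = G1inv G (G (- G2inv Gr mu)) by congr (G1inv G _); exact: esym h2.
by rewrite /G1inv pinvKV // inE /= oppr_le0.
Qed.

Section level.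
Variable lam : R.
Hypothesis bl : beta <= lam.

(** Reflection exchanges the sets from which [F1] and [F2] are chosen, but two values of [xget] can
    only be identified through uniqueness. *)
Lemma F1_reflect w : F1 G a V beta lam w = fun x => F2 Gr ar Vr beta lam w (- x).
Proof.
have b0 := medium_beta M.
have l0 : 0 <= lam by exact: le_trans (ltW b0) bl.
have lb0 : 0 <= lam - beta by rewrite subr_ge0.
have E : F1 G a V beta lam w \in [set F | corrector (a ^~ w) G (fun x => beta * V x w) lam
               (G1inv G lam) (G1inv G (lam - beta)) F].
  rewrite inE; apply: xgetPex; exists (fun x => F2 Gr ar Vr beta lam w (- x)).
  have := corrector_opp (F2_corrector M bl w); rewrite /= -!G1inv_reflect //.
  by rewrite /ar /Vr /Gr; under eq_fun do rewrite opprK; under [X in corrector _ X]eq_fun do rewrite opprK;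
    under [X in corrector _ _ X]eq_fun do rewrite opprK.
move: E; rewrite inE /= => /corrector_opp; rewrite !G1inv_reflect // !opprK => /(F2_unique M bl) E.
by apply/funext => x; rewrite -E opprK.
Qed.

Lemma F1_slope w : [/\ forall x : R, is_derive x 1 (F1 G a V beta lam w) (derive1 (F1 G a V beta lam w) x),
  slope_equation G (fun x => (a x w)^-1) (fun x => beta * V x w) lam (derive1 (F1 G a V beta lam w)) &
  forall x, derive1 (F1 G a V beta lam w) x = - slope2 beta Gr ar Vr lam w (- x)].
Proof.
pose f x := - slope2 beta Gr ar Vr lam w (- x).
have d1 (x : R) : is_derive x 1 (F1 G a V beta lam w) (f x).
  by rewrite F1_reflect; exact: is_derive_comp_opp (is_derive_F2 M bl w (- x)).
have E : derive1 (F1 G a V beta lam w) = f.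
  by apply/funext => x; rewrite derive1E; have [_ ->] := d1 x.
rewrite E; split => // x.
have := is_deriveN (is_derive_comp_opp (slope2_equation M bl w (- x))).
by rewrite opprK /ar /Vr /Gr !opprK.
Qed.

End level.

Lemma theta1_reflect lam : beta <= lam -> theta1 P G a V beta lam = - theta2 P Gr ar Vr beta lam.
Proof.
move=> bl; rewrite (theta2E P beta Gr ar Vr lam) /theta1 unlock.
transitivity (\int[P]_w (- slope2 beta Gr ar Vr lam w 0)).
  by apply: eq_Rintegral => w _; have [_ _ ->] := F1_slope bl w; rewrite oppr0.
have := RintegralZl (-1) measurableT (slope2_integrable M bl).
by rewrite mulN1r => <-; apply: eq_Rintegral => w _; rewrite mulN1r.
Qed.

End reflection.

(** * The ergodic theorem *)

Section lebesgue_shift.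
Variable R : realType.
Local Notation mu := (@lebesgue_measure R).

Lemma measurable_shift (k : R) :
  measurable_fun setT ((fun y : R => y + k) : R -> measurableTypeR R).
Proof.
by apply: continuous_measurable_fun => x; apply: cvgD; [exact: cvg_id|exact: cvg_cst].
Qed.

Lemma itv_shift (a b k : R) :
  (fun y => y + k) @^-1` `]a + k, b + k]%classic = `]a, b]%classic.
Proof.
by apply/seteqP; split => y /=; rewrite !in_itv /= ltrD2r lerD2r.
Qed.

Lemma lebesgue_measure_shift (k : R) (A : set R) : measurable A ->
  pushforward mu ((fun y => y + k) : R -> measurableTypeR R) A = mu A.
Proof.
move=> mA; apply/esym/lebesgue_measure_unique => //=; first exact: measurable_shift.
move=> _ _ [[a b]] _ <-; rewrite /pushforward.
have -> : `]a, b]%classic = `]a - k + k, b - k + k]%classic by rewrite !subrK.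
by rewrite itv_shift !lebesgue_measure_itv /= !lte_fin !subrK ltrD2r -!EFinB; case: ifP => // _; congr EFin; ring.
Qed.

Lemma Rintegral_shift (f : R -> R) (a b k : R) : measurable_fun setT f ->
  (forall y, 0 <= f y) ->
  \int[mu]_(y in `]a, b]) f (y + k) = \int[mu]_(y in `]a + k, b + k]) f y.
Proof.
move=> mf f0; rewrite /Rintegral; congr fine.
pose sh : R -> measurableTypeR R := fun y => y + k.
transitivity (\int[pushforward mu sh]_(y in `](a + k)%R, (b + k)%R]) (f y)%:E)%E; last first.
  apply: eq_measure_integral => [|msh A mA _]; [exact: measurable_shift|exact: lebesgue_measure_shift].
rewrite ge0_integral_pushforward //=.
- by rewrite /sh itv_shift.
- exact: measurable_shift.
- by apply/measurable_EFinP; apply: measurable_funTS.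
- by move=> y _; rewrite lee_fin.
Qed.

Lemma Rintegral_itv_cst (k a b : R) : a <= b -> \int[mu]_(y in `]a, b]) k = k * (b - a).
Proof.
move=> ab; rewrite Rintegral_cst //.
have -> : fine (mu `]a, b]%classic) = b - a; last by [].
rewrite lebesgue_measure_itv /= lte_fin; case: ltP => //= ba.
by apply/esym/eqP; rewrite subr_eq0 eq_le ab ba.
Qed.

End lebesgue_shift.

Section invariance.
Variables (R : realType) (d : measure_display) (Omega : measurableType d).
Variables (P : probability Omega R) (T : Omega -> Omega).
Hypothesis mT : measurable_fun setT T.
Hypothesis pT : forall A, measurable A -> P (T @^-1` A) = P A.

Lemma Rintegral_invariant (f : Omega -> R) : measurable_fun setT f -> (forall w, 0 <= f w) ->
  \int[P]_w f (T w) = \int[P]_w f w.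
Proof.
move=> mf f0; rewrite /Rintegral; congr fine.
transitivity (\int[pushforward P T]_w (f w)%:E)%E; last first.
  by apply: eq_measure_integral => A mA _; exact: pT.
rewrite ge0_integral_pushforward //=.
- by apply/measurable_EFinP.
- by move=> y _; rewrite lee_fin.
Qed.

End invariance.

(** * Integrals along the orbits of the flow *)

Section orbit_integral.
Variables (R : realType) (d : measure_display) (Omega : measurableType d).
Variables (P : probability Omega R) (tau : R -> Omega -> Omega).
Hypothesis tauP : measure_preserving_group P tau.
Variables (K : R) (Psi : Omega -> R).
Hypothesis mPsi : measurable_fun setT Psi.
Hypothesis Psi0 : forall w, 0 <= Psi w.
Hypothesis PsiK : forall w, Psi w <= K.
Local Notation mu := (@lebesgue_measure R).
Local Notation RR := (measurableTypeR R).

(** Half-open intervals concatenate without overlap. *)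
Definition orbit_integral (a b : R) (w : Omega) : R := \int[mu]_(y in `]a, b]) Psi (tau y w).

Let mT : measurable_fun setT (fun z : RR * Omega => tau z.1 z.2).
Proof. by have [] := tauP. Qed.

Let mtau x : measurable_fun setT (tau x).
Proof. by have := measurableT_comp mT (measurable_pair1 (x : RR)). Qed.

Let mJ : measurable_fun setT (fun z : RR * Omega => Psi (tau z.1 z.2)).
Proof. exact: measurableT_comp. Qed.

Let mo w : measurable_fun setT (fun y : RR => Psi (tau y w)).
Proof. by have := measurableT_comp mJ (measurable_pair2 w). Qed.

Let itv_lty (a b : R) : (mu `]a, b]%classic < +oo)%E.
Proof. by rewrite lebesgue_measure_itv /=; case: ifP => // _; rewrite -EFinB ltry. Qed.

Let iK (a b : R) : mu.-integrable `]a, b] (EFin \o (fun=> K)).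
Proof.
apply: measurable_bounded_integrable => //.
- exact: itv_lty.
- by exists `|K|; split; [exact: num_real|move=> x Mx w _; exact: ltW].
Qed.

Let io w (a b : R) : mu.-integrable `]a, b] (EFin \o (fun y => Psi (tau y w))).
Proof.
apply: measurable_bounded_integrable => //.
- exact: itv_lty.
- exact: measurable_funTS.
- exists `|K|; split; [exact: num_real|move=> x Mx y _; rewrite /= ger0_norm //].
  by apply: le_trans (PsiK _) _; exact: le_trans (ler_norm K) (ltW Mx).
Qed.

Lemma orbit_integral_ge0 a b w : 0 <= orbit_integral a b w.
Proof. by apply: Rintegral_ge0 => y _. Qed.

Lemma orbit_integral_le a b w : a <= b -> orbit_integral a b w <= K * (b - a).
Proof.
move=> ab; apply: (@le_trans _ _ (\int[mu]_(y in `]a, b]) K)).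
  by apply: le_Rintegral.
by rewrite Rintegral_itv_cst.
Qed.

Lemma orbit_integral_compl a b w : a <= b ->
  \int[mu]_(y in `]a, b]) (K - Psi (tau y w)) = K * (b - a) - orbit_integral a b w.
Proof. by move=> ab; rewrite RintegralB // Rintegral_itv_cst. Qed.

Lemma orbit_integral_cat a b c w : a <= b -> b <= c ->
  orbit_integral a c w = orbit_integral a b w + orbit_integral b c w.
Proof.
move=> ab bc; rewrite /orbit_integral.
have E : `]a, c]%classic = `]a, b]%classic `|` `]b, c]%classic.
  by rewrite -itv_bndbnd_setU ?bnd_simp.
rewrite E Rintegral_setU // -?E //.
apply/disj_set2P; apply/seteqP; split => // y [] /=; rewrite !in_itv /= => /andP[_ yb] /andP[b2 _].
by move: (lt_le_trans b2 yb); rewrite ltxx.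
Qed.

Lemma orbit_integral_shift a b x w : orbit_integral a b (tau x w) = orbit_integral (a + x) (b + x) w.
Proof.
have := @Rintegral_shift R (fun y => Psi (tau y w)) a b x (mo w) (fun y => Psi0 _).
rewrite /orbit_integral => <-; congr Rintegral; apply/funext => y.
by have [_ -> _ _] := tauP.
Qed.

Lemma orbit_integral_measurable a b : measurable_fun setT (orbit_integral a b).
Proof.
have mf : measurable_fun setT (fun z : Omega * RR => Psi (tau z.2 z.1)).
  exact: (measurableT_comp mJ (@measurable_swap _ _ Omega RR)).
have mD : measurable (setT `*` `]a, b]%classic : set (Omega * RR)) by exact: measurableX.
have := @measurable_parametric_integral R _ Omega _ _ mD mf (fun z => Psi0 _).
apply: eq_measurable_fun => w _; rewrite /orbit_integral /=; congr Rintegral.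
by apply/seteqP; split => y /= => [[]|].
Qed.

(** Tonelli exchanges the integrals; by invariance of [P] the inner one no longer depends on [y],
    and the window has length [1]. *)
Lemma orbit_integral_mean : \int[P]_w orbit_integral 0 1 w = \int[P]_w Psi w.
Proof.
pose f (z : Omega * RR) := (Psi (tau z.2 z.1) * \1_(`]0, 1]%classic : set RR) z.2)%:E.
have mf : measurable_fun setT f.
  apply/measurable_EFinP; apply: measurable_funM.
    exact: (measurableT_comp mJ (@measurable_swap _ _ Omega RR)).
  apply: measurableT_comp; last exact: measurable_snd.
  exact: measurable_indic.
have f0 z : (0 <= f z)%E by rewrite lee_fin mulr_ge0 // indicE.
have m0 : 0 <= \int[P]_w Psi w by apply: Rintegral_ge0.
have iPsi : P.-integrable setT (EFin \o Psi).
  by apply: (@bounded_integrable _ _ _ P Psi K) => // w; rewrite ger0_norm.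
have := @fubini_tonelli _ _ Omega RR R P mu f mf f0.
have E1 w : (\int[mu]_y f (w, y) = (orbit_integral 0 1 w)%:E)%E.
  rewrite /orbit_integral /Rintegral fineK; last exact: integrable_fin_num (io w 0 1).
  by rewrite [RHS]integral_mkcond; apply: eq_integral => y _; rewrite /f /= patchE indicE; case: ifP; rewrite ?mulr1 ?mulr0.
under eq_integral => w _ do rewrite E1.
have E2 y : (\int[P]_w f (w, y) = (\int[P]_w Psi w * \1_(`]0, 1]%classic : set RR) y)%:E)%E.
  have h := @Rintegral_invariant _ _ _ P (tau y) (mtau y) (fun A mA => ltac:(by have [_ _ _ ->] := tauP)) Psi mPsi Psi0.
  rewrite /f /= indicE; case: (y \in _); last first.
    by rewrite mulr0; apply: integral0_eq => w _; rewrite mulr0.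
  rewrite mulr1 -h /Rintegral fineK.
    by apply: eq_integral => w _; rewrite mulr1.
  apply: integrable_fin_num => //; apply: (@bounded_integrable _ _ _ P _ K).
    by apply: measurableT_comp.
  by move=> w; rewrite ger0_norm.
under [in RHS]eq_integral => y _ do rewrite E2.
rewrite -/(Rintegral _ _ _) => E; rewrite {1}/Rintegral E.
set m := \int[P]_w Psi w.
have -> : (\int[mu]_y (m * \1_(`]0, 1]%classic : set RR) y)%:E)%E = (\int[mu]_(y in `]0%R, 1%R]) m%:E)%E.
  by rewrite [RHS]integral_mkcond; apply: eq_integral => y _; rewrite patchE indicE; case: ifP; rewrite ?mulr1 ?mulr0.
have e1 : mu `]0%R, 1%R]%classic = 1%E by rewrite lebesgue_measure_itv /= lte_fin ltr01 sube0.
transitivity (fine (m%:E * mu `]0%R, 1%R]%classic)); last by rewrite e1 mule1.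
by congr fine; exact: integral_cst.
Qed.

End orbit_integral.

(** * The maximal ergodic inequality *)

Section maximal_ergodic.
Variables (R : realType) (d : measure_display) (Omega : measurableType d).
Variables (P : probability Omega R) (T : Omega -> Omega).
Hypothesis mT : measurable_fun setT T.
Hypothesis pT : forall A, measurable A -> P (T @^-1` A) = P A.
Variables (f : Omega -> R) (B : R).
Hypothesis mf : measurable_fun setT f.
Hypothesis fB : forall w, `|f w| <= B.

Fixpoint birkhoff_sum n w : R := if n is m.+1 then f w + birkhoff_sum m (T w) else 0.

(** The maximum of [0] and of the first [n] Birkhoff sums, in the recursive form on which Garsia's
    argument rests. *)
Fixpoint maximal_sum n w : R :=
  if n is m.+1 then Num.max 0 (f w + maximal_sum m (T w)) else 0.

Lemma maximal_sum_ge0 n w : 0 <= maximal_sum n w.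
Proof. by case: n => //= n; rewrite le_max lexx. Qed.

Lemma maximal_sum_le n w : maximal_sum n w <= maximal_sum n.+1 w.
Proof.
elim: n w => [|n IH] w; first exact: maximal_sum_ge0.
rewrite [leRHS]/= le_max2 // lerD2l; exact: IH.
Qed.

Lemma maximal_sum_mono m n w : (m <= n)%N -> maximal_sum m w <= maximal_sum n w.
Proof.
by move=> /subnK <-; elim: (n - m)%N => // k IH; exact: le_trans IH (maximal_sum_le _ _).
Qed.

Lemma birkhoff_sum_le n w : birkhoff_sum n w <= maximal_sum n w.
Proof.
by elim: n w => // n IH w /=; rewrite le_max lerD2l IH orbT.
Qed.

Lemma maximal_sum_bound n w : maximal_sum n w <= B *+ n.
Proof.
have B0 : 0 <= B by exact: le_trans (normr_ge0 _) (fB w).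
elim: n w => [|n IH] w //=; rewrite ge_max mulrn_wge0 //= mulrS lerD //.
exact: le_trans (ler_norm _) (fB w).
Qed.

Lemma measurable_maximal_sum n : measurable_fun setT (maximal_sum n).
Proof.
elim: n => [|n IH] /=; first exact: measurable_cst.
apply: measurable_maxr; first exact: measurable_cst.
by apply: measurable_funD => //; exact: measurableT_comp.
Qed.

Let positive n := [set w | 0 < maximal_sum n w].

Let measurable_positive n : measurable (positive n).
Proof.
have := @measurable_set_le _ _ _ _ _ (measurable_maximal_sum n) (measurable_cst (0 : R)).
move=> /measurableC; congr measurable; apply/seteqP; split => w /=; rewrite /positive /= ltNge.
  by move/negP.
by move=> /negP.
Qed.

Let mfp n : measurable_fun setT (fun w => f w * \1_(positive n) w).
Proof. by apply: measurable_funM => //; exact: measurable_indic. Qed.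

Let fp_bound n w : `|f w * \1_(positive n) w| <= B.
Proof.
rewrite normrM indicE; case: (w \in _); first by rewrite normr1 mulr1.
by rewrite normr0 mulr0 (le_trans _ (fB w)).
Qed.

(** Where [maximal_sum n.+1] is positive, [f] is the difference of
    [maximal_sum n.+1] and [maximal_sum n \o T]. *)
Lemma garsia n : 0 <= \int[P]_w (f w * \1_(positive n) w).
Proof.
case: n => [|n].
  rewrite (_ : (fun w => _) = fun=> 0) ?Rintegral_probability_cst //.
  by apply/funext => w; rewrite indicE memNset ?mulr0 // /positive /= ltxx.
have iM m : P.-integrable setT (EFin \o maximal_sum m).
  apply: (@bounded_integrable _ _ _ P _ (B *+ m) (measurable_maximal_sum m)) => w.
  by rewrite ger0_norm ?maximal_sum_ge0 // maximal_sum_bound.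
have iMT m : P.-integrable setT (EFin \o (fun w => maximal_sum m (T w))).
  apply: (@bounded_integrable _ _ _ P _ (B *+ m)).
    by apply: measurableT_comp => //; exact: measurable_maximal_sum.
  by move=> w; rewrite ger0_norm ?maximal_sum_ge0 // maximal_sum_bound.
have inv := Rintegral_invariant mT pT (measurable_maximal_sum n) (maximal_sum_ge0 n).
have h1 : \int[P]_w maximal_sum n w <= \int[P]_w maximal_sum n.+1 w.
  by apply: le_Rintegral => // w _; exact: maximal_sum_le.
have h2 : \int[P]_w (maximal_sum n.+1 w - maximal_sum n (T w)) <= \int[P]_w (f w * \1_(positive n.+1) w).
  apply: le_Rintegral => //.
  - exact: (@integrableB _ _ _ P setT measurableT _ _ (iM n.+1) (iMT n)).
  - exact: (@bounded_integrable _ _ _ P _ B).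
  move=> w _; rewrite indicE; have := maximal_sum_ge0 n (T w).
  case: (boolP (w \in positive n.+1)).
    rewrite inE /positive /= lt_max ltxx /= => h _.
    by rewrite max_r ?(ltW h) // mulr1 addrK.
  move=> /negP; rewrite inE /positive /= => /negP; rewrite -leNgt => h1' h2'.
  by rewrite mulr0 subr_le0 (le_trans h1').
rewrite RintegralB // inv in h2.
by apply: le_trans h2; rewrite subr_ge0.
Qed.

(** The sets [positive n] increase to almost all of the space, so dominated convergence removes the
    indicator from [garsia]. *)
Lemma maximal_ergodic : {ae P, forall w, exists n, 0 < birkhoff_sum n w} ->
  0 <= \int[P]_w f w.
Proof.
move=> H.
have iB : P.-integrable setT (EFin \o (fun=> B)).
  by apply: (@bounded_integrable _ _ _ P _ `|B|) => //; exact: measurable_cst.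
have mfn n : measurable_fun setT (fun w => (f w * \1_(positive n) w)%:E) by exact/measurable_EFinP.
have mfE : measurable_fun setT (fun w => (f w)%:E) by exact/measurable_EFinP.
have [] := @dominated_convergence _ _ R P setT measurableT
  (fun n w => (f w * \1_(positive n) w)%:E) (fun w => (f w)%:E) (fun=> B%:E) mfn mfE _ iB _.
- apply: filterS H => w [n Sn] _.
  apply: cvg_near_cst; exists n => // m /= nm.
  by rewrite indicE mem_set ?mulr1 // /positive /= (lt_le_trans Sn) // (le_trans (birkhoff_sum_le _ _)) // maximal_sum_mono.
- by apply: nearW => w n _; rewrite /= lee_fin.
move=> ifn _ cv.
have cv' : \int[P]_w (f w * \1_(positive n) w) @[n --> \oo] --> \int[P]_w f w.
  by apply: fine_cvg; rewrite fineK //; exact: integrable_fin_num.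
rewrite -(cvg_lim _ cv') //; apply: limr_ge; first by apply/cvg_ex; eexists; exact: cv'.
by apply: nearW => n; exact: garsia.
Qed.

End maximal_ergodic.

Lemma shift_excess (R : realType) (p q r s u t N k : R) : p = q + r -> p = s + u ->
  q <= k -> 0 <= u -> t + (N + k) < s -> t + N < r.
Proof. by move=> -> E qk u0 ts; lra. Qed.

(** * Almost sure growth rate of orbit integrals *)

Section ergodic_theorem.
Variables (R : realType) (d : measure_display) (Omega : measurableType d).
Variables (P : probability Omega R) (tau : R -> Omega -> Omega).
Hypothesis tauP : measure_preserving_group P tau.
Hypothesis ergP : ergodic P tau.

Let tD x y w : tau (x + y) w = tau x (tau y w).
Proof. by have [_ -> _ _] := tauP. Qed.

Let t0 w : tau 0 w = w.
Proof. by have [-> _ _ _] := tauP. Qed.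

(** An inclusion for every real [x] is an equality, because [tau (- x)] inverts [tau x]. *)
Lemma ergodic_invariant (D : set Omega) : measurable D ->
  (forall x w, D w -> D (tau x w)) -> P D = 0%E \/ P D = 1%E.
Proof.
move=> mD H; apply: ergP => // x; apply/seteqP; split.
  by move=> _ [w Dw <-]; exact: H.
by move=> w Dw; exists (tau (- x) w); [exact: H|rewrite -tD subrr t0].
Qed.

Variables (K : R) (Psi : Omega -> R).
Hypothesis mPsi : measurable_fun setT Psi.
Hypothesis Psi0 : forall w, 0 <= Psi w.
Hypothesis PsiK : forall w, Psi w <= K.

Let I := orbit_integral tau Psi.
Let m := \int[P]_w Psi w.
Let I_ge0 a b w : 0 <= I a b w := orbit_integral_ge0 tau Psi0 a b w.
Let I_le a b w (ab : a <= b) : I a b w <= K * (b - a) := orbit_integral_le tauP mPsi Psi0 PsiK w ab.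
Let I_cat a b c w (ab : a <= b) (bc : b <= c) : I a c w = I a b w + I b c w :=
  orbit_integral_cat tauP mPsi Psi0 PsiK w ab bc.
Let I_shift a b x w : I a b (tau x w) = I (a + x) (b + x) w :=
  orbit_integral_shift tauP mPsi Psi0 a b x w.
Let mI a b : measurable_fun setT (I a b) := orbit_integral_measurable tauP mPsi Psi0 a b.

(** The event that [I 0 n - c n] is unbounded above is invariant under the
    whole flow; on it, the maximal ergodic theorem gives [c <= m]. *)
Lemma ergodic_upper (c : R) : m < c ->
  {ae P, forall w, exists N : nat, forall n : nat, I 0 n%:R w <= c * n%:R + N%:R}.
Proof.
move=> mc.
pose D := \bigcap_(N in [set: nat]) \bigcup_(n in [set: nat]) ~` [set w | I 0 n%:R w <= c * n%:R + N%:R].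
have mD : measurable D.
  apply: bigcap_measurable => // N _; apply: bigcup_measurable => n _; apply: measurableC.
  by apply: measurable_set_le; [exact: mI|exact: measurable_cst].
have DP w : D w <-> forall N : nat, exists n : nat, c * n%:R + N%:R < I 0 n%:R w.
  split=> [Dw N|H N _].
    by have [n _ /negP] := Dw N Logic.I; rewrite -ltNge; exists n.
  by have [n Hn] := H N; exists n => //; apply/negP; rewrite -ltNge.
have Dinv x w : D w -> D (tau x w).
  move=> /DP H; apply/DP => N.
  have K0 : 0 <= K by exact: le_trans (Psi0 w) (PsiK w).
  (* Translating the window of integration by [x] changes the integral by at most [K * |x|], which
     [k] absorbs into the constant [N]. *)
  have [k Hk] : exists k : nat, K * `|x| <= k%:R.
    by exists (Num.truncn (K * `|x|)).+1; apply/ltW/truncnS_gt.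
  have [n Hn] := H (N + k)%N; exists n; move: Hn; rewrite natrD I_shift add0r => Hn.
  have n0 : (0 : R) <= n%:R by rewrite ler0n.
  have [x0|/ltW x0] := leP 0 x.
    have e1 := @I_cat 0 x (n%:R + x) w x0 (ltac:(rewrite lerDr; exact: n0)).
    have e2 := @I_cat 0 n%:R (n%:R + x) w n0 (ltac:(rewrite lerDl; exact: x0)).
    have b1 := @I_le 0 x w x0; have b2 := I_ge0 n%:R (n%:R + x) w.
    rewrite ger0_norm // in Hk; rewrite subr0 in b1.
    by apply: shift_excess Hn; [exact: e1|exact: e2|exact: le_trans Hk|exact: b2].
  have e1 := @I_cat x (n%:R + x) n%:R w (ltac:(rewrite lerDr; exact: n0)) (ltac:(rewrite gerDl; exact: x0)).
  have e2 := @I_cat x 0 n%:R w x0 n0.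
  have b1 := @I_le (n%:R + x) n%:R w (ltac:(rewrite gerDl; exact: x0)); have b2 := I_ge0 x 0 w.
  rewrite ler0_norm // in Hk; rewrite opprD addrA subrr sub0r in b1.
  by apply: shift_excess Hn; [rewrite addrC in e1; exact: e1|rewrite addrC in e2; exact: e2|exact: le_trans Hk|exact: b2].
have [PD0|PD1] := ergodic_invariant mD Dinv.
  exists D; split => // w /= H; apply/DP => N; apply: contrapT => H'; apply: H; exists N => n.
  by rewrite leNgt; apply/negP => h; apply: H'; exists n.
exfalso.
(* The Birkhoff sums of [f] under the single map [tau 1] are [I 0 n - c n]. This map need not be
   ergodic: ergodicity of the flow has already been spent on showing that [D] has full measure. *)
pose f w := I 0 1 w - c.
have mf : measurable_fun setT f by apply: measurable_funB; [exact: mI|exact: measurable_cst].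
have Ib w : `|I 0 1 w| <= K by rewrite ger0_norm // (le_trans (I_le w ler01)) // subr0 mulr1.
have fB w : `|f w| <= K + `|c| by rewrite (le_trans (ler_normB _ _)) // lerD2r.
have m1 : measurable_fun setT (tau 1).
  have [_ _ mt _] := tauP.
  by have := measurableT_comp mt (measurable_pair1 (1 : measurableTypeR R)).
have p1 A : measurable A -> P (tau 1 @^-1` A) = P A by have [_ _ _ h] := tauP; exact: h.
have S n w : birkhoff_sum (tau 1) f n w = I 0 n%:R w - c * n%:R.
  elim: n w => [|n IH] w /=.
    rewrite mulr0 subr0; apply/esym/eqP; rewrite eq_le I_ge0 andbT.
    by apply: le_trans (I_le w (lexx 0)) _; rewrite subrr mulr0.
  rewrite IH I_shift add0r /f -natr1 (@I_cat 0 1 (n%:R + 1)) ?lerDr //.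
  by ring.
have : 0 <= \int[P]_w f w.
  apply: (maximal_ergodic m1 p1 mf fB).
  exists (~` D); split; first exact: measurableC.
    by rewrite probability_setC // PD1 subee.
  move=> w /= H Dw; apply: H; have [n Hn] := (DP w).1 Dw 0%N.
  by exists n; rewrite S subr_gt0; move: Hn; rewrite addr0.
have iI : P.-integrable setT (EFin \o I 0 1) by exact: (@bounded_integrable _ _ _ P _ K).
have ic : P.-integrable setT (EFin \o (fun=> c)).
  by apply: (@bounded_integrable _ _ _ P _ `|c|) => //; exact: measurable_cst.
rewrite RintegralB // Rintegral_probability_cst (orbit_integral_mean tauP mPsi Psi0 PsiK).
by rewrite leNgt subr_lt0 mc.
Qed.

End ergodic_theorem.

Section ergodic_linear.
Variables (R : realType) (d : measure_display) (Omega : measurableType d).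
Variables (P : probability Omega R).

(** The lower bound is the upper bound for [K - Psi]. The rates [1 / (k + 1)] allow one null set for
    all [eta], and the last incomplete unit interval costs at most [K]. *)
Lemma ergodic_linear (tau : R -> Omega -> Omega) (K : R) (Psi : Omega -> R) :
  measure_preserving_group P tau -> ergodic P tau ->
  measurable_fun setT Psi -> (forall w, 0 <= Psi w) -> (forall w, Psi w <= K) ->
  {ae P, forall w, forall eta : R, 0 < eta -> exists N : R, forall x : R, 0 <= x ->
    `|orbit_integral tau Psi 0 x w - \int[P]_w Psi w * x| <= eta * x + N}.
Proof.
move=> tauP ergP mPsi Psi0 PsiK.
set m := \int[P]_w Psi w.
pose Psi' w := K - Psi w.
have mPsi' : measurable_fun setT Psi' by apply: measurable_funB => //; exact: measurable_cst.
have Psi'0 w : 0 <= Psi' w by rewrite subr_ge0.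
have Psi'K w : Psi' w <= K by rewrite gerBl.
have iPsi : P.-integrable setT (EFin \o Psi).
  by apply: (@bounded_integrable _ _ _ P Psi K) => // w; rewrite ger0_norm.
have iPsi' : P.-integrable setT (EFin \o Psi').
  by apply: (@bounded_integrable _ _ _ P Psi' K) => // w; rewrite ger0_norm.
have mE : \int[P]_w Psi' w = K - m.
  have := RintegralD measurableT iPsi iPsi'.
  rewrite (_ : (fun w => _) = fun=> K); last by apply/funext => w; rewrite /Psi' addrC subrK.
  by rewrite Rintegral_probability_cst -/m => ->; rewrite addrC addKr.
have IE x w : 0 <= x -> orbit_integral tau Psi' 0 x w = K * x - orbit_integral tau Psi 0 x w.
  by move=> x0; have := orbit_integral_compl tauP mPsi Psi0 PsiK w x0; rewrite subr0.
have e0 k : 0 < k.+1%:R^-1 :> R by rewrite invr_gt0 ltr0n.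
have U k := ergodic_upper tauP ergP mPsi Psi0 PsiK (c := m + k.+1%:R^-1) (ltac:(rewrite ltrDl; exact: e0)).
have L k := ergodic_upper tauP ergP mPsi' Psi'0 Psi'K (c := K - m + k.+1%:R^-1) (ltac:(rewrite mE ltrDl; exact: e0)).
apply: filterS2 (ae_foralln U) (ae_foralln L) => w {}U {}L eta eta0.
have [k Hk] : exists k : nat, k.+1%:R^-1 <= eta.
  exists (Num.truncn eta^-1); rewrite invf_ple ?posrE ?ltr0n //; exact/ltW/truncnS_gt.
have [N1 HN1] := U k; have [N2 HN2] := L k.
have K0 : 0 <= K by exact: le_trans (Psi0 w) (PsiK w).
have m0 : 0 <= m by apply: Rintegral_ge0.
have mK : m <= K.
  rewrite -[leRHS](Rintegral_probability_cst P); apply: le_Rintegral => //.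
  by apply: (@bounded_integrable _ _ _ P _ `|K|) => //; exact: measurable_cst.
exists (N1%:R + N2%:R + K + eta) => x x0.
pose n := Num.truncn x.
have /andP[nx xn] : n%:R <= x < n.+1%:R by exact: truncn_itv.
have n0 : (0 : R) <= n%:R by rewrite ler0n.
have H1 := HN1 n; have H2 := HN2 n; rewrite IE // in H2.
set I := orbit_integral tau Psi in H1 H2 *.
have cat : I 0 x w = I 0 n%:R w + I n%:R x w := orbit_integral_cat tauP mPsi Psi0 PsiK w n0 nx.
have b0 : 0 <= I n%:R x w := orbit_integral_ge0 tau Psi0 _ _ w.
have bK : I n%:R x w <= K * (x - n%:R) := orbit_integral_le tauP mPsi Psi0 PsiK w nx.
have x1 : x - n%:R <= 1 by rewrite lerBlDl; apply/ltW; rewrite -[1]/(1%:R) -natrD addn1.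
have xx0 : 0 <= x - n%:R by rewrite subr_ge0.
have bK1 : K * (x - n%:R) <= K by rewrite ler_piMr.
have mx0 : 0 <= m * (x - n%:R) by rewrite mulr_ge0.
have mx1 : m * (x - n%:R) <= K.
  by apply: le_trans mK; rewrite ler_piMr.
have ek : k.+1%:R^-1 * n%:R <= eta * x by apply: ler_pM => //; rewrite invr_ge0.
have N10 : (0 : R) <= N1%:R by rewrite ler0n.
have N20 : (0 : R) <= N2%:R by rewrite ler0n.
rewrite mulrBr in mx0; rewrite mulrBr in mx1.
rewrite mulrDl in H1; rewrite mulrDl mulrBl in H2.
have bK2 := le_trans bK bK1.
rewrite ler_norml; move: H1 H2 cat b0 bK2 mx0 mx1 ek N10 N20 (ltW eta0).
move: (k.+1%:R^-1 * n%:R) (m * n%:R) (m * x) (K * n%:R) (eta * x) (I 0 x w) (I 0 n%:R w) (I n%:R x w) N1%:R N2%:R.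
by clear => *; apply/andP; split; lra.
Qed.

Lemma orbit_integral_FTC (tau : R -> Omega -> Omega) (Psi : Omega -> R) (F : R -> R) (x : R) w :
  continuous (fun y => Psi (tau y w)) ->
  (forall y : R, is_derive y 1 F (Psi (tau y w))) -> 0 <= x ->
  orbit_integral tau Psi 0 x w = F x - F 0.
Proof.
move=> cf dF x0; rewrite (prim_unique cf dF) /prim /orbit_integral.
rewrite Rintegral_itv_obnd_cbnd; last first.
  apply: integrableS (integrable_itv 0 x cf) => //.
  by apply: subset_itv; rewrite bnd_simp.
rewrite (_ : \int[lebesgue_measure]_(y in `[x, 0]) _ = 0) ?subr0 //.
move: x0; rewrite le_eqVlt => /predU1P[<-|x0].
  by rewrite set_itv1 Rintegral_set1.
by rewrite set_itv_ge ?Rintegral_set0 // bnd_simp -ltNge.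
Qed.

Lemma ergodic_opp (tau : R -> Omega -> Omega) :
  ergodic P tau -> ergodic P (fun x => tau (- x)).
Proof.
by move=> erg A mA H; apply: erg => // x; have := H (- x); rewrite opprK.
Qed.

(** The negative half-line is the positive one for the reversed flow, which preserves [P] and is
    ergodic as well. *)
Lemma ergodic_primitive (tau : R -> Omega -> Omega) (K : R) (Psi : Omega -> R) (F : Omega -> R -> R) :
  measure_preserving_group P tau -> ergodic P tau ->
  measurable_fun setT Psi -> (forall w, 0 <= Psi w) -> (forall w, Psi w <= K) ->
  (forall w, continuous (fun y => Psi (tau y w))) ->
  (forall w y, is_derive (y : R) 1 (F w) (Psi (tau y w))) -> (forall w, F w 0 = 0) ->
  {ae P, forall w, forall eta : R, 0 < eta -> exists N : R, forall x : R,
    `|F w x - \int[P]_w Psi w * x| <= eta * `|x| + N}.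
Proof.
move=> tauP ergP mPsi Psi0 PsiK cf dF F0.
have H1 := ergodic_linear tauP ergP mPsi Psi0 PsiK.
have H2 := ergodic_linear (measure_preserving_group_opp tauP) (ergodic_opp ergP) mPsi Psi0 PsiK.
apply: filterS2 H1 H2 => w {}H1 {}H2 eta eta0.
have [N1 {}H1] := H1 eta eta0; have [N2 {}H2] := H2 eta eta0.
have N10 : 0 <= N1.
  by have := le_trans (normr_ge0 _) (H1 0 (lexx 0)); rewrite mulr0 add0r.
have N20 : 0 <= N2.
  by have := le_trans (normr_ge0 _) (H2 0 (lexx 0)); rewrite mulr0 add0r.
exists (N1 + N2) => x; have [x0|/ltW x0] := leP 0 x.
  have := H1 x x0; rewrite (orbit_integral_FTC (cf w) (dF w) x0) F0 subr0 (ger0_norm x0) => h.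
  by apply: le_trans h _; rewrite lerD2l lerDl.
have nx0 : 0 <= - x by rewrite oppr_ge0.
have cf' : continuous (fun y => Psi (tau (- y) w)).
  move=> y; apply: (@continuous_comp _ _ _ (fun y : R => - y) (fun y => Psi (tau y w))); last exact: cf.
  exact: opp_continuous.
have dF' (y : R) : is_derive y 1 (fun y => - F w (- y)) (Psi (tau (- y) w)).
  by have := is_deriveN (is_derive_comp_opp (dF w (- y))); rewrite opprK.
have := H2 (- x) nx0; rewrite (orbit_integral_FTC (tau := fun x => tau (- x)) cf' dF' nx0).
rewrite oppr0 F0 oppr0 subr0 opprK mulrN opprK (ler0_norm x0) -normrN opprD opprK => h.
by apply: le_trans h _; rewrite lerD2l lerDr.
Qed.

End ergodic_linear.

(** * Hills and gluing *)

Section hills.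
Variable R : realType.

(** [c] is the inverse of the diffusion coefficient; intervals are measured by
    its primitive. *)
Definition hill (c V : R -> R) (h C L1 L2 : R) : Prop :=
  [/\ L1 <= L2, C <= prim c L2 - prim c L1 & forall y, L1 <= y <= L2 -> h <= V y].

Lemma prim_le (c : R -> R) x y : continuous c -> (forall x, 0 <= c x) -> x <= y -> prim c x <= prim c y.
Proof.
move=> cc c0 xy; have dS (z : R) : is_derive z 1 (fun z => - prim c z) (- c z).
  exact: is_deriveN (is_derive_prim z cc).
have := derive_le_mono xy dS; rewrite lerN2; apply=> z _; rewrite oppr_le0; exact: c0.
Qed.

(** Rational end points reduce the existence of a hill to a countable union. Moving each end inwards
    costs less than [1 / 2] of the length, whence [C + 1]. *)
Lemma hill_rational (c V : R -> R) (h C L1 L2 : R) : continuous c -> (forall x, 0 <= c x) -> 0 < C ->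
  hill c V h (C + 1) L1 L2 -> exists q1 q2 : rat, hill c V h C (ratr q1) (ratr q2).
Proof.
move=> cc c0 C0 [L12 HC HV].
pose S := prim c.
have Sc : continuous S by move=> x; exact: is_derive_continuous (is_derive_prim x cc).
have LL : L1 < L2.
  rewrite lt_neqAle L12 andbT; apply/eqP => E; move: HC; rewrite E subrr; move: C0; clear; lra.
have h2 : 0 < 2^-1 :> R by rewrite invr_gt0.
have [d1 d10 H1] : exists2 e : R, 0 < e & forall x, `|x - L1| < e -> `|S x - S L1| < 2^-1.
  have /cvgrPdist_lt /(_ _ h2) := Sc L1; rewrite -nbhs_ballE => -[e e0 He].
  by exists e => // x h1; rewrite distrC; apply: He; rewrite /ball /= distrC.
have [d2 d20 H2] : exists2 e : R, 0 < e & forall x, `|x - L2| < e -> `|S x - S L2| < 2^-1.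
  have /cvgrPdist_lt /(_ _ h2) := Sc L2; rewrite -nbhs_ballE => -[e e0 He].
  by exists e => // x h1; rewrite distrC; apply: He; rewrite /ball /= distrC.
have l1 : L1 < Num.min L2 (L1 + d1) by rewrite lt_min LL ltrDl.
have l2 : Num.max L1 (L2 - d2) < L2 by rewrite gt_max LL gtrBl.
have [q1] := rat_in_itvoo l1; rewrite in_itv /= lt_min => /andP[q1a /andP[q1b q1c]].
have [q2] := rat_in_itvoo l2; rewrite in_itv /= gt_max => /andP[/andP[q2a q2b] q2c].
have s1 : `|S (ratr q1) - S L1| < 2^-1.
  apply: H1; rewrite ger0_norm ?subr_ge0 ?(ltW q1a) //; move: q1c; clear; lra.
have s2 : `|S (ratr q2) - S L2| < 2^-1.
  apply: H2; rewrite ler0_norm ?subr_le0 ?(ltW q2c) //; move: q2b; clear; lra.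
have SS : C <= S (ratr q2) - S (ratr q1).
  move: s1 s2 HC; rewrite /S !ltr_norml => /andP[_ a1] /andP[a2 _]; move: a1 a2; clear; lra.
exists q1, q2; split => //.
  rewrite leNgt; apply/negP => /ltW /(prim_le cc c0); rewrite -/S; move: SS C0; clear; lra.
move=> y /andP[y1 y2]; apply: HV; apply/andP; split.
  exact: le_trans (ltW q1a) y1.
exact: le_trans y2 (ltW q2c).
Qed.

Lemma continuous_ge_rat (V : R -> R) (h q1 q2 : R) : continuous V -> q1 < q2 ->
  (forall q : rat, q1 <= ratr q <= q2 -> h <= V (ratr q)) -> forall y, q1 <= y <= q2 -> h <= V y.
Proof.
move=> Vc q12 H y /andP[y1 y2]; rewrite leNgt; apply/negP => Vy.
have [e e0 He] : exists2 e : R, 0 < e & forall z, `|y - z| < e -> V z < h.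
  have : nbhs y [set z | V z < h] by exact: (continuous_usc Vc Vy).
  by rewrite -nbhs_ballE => -[e e0 He]; exists e => // z; exact: He.
have e2 : Num.max q1 (y - e) < Num.min q2 (y + e).
  rewrite gt_max !lt_min q12 /=; apply/andP; split.
    by apply: le_lt_trans y1 _; rewrite ltrDl.
  apply/andP; split; first by apply: lt_le_trans y2; rewrite gtrBl.
  by move: e0; clear; lra.
have [q] := rat_in_itvoo e2; rewrite in_itv /= gt_max lt_min => /andP[/andP[a1 a2] /andP[a3 a4]].
have : V (ratr q) < h by apply: He; rewrite ltr_norml; apply/andP; split; move: a2 a4; clear; lra.
by rewrite ltNge H // (ltW a1) (ltW a3).
Qed.

(** If an integral growing at rate [m] had the same value [J] at [x0 / e] and [(x0 + r) / e], the
    missing gain [m * r / e] would be covered by the two errors. The chosen rate makes these at most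
    half the gain plus [2 * N], too little for small [e]. *)
Lemma linear_growth_gap (m r x0 e N J : R) : 0 < m -> 0 < r -> 0 <= x0 -> 0 < e ->
  `|J - m * (x0 / e)| <= m * r / (2 * (2 * x0 + r)) * (x0 / e) + N ->
  `|J - m * ((x0 + r) / e)| <= m * r / (2 * (2 * x0 + r)) * ((x0 + r) / e) + N ->
  ~ e * (4 * `|N| + 1) < m * r.
Proof.
move=> m0 r0 x00 e0; set k := m * r / _ => h1 h2 eN.
have s0 : 0 < 2 * x0 + r by rewrite ltr_wpDl // mulr_ge0.
have h5 : k * (2 * x0 + r) = m * r / 2.
  by rewrite /k; field; rewrite lt0r_neq0.
have h6 : N * e <= `|N| * e by rewrite ler_wpM2r // ?ler_norm // ltW.
clearbody k.
have h3 : m * ((x0 + r) / e) - m * (x0 / e) <= k * ((x0 + r) / e) + k * (x0 / e) + 2 * N.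
  move: h1 h2; rewrite !ler_norml => /andP[_ a1] /andP[a2 _]; move: a1 a2; lra.
have h4 : m * r <= k * (2 * x0 + r) + 2 * N * e.
  have := ler_wpM2r (ltW e0) h3.
  have -> : (m * ((x0 + r) / e) - m * (x0 / e)) * e = m * r by field; rewrite lt0r_neq0.
  have -> // : (k * ((x0 + r) / e) + k * (x0 / e) + 2 * N) * e = k * (2 * x0 + r) + 2 * N * e.
  by field; rewrite lt0r_neq0.
move: h4 h5 h6 eN (mulr_gt0 m0 r0) e0; lra.
Qed.

End hills.

(** * Hills near every macroscopic point *)

Section hill_density.
Variables (R : realType) (d : measure_display) (Omega : measurableType d).
Variables (P : probability Omega R) (tau : R -> Omega -> Omega) (beta : R).
Variables (G : R -> R) (a V : R -> Omega -> R).
Hypothesis M : medium P tau beta G a V.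
Hypothesis erg : ergodic P tau.
Local Notation T := (measurableTypeR R * Omega)%type.

Let c w x := (a x w)^-1.
Let cc w : continuous (c w) := @medium_cinv_cont _ _ _ _ _ _ _ _ _ M w.
Let c0 w x : 0 <= c w x. Proof. exact: le_trans ler01 (medium_cinv_ge1 M w x). Qed.

Lemma hill_shift h C L1 L2 y w : hill (c (tau y w)) (V ^~ (tau y w)) h C L1 L2 ->
  hill (c w) (V ^~ w) h C (L1 + y) (L2 + y).
Proof.
have sE f : stationary tau f -> forall x, f x (tau y w) = f (y + x) w.
  by move=> fs x; rewrite fs [RHS]fs addrC (medium_tauD M).
have pE x : prim (c (tau y w)) x = prim (c w) (y + x) - prim (c w) y.
  have dS (z : R) : is_derive z 1 (fun z => prim (c w) (y + z)) (c (tau y w) z).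
    have := is_derive_comp_shift (is_derive_prim (y + z) (@cc w)).
    by rewrite /c (sE _ (medium_a_stat M)).
  by rewrite -(prim_unique (@cc _) dS) addr0.
move=> [L12 HC HV]; split; first by rewrite lerD2r.
  by move: HC; rewrite !pE ![y + _]addrC; lra.
move=> x /andP[x1 x2]; have -> : x = y + (x - y) by ring.
by rewrite -(sE _ (medium_V_stat M)); apply: HV; rewrite lerBrDr x1 lerBlDr x2.
Qed.

(** Rational end points and rational test points make the event measurable; [ratr q.1 < ratr q.2]
    lets continuity of [V] fill in the other points. The bound [n] makes the hill negligible after
    scaling. *)
Let hill_event (h C : R) (n : nat) : set Omega :=
  \bigcup_(q : rat * rat) ([set w | [/\ - (n%:R : R) <= ratr q.1, (ratr q.1 : R) < ratr q.2 & (ratr q.2 : R) <= n%:R]] `&`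
    ([set w | C <= prim (c w) (ratr q.2) - prim (c w) (ratr q.1)] `&`
     \bigcap_(q' : rat) ([set w | (ratr q.1 : R) <= (ratr q' : R) <= ratr q.2 -> h <= V (ratr q') w]))).

Let hill_eventP h C n w : hill_event h C n w -> exists L1 L2,
  [/\ hill (c w) (V ^~ w) h C L1 L2, - n%:R <= L1 & L2 <= n%:R].
Proof.
move=> [[q1 q2] _ /= [[n1 q12 n2] [HC HV]]]; exists (ratr q1), (ratr q2); split => //.
split; [exact: ltW|exact: HC|].
by apply: continuous_ge_rat => // [|q' h']; [exact: medium_V_cont M w|exact: HV].
Qed.

Let measurable_cst_set (Q : Prop) : measurable [set w : Omega | Q].
Proof. by have [q|q] := pselect Q; [rewrite (_ : mkset _ = setT)|rewrite (_ : mkset _ = set0)] => //; apply/seteqP; split. Qed.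

Let measurable_hill_event h C n : measurable (hill_event h C n).
Proof.
have mc : measurable_fun setT (fun z : T => c z.2 z.1).
  have -> : (fun z : T => c z.2 z.1) = (fun r => r `^ (-1)) \o (fun z : T => a z.1 z.2).
    by apply/funext => z; rewrite /= powR_inv1 //; have /andP[/ltW] := medium_a M z.1 z.2.
  apply: measurableT_comp; first exact: measurable_powR.
  apply: (medium_stat_measurable M) (medium_a_stat M) (medium_a_meas M).
have mp := @measurable_prim R d Omega (fun x w => c w x) mc (fun x w => c0 w x).
have mpx x : measurable_fun setT (fun w => prim (c w) x).
  by have := measurableT_comp mp (measurable_pair1 (x : measurableTypeR R)).
have mV := @medium_stat_measurable _ _ _ _ _ _ _ _ _ M _ (medium_V_stat M) (medium_V_meas M).
have mVx x : measurable_fun setT (V x).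
  by have := measurableT_comp mV (measurable_pair1 (x : measurableTypeR R)).
apply: countable_bigcupT_measurable => [|[q1 q2]]; first exact: countableP.
apply: measurableI; first exact: measurable_cst_set.
apply: measurableI.
  by apply: measurable_set_le; [exact: measurable_cst|exact: measurable_funB].
rewrite -[X in measurable X]setCK setC_bigcap; apply: measurableC.
apply: bigcupT_measurable_rat => q; apply: measurableC.
have [q12|q12] := pselect ((ratr q1 : R) <= (ratr q : R) <= ratr q2).
  rewrite (_ : mkset _ = [set w | h <= V (ratr q) w]).
    by apply: measurable_set_le => //; exact: measurable_cst.
  by apply/seteqP; split => w /= H //; exact: H.
rewrite (_ : mkset _ = setT); first exact: measurableT.
by apply/seteqP; split => w /= // _ /q12.
Qed.

(** The events [hill_event h C n] cover almost all of the space, so they cannot all be null. *)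
Let hill_event_pos (h C : R) : 0 < C ->
  {ae P, forall w, exists L1 L2, hill (c w) (V ^~ w) h (C + 1) L1 L2} ->
  exists n, (0 < P (hill_event h C n))%E.
Proof.
move=> C0 H; apply: contrapT => HN.
have P0 n : P (hill_event h C n) = 0%E.
  by apply/eqP; rewrite eq_le measure_ge0 andbT leNgt; apply/negP => h0; apply: HN; exists n.
have HN' n : {ae P, forall w, ~ hill_event h C n w}.
  by exists (hill_event h C n); split => // w /=; apply: contrapT.
have : {ae P, forall w, False}.
  apply: filterS2 H (ae_foralln HN') => w [L1 [L2 /(hill_rational (@cc w) (c0 w) C0)[q1 [q2 [q12 HC HV]]]]] Hn.
  have [n [n1 n2]] : exists n : nat, - (n%:R : R) <= ratr q1 /\ (ratr q2 : R) <= n%:R.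
    exists (maxn (Num.truncn `|ratr q1 : R|).+1 (Num.truncn `|ratr q2 : R|).+1); split.
      rewrite lerNl (le_trans (ler_norm _)) // normrN.
      by apply: le_trans (ltW (truncnS_gt _)) _; rewrite ler_nat leq_maxl.
    rewrite (le_trans (ler_norm _)) //.
    by apply: le_trans (ltW (truncnS_gt _)) _; rewrite ler_nat leq_maxr.
  apply: (Hn n); exists (q1, q2) => //; split => /=; last first.
    by split => // q' _ /=; exact: HV.
  split => //; rewrite lt_neqAle q12 andbT; apply/eqP => E.
  by move: HC; rewrite E subrr leNgt C0.
case=> A [mA PA HA]; have : P setT = 0%E.
  by rewrite (_ : setT = A) //; apply/seteqP; split => // w _; apply: HA.
by rewrite probability_setT => /eqP; rewrite onee_eq0.
Qed.

(** Without a visit to [A], the orbit integral of its indicator would be constant across the window,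
    against its growth at rate [m > 0]. *)
Lemma orbit_visit (t : R -> Omega -> Omega) (A : set Omega) (m : R) w :
  measure_preserving_group P t -> measurable A -> 0 < m ->
  (forall eta : R, 0 < eta -> exists N : R, forall x : R, 0 <= x ->
    `|orbit_integral t (\1_A : Omega -> R) 0 x w - m * x| <= eta * x + N) ->
  forall x0 r : R, 0 <= x0 -> 0 < r -> \forall e \near 0^'+,
    exists y, [/\ x0 / e <= y, y <= (x0 + r) / e & A (t y w)].
Proof.
move=> tP mA m0 H x0 r x00 r0.
have s0 : 0 < 2 * x0 + r by rewrite ltr_wpDl // mulr_ge0.
have k0 : 0 < m * r / (2 * (2 * x0 + r)) by rewrite divr_gt0 // mulr_gt0.
have [N HN] := H _ k0.
near=> e.
have e0 : 0 < e by near: e; exact: nbhs_right_gt.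
have ei : 0 < e^-1 by rewrite invr_gt0.
have x1 : 0 <= x0 / e by rewrite divr_ge0 // ltW.
have x12 : x0 / e <= (x0 + r) / e by rewrite ler_pM2r // lerDl ltW.
have x2 := le_trans x1 x12.
have eN : e * (4 * `|N| + 1) < m * r.
  rewrite -ltr_pdivlMr; last by rewrite ltr_wpDl // mulr_ge0.
  by near: e; apply: nbhs_right_lt; rewrite divr_gt0 ?mulr_gt0 // ltr_wpDl // mulr_ge0.
apply: contrapT => HA.
have mPsi : measurable_fun setT (\1_A : Omega -> R) by exact: measurable_indic.
have Psi0 v : 0 <= (\1_A : Omega -> R) v by rewrite indicE.
have Psi1 v : (\1_A : Omega -> R) v <= 1 by rewrite indicE lern1; case: (_ \in _).
have I0 : orbit_integral t (\1_A : Omega -> R) (x0 / e) ((x0 + r) / e) w = 0.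
  rewrite /orbit_integral (_ : 0 = \int[lebesgue_measure]_(y in `]x0 / e, (x0 + r) / e]) (0 : R)).
    apply: eq_Rintegral => y; rewrite inE /= in_itv /= => /andP[/ltW y1 y2].
    by rewrite indicE memNset // => Ay; apply: HA; exists y.
  by rewrite Rintegral_itv_cst // mul0r.
have cat := orbit_integral_cat tP mPsi Psi0 Psi1 w x1 x12.
have h1 := HN _ x1; have h2 := HN _ x2; rewrite cat I0 addr0 in h2.
exact: linear_growth_gap m0 r0 x00 e0 h1 h2 eN.
Unshelve. all: by end_near. Qed.

Lemma hill_density (h C : R) : 0 < C ->
  {ae P, forall w, exists L1 L2, hill (c w) (V ^~ w) h (C + 1) L1 L2} ->
  {ae P, forall w, forall x0 r : R, 0 < r -> \forall e \near 0^'+, exists L1 L2,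
     [/\ hill (c w) (V ^~ w) h C L1 L2, (x0 - r) / e <= L1 & L2 <= (x0 + r) / e]}.
Proof.
move=> C0 H; have [n Pn] := hill_event_pos C0 H.
set A := hill_event h C n in Pn *; have mA : measurable A by exact: measurable_hill_event.
have tP := medium_group M.
have mPsi : measurable_fun setT (\1_A : Omega -> R) by exact: measurable_indic.
have Psi0 v : 0 <= (\1_A : Omega -> R) v by rewrite indicE.
have Psi1 v : (\1_A : Omega -> R) v <= 1 by rewrite indicE lern1; case: (_ \in _).
have m0 : 0 < \int[P]_w (\1_A : Omega -> R) w.
  rewrite /Rintegral integral_indic // setIT fine_gt0 // Pn /=.
  by apply: le_lt_trans (probability_le1 P mA) _; rewrite ltry.
apply: filterS2 (ergodic_linear tP erg mPsi Psi0 Psi1)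
  (ergodic_linear (measure_preserving_group_opp tP) (ergodic_opp erg) mPsi Psi0 Psi1) => w H1 H2 x0 r r0.
(* Half of [r] is used to find a visit, the other half to contain the hill around it, which needs
   [n <= r / 2 / e]. For [x0 < 0] the visit is found with the reversed flow. *)
have r2 : 0 < r / 2 by rewrite divr_gt0.
have [x00|x00] := leP 0 x0.
  near=> e.
  have e0 : 0 < e by near: e; exact: nbhs_right_gt.
  have ei : 0 < e^-1 by rewrite invr_gt0.
  have [y [y1 y2 Ay]] : exists y, [/\ x0 / e <= y, y <= (x0 + r / 2) / e & A (tau y w)].
    by near: e; exact: orbit_visit tP mA m0 H1 _ _ x00 r2.
  have ne : n%:R <= r / 2 / e.
    rewrite ler_pdivlMr //; have n1 : (0 : R) < n%:R + 1 by rewrite ltr_wpDl.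
    have : e < r / 2 / (n%:R + 1) by near: e; apply: nbhs_right_lt; rewrite divr_gt0.
    rewrite ltr_pdivlMr // mulrDr mulr1 [n%:R * e]mulrC => /ltW h'; apply: le_trans h'; rewrite lerDl; exact: ltW.
  have [L1 [L2 [hL n1 n2]]] := hill_eventP Ay.
  exists (L1 + y), (L2 + y); split; first exact: hill_shift hL.
    rewrite mulrBl; have := mulr_gt0 r2 ei; lra.
  rewrite mulrDl in y2; rewrite mulrDl; have := mulr_gt0 r2 ei; lra.
have nx0 : 0 <= - x0 by rewrite oppr_ge0 ltW.
near=> e.
have e0 : 0 < e by near: e; exact: nbhs_right_gt.
have ei : 0 < e^-1 by rewrite invr_gt0.
have [y [y1 y2 Ay]] : exists y, [/\ - x0 / e <= y, y <= (- x0 + r / 2) / e & A (tau (- y) w)].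
  near: e; exact: orbit_visit (measure_preserving_group_opp tP) mA m0 H2 _ _ nx0 r2.
have ne : n%:R <= r / 2 / e.
  rewrite ler_pdivlMr //; have n1 : (0 : R) < n%:R + 1 by rewrite ltr_wpDl.
  have : e < r / 2 / (n%:R + 1) by near: e; apply: nbhs_right_lt; rewrite divr_gt0.
  rewrite ltr_pdivlMr // mulrDr mulr1 [n%:R * e]mulrC => /ltW h'; apply: le_trans h'; rewrite lerDl; exact: ltW.
have [L1 [L2 [hL n1 n2]]] := hill_eventP Ay.
exists (L1 - y), (L2 - y); split; first exact: hill_shift hL.
  rewrite mulrDl in y2; rewrite mulrBl; have := mulr_gt0 r2 ei; lra.
rewrite mulrDl; rewrite mulNr in y1; have := mulr_gt0 r2 ei; lra.
Unshelve. all: by end_near. Qed.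

End hill_density.

(** * A smooth step and the behaviour of slopes on a hill *)

Section smooth_step.
Variable R : realType.

Lemma derive0_const (f f' : R -> R) (a b : R) : a <= b -> (forall x : R, is_derive x 1 f (f' x)) ->
  (forall x, a < x < b -> f' x = 0) -> f a = f b.
Proof.
move=> ab df f0; apply/eqP; rewrite eq_le; apply/andP; split.
  have := derive_le_mono ab (fun x => is_deriveN (df x)); rewrite lerN2; apply=> x /f0 ->.
  by rewrite oppr0.
by apply: (derive_le_mono ab df) => x /f0 ->.
Qed.

(** [b] is twice the positive part of [x * (1 - x)], and [s] its normalized primitive. One
    continuous derivative is what is required, because slopes are glued and correctors are their
    primitives. *)
Lemma smooth_step : exists (s s' : R -> R) (B : R),
  [/\ forall x : R, is_derive x 1 s (s' x), continuous s',
      forall x, x <= 0 -> s x = 0 /\ s' x = 0,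
      forall x, 1 <= x -> s x = 1 /\ s' x = 0 &
      forall x, 0 <= s x <= 1 /\ `|s' x| <= B].
Proof.
pose y (x : R) := x * (1 - x); pose b (x : R) := y x + `|y x|.
have b0 x : 0 <= b x by rewrite /b -lerBlDl sub0r ler_normr lexx orbT.
have yc : continuous y by move=> x; apply: cvgM; [exact: cvg_id|apply: cvgB; [exact: cvg_cst|exact: cvg_id]].
have bc : continuous b by move=> x; apply: cvgD; [exact: yc|apply: cvg_norm; exact: yc].
have bl x : x <= 0 -> b x = 0.
  move=> x0; rewrite /b ler0_norm ?subrr // /y mulr_le0_ge0 //; move: x0; clear; lra.
have br x : 1 <= x -> b x = 0.
  move=> x1; rewrite /b ler0_norm ?subrr // /y mulr_ge0_le0 //; move: x1; clear; lra.
have b2 x : b x <= 2.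
  have y1 : y x <= 1.
    rewrite /y; have := sqr_ge0 (x - 2^-1); rewrite expr2 => h.
    have -> : x * (1 - x) = 4^-1 - (x - 2^-1) * (x - 2^-1) by field.
    move: h; clear; lra.
  rewrite /b; have [h|/ltW h] := leP 0 (y x).
    rewrite ger0_norm //; move: y1; clear; lra.
  by rewrite ler0_norm // subrr.
pose s := prim b; have ds (x : R) : is_derive x 1 s (b x) by exact: is_derive_prim.
have s0 : s 0 = 0 by exact: prim0.
have sl x : x <= 0 -> s x = 0.
  by move=> x0; rewrite -s0; apply: (derive0_const x0 ds) => z /andP[_ /ltW]; exact: bl.
have sr x : 1 <= x -> s x = s 1.
  by move=> x1; apply/esym; apply: (derive0_const x1 ds) => z /andP[/ltW h _]; exact: br.
have smono x z : x <= z -> s x <= s z by exact: prim_le.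
have s1 : 0 < s 1.
  have h13 : 4^-1 < 1 - 4^-1 :> R by lra.
  have [z] := MVT h13 (fun x _ => ds x) (is_derive_within ds).
  rewrite in_itv /= => /andP[z1 z2] E.
  have bz : 0 < b z.
    have yz : 0 < y z by apply: mulr_gt0; move: z1 z2; clear; lra.
    by rewrite /b gtr0_norm // addr_gt0.
  have e1 : 0 < s (1 - 4^-1) - s 4^-1.
    by rewrite E mulr_gt0 //; lra.
  have e2 : s (1 - 4^-1) <= s 1 by apply: smono; lra.
  have e3 : 0 <= s 4^-1 by rewrite -s0; apply: smono; lra.
  by move: e1 e2 e3; clear; lra.
exists (fun x => (s 1)^-1 * s x), (fun x => (s 1)^-1 * b x), ((s 1)^-1 * 2); split.
- by move=> x; exact: is_deriveZ (ds x).
- by move=> x; apply: cvgM; [exact: cvg_cst|exact: bc].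
- by move=> x x0; rewrite (sl x x0) (bl x x0) mulr0.
- by move=> x x1; rewrite (sr x x1) (br x x1) mulr0 mulVf // lt0r_neq0.
move=> x; split; last by rewrite ger0_norm ?ler_pM2l ?invr_gt0 // mulr_ge0 // invr_ge0 ltW.
rewrite mulr_ge0 /=; first last.
- by have [x0|/ltW x0] := leP x 0; [rewrite sl|rewrite -s0; exact: smono].
- by rewrite invr_ge0 ltW.
rewrite mulrC ler_pdivrMr // mul1r; have [x1|/ltW x1] := leP 1 x; first by rewrite sr.
exact: smono.
Qed.

End smooth_step.

Section hill_slopes.
Variable R : realType.
Variables (G c W : R -> R) (beta : R).

Lemma slope_equation_opp lam f : slope_equation G c W lam f ->
  slope_equation (fun p => G (- p)) (fun x => c (- x)) (fun x => W (- x)) lam (fun x => - f (- x)).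
Proof.
move=> df x; have := is_deriveN (is_derive_comp_opp (df (- x))).
by rewrite !opprK.
Qed.

(** While [f > t0], [G f >= 2 * m] exceeds [beta - W <= m] by at least [m], so [f] decays at rate
    [m] in the variable [S]. Followed back from [x] to [L1], it would pass the bound [q]. *)
Lemma slope_on_hill (f S : R -> R) (L1 L2 q t0 m : R) : slope_equation G c W beta f ->
  (forall x : R, is_derive x 1 S (c x)) -> (forall x, 0 <= c x) ->
  (forall x, f x <= q) -> 0 <= t0 -> 0 < m ->
  (forall t, t0 < t -> 2 * m <= G t) ->
  (forall x, L1 <= x <= L2 -> beta - W x <= m) ->
  forall x, L1 <= x <= L2 -> q < m * (S x - S L1) -> f x <= t0.
Proof.
move=> df dS c0 fq t00 m0 Gm Wm x /andP[x1 x2] qx; rewrite leNgt; apply/negP => tf.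
have H y : L1 <= y <= x -> t0 < f y -> c y * (beta - W y - G (f y)) <= - m * c y.
  move=> /andP[y1 y2] ty; rewrite [leRHS]mulrC ler_wpM2l //.
  have h1 := Gm _ ty; have h2 : beta - W y <= m by apply: Wm; rewrite y1 (le_trans y2).
  by move: h1 h2; lra.
have := backward_barrier x1 df dS (ltW m0) c0 H tf (y := L1).
rewrite lexx x1 => /(_ isT) h; have := fq L1; move: h qx tf t00; lra.
Qed.

End hill_slopes.

Section glue.
Variable R : realType.
Variables (G A W : R -> R) (beta : R).
Hypothesis Gc : continuous G.
Hypothesis A0 : forall x, 0 < A x.
Hypothesis cc : continuous (fun x => (A x)^-1).
Hypothesis Wc : continuous W.
Let c x := (A x)^-1.
Let S := prim c.

Let dS (x : R) : is_derive x 1 S (c x). Proof. exact: is_derive_prim. Qed.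

(** The two solutions are interpolated by a smooth step in the variable [S];
    the error is of the order of [G] in the transition zone plus the inverse of
    its [S]-length. *)
Lemma glue_slopes : exists2 B : R, 0 <= B & forall (fl fr : R -> R) (s0 C M e1 : R),
  slope_equation G c W beta fl -> slope_equation G c W beta fr -> 0 <= e1 ->
  (forall x, `|fl x| <= M) -> (forall x, `|fr x| <= M) -> 0 < C ->
  (forall x th, s0 <= S x -> S x <= s0 + C -> 0 <= th <= 1 ->
     0 <= G ((1 - th) * fl x + th * fr x) <= e1) ->
  exists f g : R -> R, [/\ forall x : R, is_derive x 1 f (g x), continuous g,
    forall x, `|f x| <= M,
    forall x, `|A x * g x + G (f x) + W x - beta| <= e1 + B * (2 * M) / C &
    (forall x, S x <= s0 -> f x = fl x) /\ (forall x, s0 + C <= S x -> f x = fr x)].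
Proof.
have [s [s' [B [ds cs sl sr sb]]]] := smooth_step R.
have B0 : 0 <= B by have [_ h] := sb 0; exact: le_trans (normr_ge0 _) h.
exists B => // fl fr s0 C M e1 dl dr e10 bl br C0 HG.
pose u x := (S x - s0) / C; pose chi x := s (u x).
pose f x := (1 - chi x) * fl x + chi x * fr x.
pose dchi x := s' (u x) * (c x / C).
have du (x : R) : is_derive x 1 u (c x / C).
  have h := is_deriveZ C^-1 (is_deriveB (dS x) (is_derive_cst s0 x (1 : R))).
  rewrite -[X in is_derive _ _ _ X](_ : C^-1 * (c x - 0) = c x / C); last by rewrite subr0 mulrC.
  by rewrite [u](_ : _ = C^-1 \*: (S - cst s0)) //; apply/funext => y; rewrite /u mulrC.
have dX (x : R) : is_derive x 1 chi (dchi x).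
  by have := @is_derive1_comp _ s u x _ _ (ds (u x)) (du x).
pose gl x := c x * (beta - W x - G (fl x)); pose gr x := c x * (beta - W x - G (fr x)).
pose g x := ((1 - chi x) * gl x + fl x * (0 - dchi x)) + (chi x * gr x + fr x * dchi x).
have df (x : R) : is_derive x 1 f (g x).
  have d1 : is_derive x 1 (fun x => 1 - chi x) (0 - dchi x).
    exact: is_deriveB (is_derive_cst (1 : R) x (1 : R)) (dX x).
  exact: is_deriveD (is_deriveM d1 (dl x)) (is_deriveM (dX x) (dr x)).
have cont (F F' : R -> R) (dF : forall x : R, is_derive x 1 F (F' x)) : continuous F.
  by move=> x; exact: is_derive_continuous (dF x).
have cSE (F : R -> R) : continuous F -> continuous (fun x => c x * (beta - W x - G (F x))).
  move=> cF x; apply: cvgM; first exact: cc.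
  apply: cvgB; first by apply: cvgB; [exact: cvg_cst|exact: Wc].
  by apply: (@continuous_comp _ _ _ F G); [exact: cF|exact: Gc].
have cdchi : continuous dchi.
  move=> x; apply: cvgM; last by apply: cvgM; [exact: cc|exact: cvg_cst].
  by apply: (@continuous_comp _ _ _ u s'); [exact: (cont _ _ du)|exact: cs].
have cg : continuous g.
  move=> x; apply: cvgD; apply: cvgD; apply: cvgM.
  - by apply: cvgB; [exact: cvg_cst|exact: (cont _ _ dX)].
  - exact/cSE/(cont _ _ dl).
  - exact: (cont _ _ dl).
  - by apply: cvgB; [exact: cvg_cst|exact: cdchi].
  - exact: (cont _ _ dX).
  - exact/cSE/(cont _ _ dr).
  - exact: (cont _ _ dr).
  - exact: cdchi.
have chib x : 0 <= chi x <= 1 by have [] := sb (u x).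
(* Both slopes solve the same equation, so [W] and [beta] cancel and the convexity defect of [G]
   remains. Since the step is taken in [S], its derivative contains [c = 1 / A], which cancels the
   diffusion: the last term is small however degenerate [A] is. *)
have key x : A x * g x + G (f x) + W x - beta =
    G (f x) - (1 - chi x) * G (fl x) - chi x * G (fr x) + s' (u x) / C * (fr x - fl x).
  by rewrite /g /gl /gr /dchi /c; field; rewrite !lt0r_neq0.
have left x : S x <= s0 -> chi x = 0 /\ s' (u x) = 0.
  by move=> h; apply: sl; rewrite /u ler_pdivrMr // mul0r subr_le0.
have right x : s0 + C <= S x -> chi x = 1 /\ s' (u x) = 0.
  by move=> h; apply: sr; rewrite /u ler_pdivlMr // mul1r lerBrDl.
have fl' x : S x <= s0 -> f x = fl x by move=> /left[h _]; rewrite /f h subr0 mul1r mul0r addr0.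
have fr' x : s0 + C <= S x -> f x = fr x by move=> /right[h _]; rewrite /f h subrr mul1r mul0r add0r.
have M0 : 0 <= M by exact: le_trans (normr_ge0 _) (bl 0).
exists f, g; split => //.
- move=> x; have /andP[h1 h2] := chib x; have h3 : 0 <= 1 - chi x by rewrite subr_ge0.
  apply: (le_trans (ler_normD _ _)); rewrite !normrM (ger0_norm h1) (ger0_norm h3).
  have h4 := ler_wpM2l h3 (bl x); have h5 := ler_wpM2l h1 (br x); move: h4 h5; lra.
- move=> x; rewrite key.
  have R0 : 0 <= B * (2 * M) / C by rewrite divr_ge0 ?(ltW C0) // mulr_ge0 // mulr_ge0.
  have [h|/ltW h1] := leP (S x) s0.
    have [h1 h2] := left x h; rewrite (fl' x h) h1 h2 subr0 mul1r subrr !mul0r subr0 addr0 normr0.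
    exact: addr_ge0.
  have [h|/ltW h2] := leP (s0 + C) (S x).
    have [h2 h3] := right x h; rewrite (fr' x h) h2 h3 subrr !mul0r subr0 mul1r subrr addr0 normr0.
    exact: addr_ge0.
  have G1 := HG x (chi x) h1 h2 (chib x).
  have G2 := HG x 0 h1 h2 (ltac:(rewrite lexx ler01; done)).
  have G3 := HG x 1 h1 h2 (ltac:(rewrite lexx ler01; done)).
  rewrite subr0 mul1r mul0r addr0 in G2; rewrite subrr mul0r mul1r add0r in G3.
  rewrite -/(f x) in G1.
  have /andP[k1 k2] := chib x; have k3 : 0 <= 1 - chi x by rewrite subr_ge0.
  apply: (le_trans (ler_normD _ _)); apply: lerD.
    move: G1 G2 G3 => /andP[a1 a2] /andP[a3 a4] /andP[a5 a6].
    have b1 := ler_wpM2l k3 a4; have b2 := ler_wpM2l k1 a6.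
    have b3 := mulr_ge0 k3 a3; have b4 := mulr_ge0 k1 a5.
    rewrite ler_norml; apply/andP; split; move: a1 a2 b1 b2 b3 b4; lra.
  rewrite normrM normrM (ger0_norm (_ : 0 <= C^-1)); last by rewrite invr_ge0 ltW.
  have -> : B * (2 * M) / C = B / C * (2 * M) by ring.
  have [_ b1] := sb (u x).
  apply: ler_pM => //.
  - by rewrite mulr_ge0 // invr_ge0 ltW.
  - by rewrite ler_pM2r // invr_gt0.
  - by apply: (le_trans (ler_normB _ _)); have := bl x; have := br x; lra.
Qed.

End glue.

(** * Approximate correctors with a possible kink *)

Section near_corrector.
Variable R : realType.

(** [thl] and [thr] are the slopes of [e * F (x / e)] on the left and on the
    right of [x0]. *)
Definition near_corrector (A H W : R -> R) (hb thl thr x0 eta M r : R) : Prop :=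
  \forall e \near (0 : R)^'+, exists F f g : R -> R,
  [/\ [/\ forall y : R, is_derive y 1 F (f y), forall y : R, is_derive y 1 f (g y) & continuous g],
      forall y, `|f y| <= M,
      forall y, `|A y * g y + H (f y) + W y - hb| <= eta,
      forall x, x0 <= x -> x <= x0 + 1 -> `|e * F (x / e) - thr * (x - x0)| <= r &
      forall x, x0 - 1 <= x -> x <= x0 -> `|e * F (x / e) - thl * (x - x0)| <= r].

(** When [thl <= p <= thr] up to [r], the kinked profile lies above the line of slope [p] and meets
    it at [x0], up to small errors; this is the sense in which a corrector must be a bound from
    below on the unit interval. *)
Lemma near_corrector_upper (A H W : R -> R) (hb p x0 : R) :
  (forall eta : R, 0 < eta -> exists2 M : R, 0 <= M & forall r : R, 0 < r -> exists thl thr : R,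
     [/\ thl <= p + r, p - r <= thr, `|thl| <= M, `|thr| <= M & near_corrector A H W hb thl thr x0 eta M r]) ->
  upper_corrector A H W hb p x0.
Proof.
move=> Hyp eta eta0; have [M M0 HM] := Hyp eta eta0; exists M => r r0.
have r2 : 0 < r / 2 by rewrite divr_gt0.
have [thl [thr [h1 h2 h3 h4 nc]]] := HM _ r2.
have D0 : 0 < M + `|p| + 1 by rewrite ltr_wpDl // addr_ge0.
(* Within distance [rho], slopes bounded by [M] cannot carry the profile more than [r / 2] above the
   line of slope [p]. *)
pose rho := Num.min 1 (r / 2 / (M + `|p| + 1)).
have rho0 : 0 < rho by rewrite lt_min ltr01 divr_gt0.
exists rho => //; apply: filterS nc => e [F [f [g [dd fM ee Hr Hl]]]].
exists F, f, g; split => //.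
  move=> x; rewrite ler_distlC => /andP[x1 x2].
  have [xx|/ltW xx] := leP x0 x.
    have xx2 : x <= x0 + 1 by move: x1 x2; lra.
    have := Hr x xx xx2; rewrite ler_norml => /andP[b1 _].
    have t : 0 <= x - x0 by rewrite subr_ge0.
    have t1 : x - x0 <= 1 by rewrite lerBlDl.
    have u := ler_wpM2r t h2; rewrite mulrBl in u.
    have v : r / 2 * (x - x0) <= r / 2 by rewrite ler_piMr // ltW.
    move: u v b1; lra.
  have xx2 : x0 - 1 <= x by move: x1 x2; lra.
  have := Hl x xx2 xx; rewrite ler_norml => /andP[b1 _].
  have t : 0 <= x0 - x by rewrite subr_ge0.
  have t1 : x0 - x <= 1 by move: xx2; lra.
  have u := ler_wpM2r t h1.
  have v : r / 2 * (x0 - x) <= r / 2 by rewrite ler_piMr // ltW.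
  move: u v b1; lra.
move=> x xr.
have rho1 : rho <= 1 by rewrite ge_min lexx.
have rho2 : (M + `|p| + 1) * rho <= r / 2.
  by rewrite mulrC -ler_pdivlMr // ge_min lexx orbT.
have up : - (p * (x - x0)) <= `|p| * rho.
  by apply: (le_trans (ler_norm _)); rewrite normrN normrM ler_wpM2l.
have ut th : `|th| <= M -> th * (x - x0) <= M * rho.
  move=> hth; apply: (le_trans (ler_norm _)); rewrite normrM; exact: ler_pM.
move: (xr); rewrite ler_distlC => /andP[x1 x2].
have [xx|/ltW xx] := leP x0 x.
  have xx2 : x <= x0 + 1 by move: x2 rho1; lra.
  have := Hr x xx xx2; rewrite ler_norml => /andP[_ b1].
  have u := ut _ h4; move: u up b1 rho2 rho0; lra.
have xx2 : x0 - 1 <= x by move: x1 rho1; lra.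
have := Hl x xx2 xx; rewrite ler_norml => /andP[_ b1].
have u := ut _ h3; move: u up b1 rho2 rho0; lra.
Qed.

Lemma near_corrector_lower (A H W : R -> R) (hb p x0 : R) :
  (forall eta : R, 0 < eta -> exists2 M : R, 0 <= M & forall r : R, 0 < r -> exists thl thr : R,
     [/\ p - r <= thl, thr <= p + r, `|thl| <= M, `|thr| <= M & near_corrector A H W hb thl thr x0 eta M r]) ->
  upper_corrector A (fun q => - H (- q)) (fun x => - W x) (- hb) (- p) x0.
Proof.
move=> Hyp; apply: near_corrector_upper => eta eta0; have [M M0 HM] := Hyp eta eta0.
exists M => // r r0; have [thl [thr [h1 h2 h3 h4 nc]]] := HM _ r0.
exists (- thl), (- thr); rewrite !normrN; split => //.
- by move: h1; lra.
- by move: h2; lra.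
apply: filterS nc => e [F [f [g [[dF df cg] fM ee Hr Hl]]]].
exists (fun x => - F x), (fun x => - f x), (fun x => - g x); split.
- split; [by move=> x; exact: is_deriveN|by move=> x; exact: is_deriveN|].
  by move=> x; apply: cvgN; exact: cg.
- by move=> y; rewrite normrN.
- move=> y; rewrite opprK -normrN.
  by have -> : - (A y * - g y - H (f y) - W y - - hb) = A y * g y + H (f y) + W y - hb by ring.
- move=> x u v; rewrite -normrN.
  have -> : - (e * - F (x / e) - - thr * (x - x0)) = e * F (x / e) - thr * (x - x0) by ring.
  exact: Hr.
- move=> x u v; rewrite -normrN.
  have -> : - (e * - F (x / e) - - thl * (x - x0)) = e * F (x / e) - thl * (x - x0) by ring.
  exact: Hl.
Qed.

(** The rate [r / 2 / D] is chosen because [|x| + |x0| <= D] on the unit interval around [x0]; the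
    constant [N] disappears after multiplication by [e]. *)
Lemma linear_scaled (F : R -> R) (th : R) :
  (forall eta : R, 0 < eta -> exists N : R, forall x : R, `|F x - th * x| <= eta * `|x| + N) ->
  forall x0 r : R, 0 < r -> \forall e \near (0 : R)^'+, forall x, `|x - x0| <= 1 ->
    `|e * (F (x / e) - F (x0 / e)) - th * (x - x0)| <= r.
Proof.
move=> HF x0 r r0; pose D := 2 * `|x0| + 1; have D0 : 0 < D by rewrite ltr_wpDl // mulr_ge0.
have [N HN] := HF (r / 2 / D) (ltac:(rewrite !divr_gt0; done)).
have N0 : 0 <= N by have := le_trans (normr_ge0 _) (HN 0); rewrite normr0 mulr0 add0r.
have h : 0 < 4 * N + 1 by rewrite ltr_wpDl // mulr_ge0.
near=> e => x x1.
have e0 : 0 < e by near: e; exact: nbhs_right_gt.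
have eN : e * (4 * N + 1) <= r.
  by rewrite -ler_pdivlMr //; near: e; apply: nbhs_right_le; rewrite divr_gt0.
have ee : e * e^-1 = 1 by rewrite mulfV // lt0r_neq0.
have S z : `|e * F (z / e) - th * z| <= r / 2 / D * `|z| + e * N.
  have -> : e * F (z / e) - th * z = e * (F (z / e) - th * (z / e)).
    by rewrite mulrBr mulrCA [e * (z / e)]mulrCA ee mulr1.
  rewrite normrM (gtr0_norm e0).
  have := ler_wpM2l (ltW e0) (HN (z / e)); rewrite normrM (gtr0_norm (_ : 0 < e^-1)) ?invr_gt0 //.
  have -> // : e * (r / 2 / D * (`|z| / e) + N) = r / 2 / D * `|z| + e * N.
  by field; rewrite !lt0r_neq0.
have h1 := S x; have h2 := S x0.
have xb : `|x| <= `|x0| + 1.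
  have -> : x = x0 + (x - x0) by ring.
  by apply: (le_trans (ler_normD _ _)); rewrite lerD2l.
have k0 : 0 <= r / 2 / D by rewrite !divr_ge0 // ltW.
have h3 : r / 2 / D * (`|x| + `|x0|) <= r / 2.
  apply: (@le_trans _ _ (r / 2 / D * D)); last by rewrite divfK // lt0r_neq0.
  by rewrite ler_wpM2l // /D; move: xb; lra.
have -> : e * (F (x / e) - F (x0 / e)) - th * (x - x0) =
  (e * F (x / e) - th * x) - (e * F (x0 / e) - th * x0) by ring.
apply: (le_trans (ler_normB _ _)).
rewrite mulrDr in h3; move: h1 h2 h3 eN e0; lra.
Unshelve. all: by end_near. Qed.

Lemma near_corrector_exact (A H W F f g : R -> R) (lam hb th x0 eta M r : R) :
  (forall y : R, is_derive y 1 F (f y)) -> (forall y : R, is_derive y 1 f (g y)) ->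
  continuous g -> (forall y, `|f y| <= M) ->
  (forall y, A y * g y + H (f y) + W y = lam) -> `|lam - hb| <= eta ->
  (forall eta : R, 0 < eta -> exists N : R, forall x : R, `|F x - th * x| <= eta * `|x| + N) ->
  0 < r -> near_corrector A H W hb th th x0 eta M r.
Proof.
move=> dF df cg fM eqf lh HF r0; apply: filterS (linear_scaled HF x0 r0) => e He.
exists (fun x => F x - F (x0 / e)), f, g; split => //.
- split => // y; have := is_deriveB (dF y) (is_derive_cst (F (x0 / e)) y (1 : R)).
  by rewrite subr0.
- by move=> y; rewrite eqf.
- by move=> x x1 x2; apply: He; rewrite ger0_norm ?subr_ge0 // lerBlDl.
- move=> x x1 x2; apply: He; rewrite ler0_norm ?subr_le0 //; move: x1; lra.
Qed.

(** Outside a window of half-width [r' / e] the glued slope is [fl] or [fr]. Inside, primitives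
    drift apart by at most [2 * M * (r' / e)], which the factor [e] reduces to at most [r / 2]. *)
Lemma near_corrector_glued (A H W Fl Fr fl fr : R -> R) (hb thl thr x0 eta M r : R) :
  (forall y : R, is_derive y 1 Fl (fl y)) -> (forall y : R, is_derive y 1 Fr (fr y)) ->
  (forall y, `|fl y| <= M) -> (forall y, `|fr y| <= M) ->
  (forall eta : R, 0 < eta -> exists N : R, forall x : R, `|Fl x - thl * x| <= eta * `|x| + N) ->
  (forall eta : R, 0 < eta -> exists N : R, forall x : R, `|Fr x - thr * x| <= eta * `|x| + N) ->
  (forall r, 0 < r -> \forall e \near (0 : R)^'+, exists (L1 L2 : R) (f g : R -> R),
     [/\ [/\ (x0 - r) / e <= L1, L1 <= L2 & L2 <= (x0 + r) / e],
         forall y : R, is_derive y 1 f (g y) /\ `|f y| <= M, continuous g,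
         forall y, `|A y * g y + H (f y) + W y - hb| <= eta &
         (forall y, y <= L1 -> f y = fl y) /\ (forall y, L2 <= y -> f y = fr y)]) ->
  0 < r -> near_corrector A H W hb thl thr x0 eta M r.
Proof.
move=> dFl dFr flM frM HFl HFr Hg r0.
have r2 : 0 < r / 2 by rewrite divr_gt0.
have M0 : 0 <= M by exact: le_trans (normr_ge0 _) (flM 0).
pose r' := r / 2 / (2 * M + 1).
have M1 : 0 < 2 * M + 1 by rewrite ltr_wpDl // mulr_ge0.
have r'0 : 0 < r' by rewrite divr_gt0.
have r'M : 2 * M * r' <= r / 2.
  have : (2 * M + 1) * r' = r / 2 by rewrite mulrC divfK // lt0r_neq0.
  move: r'0; lra.
have nl := linear_scaled HFl x0 r2; have nr := linear_scaled HFr x0 r2.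
near=> e.
have e0 : 0 < e by near: e; exact: nbhs_right_gt.
have [L1 [L2 [f [g [[hL1 hL12 hL2] dfM cg ee [fl' fr']]]]]] : exists (L1 L2 : R) (f g : R -> R),
     [/\ [/\ (x0 - r') / e <= L1, L1 <= L2 & L2 <= (x0 + r') / e],
         forall y : R, is_derive y 1 f (g y) /\ `|f y| <= M, continuous g,
         forall y, `|A y * g y + H (f y) + W y - hb| <= eta &
         (forall y, y <= L1 -> f y = fl y) /\ (forall y, L2 <= y -> f y = fr y)].
  by near: e; exact: Hg.
have Hl : forall x, `|x - x0| <= 1 -> `|e * (Fl (x / e) - Fl (x0 / e)) - thl * (x - x0)| <= r / 2.
  by near: e.
have Hr : forall x, `|x - x0| <= 1 -> `|e * (Fr (x / e) - Fr (x0 / e)) - thr * (x - x0)| <= r / 2.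
  by near: e.
have cf : continuous f by move=> y; exact: is_derive_continuous (dfM y).1.
pose X := x0 / e; pose F x := prim f x - prim f X.
have dF (y : R) : is_derive y 1 F (f y).
  have := is_deriveB (is_derive_prim y cf) (is_derive_cst (prim f X) y (1 : R)).
  by rewrite subr0.
have FX : F X = 0 by rewrite /F subrr.
have ei : 0 < e^-1 by rewrite invr_gt0.
have ee1 : e * e^-1 = 1 by rewrite mulfV // lt0r_neq0.
have er : e * (r' / e) = r' by rewrite mulrCA ee1 mulr1.
have re0 : 0 <= r' / e by rewrite divr_ge0 // ltW.
have L2X : L2 <= X + r' / e by rewrite /X -mulrDl.
have L1X : X - r' / e <= L1 by rewrite /X -mulrBl.
have right y : X <= y -> `|F y - (Fr y - Fr X)| <= 2 * M * (r' / e).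
  move=> Xy; pose D z := F z - Fr z.
  have dD (z : R) : is_derive z 1 D (f z - fr z) := is_deriveB (dF z) (dFr z).
  have -> : F y - (Fr y - Fr X) = D y - D X by rewrite /D FX; ring.
  have dM z : `|f z - fr z| <= 2 * M.
    by rewrite mulrDl mul1r (le_trans (ler_normB _ _)) // lerD //; exact: (dfM z).2.
  have near_ z : X <= z -> z <= X + r' / e -> `|D z - D X| <= 2 * M * (r' / e).
    move=> z1 z2; apply: (le_trans (lipschitz_derive dD dM z X)).
    by rewrite ler_wpM2l ?mulr_ge0 // ger0_norm ?subr_ge0 // lerBlDl.
  have [h|/ltW h] := leP y (X + r' / e); first exact: near_.
  have -> : D y = D (X + r' / e).
    apply/esym; apply: (derive0_const h dD) => z /andP[/ltW z1 _].
    by rewrite fr' ?subrr // (le_trans L2X).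
  by apply: near_; rewrite ?lerDl.
have left y : y <= X -> `|F y - (Fl y - Fl X)| <= 2 * M * (r' / e).
  move=> Xy; pose D z := F z - Fl z.
  have dD (z : R) : is_derive z 1 D (f z - fl z) := is_deriveB (dF z) (dFl z).
  have -> : F y - (Fl y - Fl X) = D y - D X by rewrite /D FX; ring.
  have dM z : `|f z - fl z| <= 2 * M.
    by rewrite mulrDl mul1r (le_trans (ler_normB _ _)) // lerD //; exact: (dfM z).2.
  have near_ z : z <= X -> X - r' / e <= z -> `|D z - D X| <= 2 * M * (r' / e).
    move=> z1 z2; apply: (le_trans (lipschitz_derive dD dM z X)).
    by rewrite ler_wpM2l ?mulr_ge0 // ler0_norm ?subr_le0 // opprB lerBlDl -lerBlDr.
  have [h|/ltW h] := leP (X - r' / e) y; first exact: near_.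
  have -> : D y = D (X - r' / e).
    apply: (derive0_const h dD) => z /andP[_ /ltW z1].
    by rewrite fl' ?subrr // (le_trans z1).
  by apply: near_; rewrite ?gerBl.
have comb (Fs : R -> R) th x : `|F (x / e) - (Fs (x / e) - Fs X)| <= 2 * M * (r' / e) ->
    `|e * (Fs (x / e) - Fs (x0 / e)) - th * (x - x0)| <= r / 2 -> `|e * F (x / e) - th * (x - x0)| <= r.
  move=> h1 h2.
  have -> : e * F (x / e) - th * (x - x0) = e * (F (x / e) - (Fs (x / e) - Fs X)) +
     (e * (Fs (x / e) - Fs (x0 / e)) - th * (x - x0)) by rewrite /X; ring.
  apply: (le_trans (ler_normD _ _)); rewrite [leRHS]splitr; apply: lerD => //.
  rewrite normrM (gtr0_norm e0); apply: le_trans (ler_wpM2l (ltW e0) h1) _.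
  by rewrite mulrCA er.
exists F, f, g; split => //.
- by split => // y; exact: (dfM y).1.
- by move=> y; exact: (dfM y).2.
- move=> x x1 x2; apply: (comb Fr); first by apply: right; rewrite /X ler_pM2r.
  by apply: Hr; rewrite ger0_norm ?subr_ge0 // lerBlDl.
- move=> x x1 x2; apply: (comb Fl); first by apply: left; rewrite /X ler_pM2r.
  by apply: Hl; rewrite ler0_norm ?subr_le0 // opprB lerBlDl -lerBlDr.
Unshelve. all: by end_near. Qed.

End near_corrector.

(** * Gluing on a hill at the level of the flat part *)

Section flat.
Variable R : realType.

Lemma convex_between (u v t : R) : u <= v -> 0 <= t -> t <= 1 ->
  u <= (1 - t) * u + t * v <= v /\ u <= (1 - t) * v + t * u <= v.
Proof.
move=> uv t0 t1; have s0 : 0 <= 1 - t by rewrite subr_ge0.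
have h1 := ler_wpM2l t0 uv; have h2 := ler_wpM2l s0 uv.
by split; apply/andP; split; move: h1 h2; lra.
Qed.

(** Away from the ends of a hill, both [G (f1)] and [G (f2)] are at most
    [2 * beta * (1 - h)]. *)
Lemma flat_glue (G A V f1 f2 : R -> R) (beta M eta : R) :
  continuous G -> G 0 = 0 ->
  (forall p q : R, 0 <= p -> p < q -> G p < G q) -> (forall p q : R, p < q -> q <= 0 -> G q < G p) ->
  (forall m, 0 < m -> exists2 t, 0 <= t & G t = m) -> (forall m, 0 < m -> exists2 t, 0 <= t & G (- t) = m) ->
  (forall x, 0 < A x <= 1) -> continuous (fun x => (A x)^-1) -> continuous V -> 0 < beta ->
  slope_equation G (fun x => (A x)^-1) (fun x => beta * V x) beta f1 ->
  slope_equation G (fun x => (A x)^-1) (fun x => beta * V x) beta f2 ->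
  (forall x, - M <= f1 x <= 0) -> (forall x, 0 <= f2 x <= M) -> 0 < eta ->
  exists h C : R, [/\ 0 < h < 1, 0 < C & forall L1 L2, hill (fun x => (A x)^-1) V h C L1 L2 ->
    forall b : bool, exists f g : R -> R,
    [/\ forall y : R, is_derive y 1 f (g y) /\ `|f y| <= M, continuous g,
        forall y, `|A y * g y + G (f y) + beta * V y - beta| <= eta &
        (forall y, y <= L1 -> f y = (if b then f1 else f2) y) /\
        (forall y, L2 <= y -> f y = (if b then f2 else f1) y)]].
Proof.
move=> Gc G0 Gi Gd Gs Gs' A01 cc Vc beta0 df1 df2 b1 b2 eta0.
have M0 : 0 <= M by have /andP[h1 h2] := b2 0; exact: le_trans h1 h2.
have A0 x : 0 < A x by have /andP[] := A01 x.
have Wc : continuous (fun x => beta * V x) by move=> x; apply: cvgM; [exact: cvg_cst|exact: Vc].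
pose c x := (A x)^-1; pose S := prim c.
have c0 x : 0 <= c x by rewrite invr_ge0 ltW.
have dS (x : R) : is_derive x 1 S (c x) by exact: is_derive_prim.
have Smono x y : x <= y -> S x <= S y by exact: prim_le.
pose m := Num.min (eta / 4) (beta / 2).
have m0 : 0 < m by rewrite lt_min !divr_gt0.
have m1 : 2 * m <= eta / 2.
  have : m <= eta / 4 by rewrite ge_min lexx.
  by move: eta0; lra.
have m2 : m <= beta / 2 by rewrite ge_min lexx orbT.
have m20 : 0 < 2 * m by rewrite mulr_gt0.
have [t t0 Gt] := Gs _ m20; have [t' t'0 Gt'] := Gs' _ m20.
have [B B0 HB] := @glue_slopes _ _ _ _ beta Gc A0 cc Wc.
(* [C0] is the [S]-length after which a slope bounded by [M] and decaying at rate [m] has become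
   small; [C1] makes the error [B * (2 * M) / C1] of the transition at most [eta / 2]. *)
pose C0 := (M + 1) / m; pose C1 := 4 * B * M / eta + 1.
have C00 : 0 < C0 by rewrite divr_gt0 // ltr_wpDl.
have mC0 : M < m * C0 by rewrite /C0 mulrC divfK ?lt0r_neq0 // ltrDl.
have C10 : 0 < C1 by rewrite ltr_wpDl // divr_ge0 ?(ltW eta0) // !mulr_ge0.
have C1eta : B * (2 * M) / C1 <= eta / 2.
  rewrite ler_pdivrMr // /C1 mulrDr mulr1.
  have -> : eta / 2 * (4 * B * M / eta) = B * (2 * M) by field; rewrite lt0r_neq0.
  by rewrite lerDl divr_ge0 // ltW.
have mb : m / beta <= 2^-1 by rewrite ler_pdivrMr // mulrC.
have mb0 : 0 < m / beta by rewrite divr_gt0.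
(* On this height [beta - beta * V <= m]. The length reserves [C0] at each end, for [f2] to settle
   from the left and [f1] from the right, and [C1] for the transition. *)
exists (1 - m / beta), (2 * C0 + C1); split.
- by rewrite subr_gt0 gtrBl mb0 andbT (le_lt_trans mb) // invf_lt1 // ltr1n.
- by rewrite addr_gt0 // mulr_gt0.
move=> L1 L2 [L12 HC HV] b; rewrite -/S in HC.
have Wm x : L1 <= x <= L2 -> beta - beta * V x <= m.
  move=> /HV h; have := ler_wpM2l (ltW beta0) h.
  by rewrite mulrBr mulr1 mulrCA mulfV ?lt0r_neq0 // mulr1 lerBlDr addrC -lerBlDr.
have up2 x : L1 <= x <= L2 -> C0 <= S x - S L1 -> f2 x <= t.
  move=> xL h; apply: (@slope_on_hill R G c (fun x => beta * V x) beta f2 S L1 L2 M t m) => //.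
  - by move=> y; have /andP[] := b2 y.
  - by move=> u tu; rewrite -Gt; apply/ltW/Gi.
  - by apply: lt_le_trans mC0 _; rewrite ler_pM2l.
(* After reflection [- f1] is a nonnegative slope entering the hill from [- L2], so distance is
   counted from the right end. *)
have up1 x : L1 <= x <= L2 -> C0 <= S L2 - S x -> - f1 x <= t'.
  move=> /andP[x1 x2] h.
  have dS' (y : R) : is_derive y 1 (fun y => - S (- y)) (c (- y)).
    by have := is_deriveN (is_derive_comp_opp (dS (- y))); rewrite opprK.
  have := @slope_on_hill R (fun p => G (- p)) (fun x => c (- x)) (fun x => beta * V (- x)) beta
    (fun x => - f1 (- x)) (fun y => - S (- y)) (- L2) (- L1) M t' m (slope_equation_opp df1) dS'.
  move=> /(_ (fun y => c0 _)) H; have := H _ t'0 m0 _ _ (- x); rewrite !opprK; apply.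
  - by move=> y; have /andP[h1 _] := b1 (- y); rewrite lerNl.
  - by move=> u tu; rewrite -Gt'; apply/ltW/Gd; rewrite ?ltrN2 // oppr_le0.
  - by move=> y /andP[y1 y2]; apply: Wm; rewrite lerNr y2 lerNl y1.
  - by rewrite !lerN2 x1 x2.
  - by rewrite addrC; apply: lt_le_trans mC0 _; rewrite ler_pM2l.
have G0le z : 0 <= G z.
  have [z0|z0] := leP 0 z.
    by move: z0; rewrite le_eqVlt => /predU1P[<-|/(Gi _ _ (lexx 0))/ltW]; rewrite G0.
  by have := Gd _ _ z0 (lexx 0); rewrite G0 => /ltW.
pose fl := if b then f1 else f2; pose fr := if b then f2 else f1.
have dfl : slope_equation G (fun x => (A x)^-1) (fun x => beta * V x) beta fl by rewrite /fl; case: (b).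
have dfr : slope_equation G (fun x => (A x)^-1) (fun x => beta * V x) beta fr by rewrite /fr; case: (b).
have n1 x : `|f1 x| <= M.
  by have /andP[h1 h2] := b1 x; rewrite ler0_norm // lerNl.
have n2 x : `|f2 x| <= M by have /andP[h1 h2] := b2 x; rewrite ger0_norm.
have flM x : `|fl x| <= M by rewrite /fl; case: (b).
have frM x : `|fr x| <= M by rewrite /fr; case: (b).
(* As [f1 <= 0 <= f2], every interpolated value lies between [- t'] and [t], where [G] is at most
   [2 * m]; the order [b] is immaterial. *)
have mid x th : S L1 + C0 <= S x -> S x <= S L1 + C0 + C1 -> 0 <= th <= 1 ->
    0 <= G ((1 - th) * fl x + th * fr x) <= 2 * m.
  move=> h1 h2 /andP[th0 th1]; rewrite G0le /=.
  have x1 : L1 <= x.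
    by rewrite leNgt; apply/negP => /ltW/Smono; move: h1 C00; clear; lra.
  have x2 : x <= L2.
    by rewrite leNgt; apply/negP => /ltW/Smono; move: h2 HC C00; clear; lra.
  have xL : L1 <= x <= L2 by rewrite x1.
  have u2 : f2 x <= t by apply: up2 => //; rewrite lerBrDl.
  have u1 : - f1 x <= t' by apply: up1 => //; move: h2 HC; clear; lra.
  have /andP[_ f10] := b1 x; have /andP[f20 _] := b2 x.
  set z := (1 - th) * fl x + th * fr x.
  have zb : f1 x <= z <= f2 x.
    by rewrite /z /fl /fr; case: (b); have [] := convex_between (le_trans f10 f20) th0 th1.
  move: zb => /andP[z1 z2]; have [z0|/ltW z0] := leP 0 z.
    rewrite -Gt; have : z <= t by exact: le_trans z2 u2.
    by rewrite le_eqVlt => /predU1P[->//|/(Gi _ _ z0)/ltW].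
  rewrite -Gt'; have : - t' <= z by rewrite lerNl (le_trans _ u1) // lerN2.
  by rewrite le_eqVlt => /predU1P[->//|/Gd/(_ z0)/ltW].
have [f [g [df cg fM eqf [El Er]]]] := HB fl fr (S L1 + C0) C1 M (2 * m) dfl dfr (ltW m20) flM frM C10 mid.
exists f, g; split => //.
- by move=> y; apply: le_trans (eqf y) _; move: m1 C1eta; clear; lra.
- split=> y yL.
    by apply: El; apply: le_trans (Smono _ _ yL) _; rewrite lerDl ltW.
  apply: Er; apply: (@le_trans _ _ (S L2)); last exact: Smono.
  by move: HC C00; clear; lra.
Qed.

End flat.

(** * The effective Hamiltonian *)

Lemma integral_prim (R : realType) (c : R -> R) (L1 L2 : R) : continuous c -> L1 < L2 ->
  (\int[lebesgue_measure]_(y in `[L1, L2]) (c y)%:E = (prim c L2 - prim c L1)%:E)%E.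
Proof.
move=> cc L12; have dS (x : R) : is_derive x 1 (prim c) (c x) by exact: is_derive_prim.
have Sc x : {for x, continuous (prim c)} by exact: is_derive_continuous (dS x).
rewrite (@continuous_FTC2 _ c (prim c) L1 L2) // ?EFinB //.
- exact: continuous_subspaceT.
- split; first by move=> x _; case: (dS x).
    exact/cvg_at_right_filter/Sc.
  exact/cvg_at_left_filter/Sc.
- by move=> x _; rewrite derive1E; have [_ ->] := dS x.
Qed.

Section theta_inverse.
Variables (R : realType) (d : measure_display) (Omega : measurableType d).
Variables (P : probability Omega R) (tau : R -> Omega -> Omega) (beta : R).
Variables (G : R -> R) (a V : R -> Omega -> R).
Hypothesis M : medium P tau beta G a V.
Let th := theta2 P G a V beta.

(** Continuing the inverse by the constant [beta] below [th beta] yields a function on the whole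
    line and avoids one-sided continuity; its local Lipschitz constant comes from
    [theta2_increment]. *)
Lemma theta2_inverse : exists h : R -> R,
  [/\ continuous h, forall p, beta <= h p & forall p, th (h p) = Num.max p (th beta)].
Proof.
have ex p : {lam | beta <= lam /\ th lam = Num.max p (th beta)}.
  apply: cid; have [|lam bl E] := theta2_surj M (p := Num.max p (th beta)).
    by rewrite le_max lexx orbT.
  by exists lam.
pose h p := sval (ex p).
have hb p : beta <= h p by rewrite /h; case: (ex p) => ? [].
have hth p : th (h p) = Num.max p (th beta) by rewrite /h; case: (ex p) => ? [].
exists h; split => //.
have mono p q : p <= q -> h p <= h q.
  move=> pq; rewrite leNgt; apply/negP => /(theta2_lt M (hb q)); rewrite -/th !hth ltNge.
  by rewrite ge_max !le_max pq lexx orbT.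
move=> p; have [k k0 Hk] := theta2_increment M (h (p + 1)).
have lip q q' : q <= q' -> q' <= p + 1 -> `|h q' - h q| <= k * (q' - q).
  move=> qq q'p; have hh := mono _ _ qq; rewrite ger0_norm ?subr_ge0 //.
  move: hh; rewrite le_eqVlt => /predU1P[<-|hh].
    by rewrite subrr mulr_ge0 ?subr_ge0 // ltW.
  apply: (le_trans (Hk _ _ (hb q) hh (mono _ _ q'p))); rewrite ler_pM2l // -/th !hth.
  rewrite /Num.max; case: ltP => h1; case: ltP => h2; lra.
apply/cvgrPdist_lt => e e0; have ek : 0 < e / k by rewrite divr_gt0.
near=> q.
have q1 : `|p - q| < 1 by near: q; exact: (nbhsx_ballx p _ ltr01).
have qe : `|p - q| < e / k by near: q; exact: (nbhsx_ballx p _ ek).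
have {}qe : k * `|p - q| < e by rewrite mulrC -ltr_pdivlMr.
apply: le_lt_trans qe; have [pq|/ltW qp] := leP p q.
  rewrite [`|h p - _|]distrC [`|p - q|]distrC [in leRHS]ger0_norm ?subr_ge0 //; apply: lip => //.
  by move: q1; rewrite ltr_norml => /andP[h1 _]; lra.
rewrite [in leRHS]ger0_norm ?subr_ge0 //; apply: lip => //; lra.
Unshelve. all: by end_near. Qed.

End theta_inverse.

Section effective.
Variables (R : realType) (d : measure_display) (Omega : measurableType d).
Variables (P : probability Omega R) (tau : R -> Omega -> Omega) (beta : R).
Variables (G : R -> R) (a V : R -> Omega -> R).
Let Gr p := G (- p).
Let ar x := a (- x).
Let Vr x := V (- x).
Hypothesis M2 : medium P tau beta G a V.
Hypothesis M1 : medium P (fun x => tau (- x)) beta Gr ar Vr.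
Let th1 := theta1 P G a V beta.
Let th2 := theta2 P G a V beta.
Let Hb := Hbar P G a V beta.

Let th1E lam : beta <= lam -> th1 lam = - theta2 P Gr ar Vr beta lam.
Proof. exact: (theta1_reflect M1). Qed.

Let th1_inj : {in [set lam : R | beta <= lam] &, injective th1}.
Proof.
move=> x y xb yb E; apply: (theta2_inj M1 xb yb); apply: oppr_inj.
by move: xb yb; rewrite !inE => xb yb; rewrite -(th1E xb) -(th1E yb).
Qed.

Let b0 : 0 < beta := medium_beta M2.

Let th2_ge0 : 0 <= th2 beta.
Proof.
have /andP[h _] := theta2_bound M2 (lexx beta); apply: le_trans h.
by apply: (G2inv_ge0 (medium_lip M2) (medium_G0 M2) (medium_incr M2) (medium_pinfty M2)); rewrite subrr.
Qed.

Let th1_le0 : th1 beta <= 0.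
Proof.
have /andP[h _] := theta2_bound M1 (lexx beta).
rewrite th1E // oppr_le0; apply: le_trans h.
by apply: (G2inv_ge0 (medium_lip M1) (medium_G0 M1) (medium_incr M1) (medium_pinfty M1)); rewrite subrr.
Qed.

Lemma Hbar_cases p : [\/ exists lam, [/\ beta <= lam, th1 lam = p & Hb p = lam],
  exists lam, [/\ beta <= lam, th2 lam = p & Hb p = lam] |
  [/\ th1 beta <= p, p <= th2 beta & Hb p = beta]].
Proof.
rewrite /Hb /Hbar; case: ifPn => [p1|]; last case: ifPn => [p2|].
- apply: Or31; have [|lam bl E] := theta2_surj M1 (p := - p).
    by rewrite lerNr -th1E.
  have E' : th1 lam = p by rewrite th1E // E opprK.
  by exists lam; rewrite -E' pinvKV // ?inE.
- by rewrite -ltNge => p1; apply: Or33; split => //; exact: ltW.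
rewrite -leNgt => p2 p1; apply: Or32; have [lam bl E] := theta2_surj M2 p2.
exists lam; rewrite -E pinvKV ?inE //=; exact: (theta2_inj M2).
Qed.

(** With [h1], [h2] the extended inverses of the reflected and of the direct
    [theta], [Hb p = h1 (- p) + h2 p - beta]. *)
Lemma Hbar_continuous : continuous Hb.
Proof.
have [h2 [h2c h2b h2E]] := theta2_inverse M2; have [h1 [h1c h1b h1E]] := theta2_inverse M1.
have h2beta p : p <= th2 beta -> h2 p = beta.
  by move=> p2; apply: (theta2_inj M2); [rewrite inE; exact: h2b|rewrite inE; exact: lexx|rewrite h2E (max_r p2)].
have h1beta p : th1 beta <= p -> h1 (- p) = beta.
  move=> p1; have p1' : - p <= theta2 P Gr ar Vr beta beta by rewrite lerNl -th1E.
  by apply: (theta2_inj M1); [rewrite inE; exact: h1b|rewrite inE; exact: lexx|rewrite h1E (max_r p1')].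
have -> : Hb = fun p => h1 (- p) + h2 p - beta; last first.
  move=> p; apply: cvgB; last exact: cvg_cst.
  apply: cvgD; last exact: h2c.
  by apply: (@continuous_comp _ _ _ (fun p : R => - p) h1); [exact: opp_continuous|exact: h1c].
apply/funext => p; have [[lam [bl E ->]]|[lam [bl E ->]]|[p1 p2 ->]] := Hbar_cases p.
- have lb : th1 lam <= th1 beta.
    rewrite (th1E bl) (th1E (lexx beta)) lerN2; move: bl; rewrite le_eqVlt => /predU1P[->//|].
    by move=> /(theta2_lt M1 (lexx _))/ltW.
  have -> : h1 (- p) = lam.
    apply: (theta2_inj M1); [rewrite inE; exact: h1b|rewrite inE; exact: bl|].
    rewrite h1E -E (th1E bl) opprK; apply: max_l.
    by rewrite -lerN2 -(th1E bl) -(th1E (lexx beta)).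
  rewrite h2beta ?addrK // -E; exact: le_trans lb (le_trans th1_le0 th2_ge0).
- have lb : th2 beta <= th2 lam.
    move: bl; rewrite le_eqVlt => /predU1P[->//|].
    by move=> /(theta2_lt M2 (lexx _))/ltW.
  have -> : h2 p = lam.
    by apply: (theta2_inj M2); [rewrite inE; exact: h2b|rewrite inE; exact: bl|rewrite h2E -E (max_l lb)].
  rewrite h1beta; first by rewrite addrAC subrr add0r.
  by rewrite -E; exact: le_trans (le_trans th1_le0 th2_ge0) lb.
- by rewrite h2beta // h1beta // addrK.
Qed.

End effective.

Definition sublinear (R : realType) (F : R -> R) (th : R) : Prop :=
  forall eta : R, 0 < eta -> exists N : R, forall x : R, `|F x - th * x| <= eta * `|x| + N.

(** * A countable family of levels *)

Section level_approximation.
Variables (R : realType) (d : measure_display) (Omega : measurableType d).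
Variables (P : probability Omega R) (tau : R -> Omega -> Omega) (beta : R).
Variables (G : R -> R) (a V : R -> Omega -> R).
Hypothesis M : medium P tau beta G a V.
Hypothesis erg : ergodic P tau.

(** Countable, dense in [[beta, +oo)] and containing [beta] itself, at [i = 0]: a single null set
    then serves for all levels. *)
Definition grid_level (beta : R) (i j : nat) : R := beta + i%:R / j.+1%:R.

Lemma F2_sublinear lam : beta <= lam ->
  {ae P, forall w, sublinear (F2 G a V beta lam w) (theta2 P G a V beta lam)}.
Proof.
move=> bl; rewrite (theta2E P beta G a V lam).
have sE w : (fun y => slope2 beta G a V lam (tau y w) 0) = slope2 beta G a V lam w.
  by apply/funext => y; rewrite -(slope2_stationary M bl).
apply: (@ergodic_primitive _ _ _ P tau (G2inv G lam)) => //.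
- exact: medium_group M.
- exact: (slope2_measurable M bl).
- by move=> w; exact: (slope2_ge0 M bl w 0).
- by move=> w; have /andP[] := slope2_bound M bl w 0.
- by move=> w; rewrite sE => x; exact: is_derive_continuous (slope2_equation M bl w x).
- by move=> w y; rewrite -(slope2_stationary M bl); exact: (is_derive_F2 M bl w y).
- by move=> w; exact: (F2_0 M bl w).
Qed.

Lemma grid_sublinear : {ae P, forall w, forall i j : nat,
  sublinear (F2 G a V beta (grid_level beta i j) w) (theta2 P G a V beta (grid_level beta i j))}.
Proof.
by apply: ae_foralln => i; apply: ae_foralln => j; apply: F2_sublinear; rewrite lerDl divr_ge0.
Qed.

(** The approximation is from below, so that slope bounds at level [lam] remain valid; the mesh
    [1 / (j + 1)] is finer than both [eta] and the modulus of theta. *)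
Lemma grid_approximation lam (eta r : R) : beta <= lam -> 0 < eta -> 0 < r -> exists i j : nat,
  [/\ beta <= grid_level beta i j, grid_level beta i j <= lam, `|grid_level beta i j - lam| <= eta &
      `|theta2 P G a V beta (grid_level beta i j) - theta2 P G a V beta lam| <= r].
Proof.
move=> bl eta0 r0; have [m m0 Hm] := theta2_modulus M lam r0.
pose dl := Num.min eta m; have dl0 : 0 < dl by rewrite lt_min eta0 m0.
pose j := Num.truncn dl^-1; have j0 : 0 < j.+1%:R :> R by rewrite ltr0n.
have jd : j.+1%:R^-1 < dl by rewrite invf_plt ?posrE //; exact: truncnS_gt.
pose i := Num.truncn ((lam - beta) * j.+1%:R).
have lb0 : 0 <= (lam - beta) * j.+1%:R by rewrite mulr_ge0 ?subr_ge0 // ltW.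
have /andP[i1 i2] : i%:R <= (lam - beta) * j.+1%:R < i.+1%:R by exact: truncn_itv.
have l1 : grid_level beta i j <= lam by rewrite /grid_level addrC -lerBrDr ler_pdivrMr.
have l0 : beta <= grid_level beta i j by rewrite lerDl divr_ge0 // ltW.
have l2 : lam - grid_level beta i j < dl.
  apply: lt_trans jd; rewrite /grid_level opprD addrA ltrBlDr -[X in _ < X + _]mul1r -mulrDl.
  by rewrite ltr_pdivlMr // nat1r.
exists i, j; split => //.
  rewrite ler0_norm ?subr_le0 // opprB; apply/ltW/(lt_le_trans l2).
  by rewrite ge_min lexx.
have ld : lam - grid_level beta i j < m by apply: (lt_le_trans l2); rewrite ge_min lexx orbT.
have := Hm _ _ l0 bl l1 (lexx _) ld.
rewrite ler0_norm ?opprB // subr_le0.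
by move: l1; rewrite le_eqVlt => /predU1P[->//|/(theta2_lt M l0)/ltW].
Qed.

End level_approximation.

Lemma slope_derivative_continuous (R : realType) (G c W f : R -> R) (lam : R) :
  continuous G -> continuous c -> continuous W -> slope_equation G c W lam f ->
  continuous (fun x => c x * (lam - W x - G (f x))).
Proof.
move=> Gc cc Wc df x; apply: cvgM; first exact: cc.
apply: cvgB; first by apply: cvgB; [exact: cvg_cst|exact: Wc].
by apply: (@continuous_comp _ _ _ f G); [exact: is_derive_continuous (df x)|exact: Gc].
Qed.

(** * Approximate correctors of a fixed realization, for every slope *)

Section correctors.
Variables (R : realType) (d : measure_display) (Omega : measurableType d).
Variables (P : probability Omega R) (tau : R -> Omega -> Omega) (beta : R).
Variables (G : R -> R) (a V : R -> Omega -> R).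
Let Gr p := G (- p).
Let ar x := a (- x).
Let Vr x := V (- x).
Hypothesis M2 : medium P tau beta G a V.
Hypothesis M1 : medium P (fun x => tau (- x)) beta Gr ar Vr.
Let th1 := theta1 P G a V beta.
Let th2 := theta2 P G a V beta.
Let Hb := Hbar P G a V beta.
Variable w : Omega.
Hypothesis lin2 : forall i j, sublinear (F2 G a V beta (grid_level beta i j) w) (th2 (grid_level beta i j)).
Hypothesis lin1 : forall i j, sublinear (F2 Gr ar Vr beta (grid_level beta i j) w)
  (theta2 P Gr ar Vr beta (grid_level beta i j)).
Hypothesis hills : forall h C : R, 0 < h < 1 -> 0 < C -> forall x0 r : R, 0 < r ->
  \forall e \near 0^'+, exists L1 L2, [/\ hill (fun x => (a x w)^-1) (V ^~ w) h C L1 L2,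
     (x0 - r) / e <= L1 & L2 <= (x0 + r) / e].

Let b0 : 0 < beta := medium_beta M2.
Let Gc : continuous G := locally_lipschitz_continuous (medium_lip M2).
Let cc : continuous (fun x => (a x w)^-1) := @medium_cinv_cont _ _ _ _ _ _ _ _ _ M2 w.
Let Wc : continuous (fun x => beta * V x w).
Proof. by move=> x; apply: cvgM; [exact: cvg_cst|exact: medium_V_cont M2 w x]. Qed.
Let a0 x : 0 < a x w. Proof. by have /andP[] := medium_a M2 x w. Qed.

Let lin1' i j : sublinear (F1 G a V beta (grid_level beta i j) w) (th1 (grid_level beta i j)).
Proof.
have bl : beta <= grid_level beta i j by rewrite lerDl divr_ge0.
move=> eta eta0; have [N HN] := lin1 i j eta0; exists N => x.
rewrite (F1_reflect M1 bl) /th1 (theta1_reflect M1 bl) mulNr -mulrN -[`|x|]normrN; exact: HN.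
Qed.

Let exact_corrector lam hb (F f : R -> R) th x0 eta M r :
  (forall y : R, is_derive y 1 F (f y)) ->
  slope_equation G (fun x => (a x w)^-1) (fun x => beta * V x w) lam f ->
  (forall y, `|f y| <= M) -> `|lam - hb| <= eta -> sublinear F th -> 0 < r ->
  near_corrector (a ^~ w) G (fun x => beta * V x w) hb th th x0 eta M r.
Proof.
move=> dF df fM lh HF r0.
refine (@near_corrector_exact _ (a ^~ w) G (fun x => beta * V x w) F f _ lam hb th x0 eta M r dF df
  (slope_derivative_continuous Gc cc Wc df) fM _ lh HF r0).
by move=> y; field; rewrite lt0r_neq0.
Qed.

(** Off the flat part one grid corrector serves as upper and lower corrector; [b] matters only on
    the flat part, where it selects the order of gluing. [M] comes before [r] because the grid level
    varies with [r] while the slope bound must not. *)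
Lemma medium_near_corrector p x0 (eta : R) : 0 < eta -> exists2 M : R, 0 <= M &
  forall r : R, 0 < r -> forall b : bool, exists thl thr : R,
    [/\ if b then thl <= p + r /\ p - r <= thr else p - r <= thl /\ thr <= p + r,
        `|thl| <= M, `|thr| <= M &
        near_corrector (a ^~ w) G (fun x => beta * V x w) (Hb p) thl thr x0 eta M r].
Proof.
move=> eta0.
have spec M := G2inv_spec (medium_lip M) (medium_G0 M) (medium_incr M) (medium_pinfty M).
rewrite /Hb; have [[lam [bl E ->]]|[lam [bl E ->]]|[p1 p2 ->]] := Hbar_cases M2 M1 p.
- have l0 : 0 <= lam by exact: le_trans (ltW b0) bl.
  exists (G2inv Gr lam); first by have [] := spec _ _ _ _ _ _ _ _ _ M1 lam l0.
  move=> r r0 b; have [i [j [g1 g2 g3 g4]]] := grid_approximation M1 bl eta0 r0.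
  set mu := grid_level beta i j in g1 g2 g3 g4.
  have qq : G2inv Gr mu <= G2inv Gr lam.
    apply: (G2inv_le (medium_lip M1) (medium_G0 M1) (medium_incr M1) (medium_pinfty M1)) => //.
    exact: le_trans (ltW b0) g1.
  have E' : `|th1 mu - p| <= r.
    rewrite -E /th1 !(theta1_reflect M1) // -opprD normrN; exact: g4.
  have tM : `|th1 mu| <= G2inv Gr lam.
    rewrite /th1 (theta1_reflect M1) // normrN.
    have /andP[h1 h2] := theta2_bound M1 g1.
    rewrite ger0_norm ?(le_trans h2) //; apply: le_trans h1.
    by have [] := spec _ _ _ _ _ _ _ _ _ M1 (mu - beta) (ltac:(rewrite subr_ge0; exact: g1)).
  exists (th1 mu), (th1 mu); split => //.
    by move: E'; rewrite ler_distl => /andP[h1 h2]; case: b.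
  have [dF df fE] := F1_slope M1 g1 w.
  apply: (exact_corrector x0 dF df _ g3 (lin1' i j) r0) => y.
  rewrite fE normrN ger0_norm ?(slope2_ge0 M1 g1) //.
  by have /andP[_ h] := slope2_bound M1 g1 w (- y); exact: le_trans h qq.
- have l0 : 0 <= lam by exact: le_trans (ltW b0) bl.
  exists (G2inv G lam); first by have [] := spec _ _ _ _ _ _ _ _ _ M2 lam l0.
  move=> r r0 b; have [i [j [g1 g2 g3 g4]]] := grid_approximation M2 bl eta0 r0.
  set mu := grid_level beta i j in g1 g2 g3 g4.
  have qq : G2inv G mu <= G2inv G lam.
    apply: (G2inv_le (medium_lip M2) (medium_G0 M2) (medium_incr M2) (medium_pinfty M2)) => //.
    exact: le_trans (ltW b0) g1.
  have E' : `|th2 mu - p| <= r by rewrite -E.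
  have tM : `|th2 mu| <= G2inv G lam.
    have /andP[h1 h2] := theta2_bound M2 g1.
    rewrite ger0_norm ?(le_trans h2) //; apply: le_trans h1.
    by have [] := spec _ _ _ _ _ _ _ _ _ M2 (mu - beta) (ltac:(rewrite subr_ge0; exact: g1)).
  exists (th2 mu), (th2 mu); split => //.
    by move: E'; rewrite ler_distl => /andP[h1 h2]; case: b.
  apply: (exact_corrector x0 (is_derive_F2 M2 g1 w) (slope2_equation M2 g1 w) _ g3 (lin2 i j) r0) => y.
  rewrite ger0_norm ?(slope2_ge0 M2 g1) //.
  by have /andP[_ h] := slope2_bound M2 g1 w y; exact: le_trans h qq.
have [dF1 df1 f1E] := F1_slope M1 (lexx beta) w.
have dF2 := is_derive_F2 M2 (lexx beta) w; have df2 := slope2_equation M2 (lexx beta) w.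
pose q1 := G2inv Gr beta; pose q2 := G2inv G beta.
have q10 : 0 <= q1 by have [] := spec _ _ _ _ _ _ _ _ _ M1 beta (ltW b0).
have q20 : 0 <= q2 by have [] := spec _ _ _ _ _ _ _ _ _ M2 beta (ltW b0).
pose M := q1 + q2.
have f1b x : - M <= derive1 (F1 G a V beta beta w) x <= 0.
  rewrite f1E lerN2 oppr_le0 (slope2_ge0 M1 (lexx beta)) andbT.
  by have /andP[_ h] := slope2_bound M1 (lexx beta) w (- x); apply: le_trans h _; rewrite lerDl.
have f2b x : 0 <= slope2 beta G a V beta w x <= M.
  rewrite (slope2_ge0 M2 (lexx beta)) /=.
  by have /andP[_ h] := slope2_bound M2 (lexx beta) w x; apply: le_trans h _; rewrite lerDr.
have n1 x : `|derive1 (F1 G a V beta beta w) x| <= M.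
  by have /andP[h1 h2] := f1b x; rewrite ler0_norm // lerNl.
have n2 x : `|slope2 beta G a V beta w x| <= M by have /andP[h1 h2] := f2b x; rewrite ger0_norm.
have Gs m : 0 < m -> exists2 t, 0 <= t & G t = m.
  by move=> /ltW /(spec _ _ _ _ _ _ _ _ _ M2)[h1 h2]; eexists; [exact: h1|exact: h2].
have Gs' m : 0 < m -> exists2 t, 0 <= t & G (- t) = m.
  by move=> /ltW /(spec _ _ _ _ _ _ _ _ _ M1)[h1 h2]; eexists; [exact: h1|exact: h2].
have Gd (u v : R) : u < v -> v <= 0 -> G v < G u.
  move=> uv v0; have := @medium_incr _ _ _ _ _ _ _ _ _ M1 (- v) (- u); rewrite /Gr !opprK; apply.
    by rewrite oppr_ge0.
  by rewrite ltrN2.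
have [h [C [h01 C0 glue]]] := flat_glue Gc (medium_G0 M2) (medium_incr M2) Gd Gs Gs'
  (fun x => medium_a M2 x w) cc (@medium_V_cont _ _ _ _ _ _ _ _ _ M2 w) b0 df1 df2 f1b f2b eta0.
(* The flat part uses the correctors at level exactly [beta], whose sublinearity is known because
   [beta] is on the grid. *)
have g0 : grid_level beta 0 0 = beta by rewrite /grid_level mul0r addr0.
have s1 : sublinear (F1 G a V beta beta w) (th1 beta) by have := lin1' 0 0; rewrite g0.
have s2 : sublinear (F2 G a V beta beta w) (th2 beta) by have := lin2 0 0; rewrite g0.
have t1 : `|th1 beta| <= M.
  rewrite /th1 (theta1_reflect M1) // normrN.
  have /andP[h1 h2] := theta2_bound M1 (lexx beta).
  rewrite ger0_norm; first by apply: le_trans h2 _; rewrite lerDl.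
  by apply: le_trans h1; have [] := spec _ _ _ _ _ _ _ _ _ M1 (beta - beta) (ltac:(rewrite subrr; done)).
have t2 : `|th2 beta| <= M.
  have /andP[h1 h2] := theta2_bound M2 (lexx beta).
  rewrite ger0_norm; first by apply: le_trans h2 _; rewrite lerDr.
  by apply: le_trans h1; have [] := spec _ _ _ _ _ _ _ _ _ M2 (beta - beta) (ltac:(rewrite subrr; done)).
exists M => [|r r0 b]; first exact: addr_ge0.
have glue_near r' : 0 < r' -> \forall e \near (0 : R)^'+, exists (L1 L2 : R) (f g : R -> R),
     [/\ [/\ (x0 - r') / e <= L1, L1 <= L2 & L2 <= (x0 + r') / e],
         forall y : R, is_derive y 1 f (g y) /\ `|f y| <= M, continuous g,
         forall y, `|a y w * g y + G (f y) + beta * V y w - beta| <= eta &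
         (forall y, y <= L1 -> f y = (if b then derive1 (F1 G a V beta beta w) else slope2 beta G a V beta w) y) /\
         (forall y, L2 <= y -> f y = (if b then slope2 beta G a V beta w else derive1 (F1 G a V beta beta w)) y)].
  move=> r'0; apply: filterS (hills h01 C0 x0 r'0) => e [L1 [L2 [hL e1 e2]]].
  have [f [g [h1 h2 h3 h4]]] := glue _ _ hL b.
  by exists L1, L2, f, g; split => //; split => //; have [] := hL.
case: b glue_near => glue_near.
  exists (th1 beta), (th2 beta); split => //.
    by rewrite (le_trans p1) ?lerDl ?(ltW r0) // lerBlDr (le_trans p2) ?lerDl ?ltW.
  exact: near_corrector_glued dF1 dF2 n1 n2 s1 s2 glue_near r0.
exists (th2 beta), (th1 beta); split => //.
  by rewrite lerBlDr (le_trans p2) ?lerDl ?(ltW r0) // (le_trans p1) ?lerDl ?ltW.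
exact: near_corrector_glued dF2 dF1 n2 n1 s2 s1 glue_near r0.
Qed.

End correctors.

Theorem corollary2p5 (R : realType) (d : measure_display)
    (Omega : measurableType d) (P : probability Omega R)
    (tau : R -> Omega -> Omega)
    (beta : R) (G : R -> R) (a V : R -> Omega -> R)
    (htau : measure_preserving_group P tau)
    (hergodic : ergodic P tau)
    (hbeta : 0 < beta)
    (hG_ge0 : forall p, 0 <= G p)
    (hG_lip : locally_lipschitz G)
    (hG_pinfty : G p @[p --> +oo] --> +oo)
    (hG_ninfty : G p @[p --> -oo] --> +oo)
    (hG0 : G 0 = 0)
    (hG_decr : forall p q : R, p < q -> q <= 0 -> G q < G p)
    (hG_incr : forall p q : R, 0 <= p -> p < q -> G p < G q)
    (ha_range : forall x w, 0 < a x w <= 1)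
    (hV_range : forall x w, 0 <= V x w <= 1)
    (ha_meas : measurable_fun setT (a 0))
    (hV_meas : measurable_fun setT (V 0))
    (ha_stat : stationary tau a)
    (hV_stat : stationary tau V)
    (hV_inf_sup : {ae P, forall w,
       inf (range (V ^~ w)) = 0 /\ sup (range (V ^~ w)) = 1})
    (ha_lip : forall w, [lipschitz Num.sqrt (a x w) | x in [set: R]])
    (hV_uc : forall w, unif_continuous (V ^~ w))
    (hhill : forall h C : R, 0 < h < 1 -> 0 < C ->
       {ae P, forall w, exists L1 L2 : R,
          [/\ L1 <= L2,
              (C%:E <= \int[lebesgue_measure]_(y in `[L1, L2])
                         ((a y w)^-1)%:E)%E &
              forall y : R, L1 <= y <= L2 -> h <= V y w]})
    (hwp : forall w, well_posed (a ^~ w) G (fun x => beta * V x w))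
    (hlip : forall (w : Omega) (theta : R) (u : R * R -> R),
       cauchy_solution (a ^~ w) G (fun x => beta * V x w)
         (fun x => theta * x) u ->
       exists2 ell : R, 0 < ell &
         forall t x y : R, 0 <= t -> `|u (t, x) - u (t, y)| <= ell * `|x - y|) :
  exists Omega0 : set Omega,
    [/\ measurable Omega0, P Omega0 = 1%E &
        forall (w : Omega) (g : R -> R), Omega0 w -> unif_continuous g ->
          exists (u : R -> R * R -> R) (ubar : R * R -> R),
            [/\ forall eps : R, 0 < eps ->
                  unique_cauchy_solution
                    (fun x => eps * a (x / eps) w) G
                    (fun x => beta * V (x / eps) w) g (u eps),
                unique_cauchy_solution
                  (fun=> 0) (Hbar P G a V beta) (fun=> 0) g ubar &
                {family compactly_in (@spacetime R),
                   u eps @[eps --> 0^'+] --> ubar}]].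

Proof.
(* The Lipschitz bound is on the square root, so [a] is recovered as its square. *)
have acont w : continuous (a ^~ w).
  have ll : locally_lipschitz (fun x => Num.sqrt (a x w)).
    by move=> p; exists setT; [exact: filterT|exact: ha_lip].
  have sc := locally_lipschitz_continuous ll.
  have -> : a ^~ w = fun x => Num.sqrt (a x w) * Num.sqrt (a x w).
    by apply/funext => x; rewrite -expr2 sqr_sqrtr //; have /andP[/ltW] := ha_range x w.
  by move=> x; apply: cvgM; exact: sc.
have vcont w : continuous (V ^~ w).
  move=> x; apply/cvgrPdist_lt => e e0.
  have [d0 d00 Hd] := (unif_continuousR (V ^~ w)).1 (hV_uc w) e e0.
  near=> y; apply: Hd; near: y; exact: (nbhsx_ballx x _ d00).
have M2 : medium P tau beta G a V by split.
have M1 := medium_reflect M2 hG_decr hG_ninfty.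
have Gc := locally_lipschitz_continuous hG_lip.
(* Heights increasing to [1] and integer lengths replace all pairs [(h, C)] by countably many; the
   shift [k.+2] keeps [hk 0] positive. *)
pose hk (k : nat) : R := 1 - k.+2%:R^-1.
have hk01 k : 0 < hk k < 1.
  have h0 : 0 < k.+2%:R^-1 :> R by rewrite invr_gt0 ltr0n.
  have h1 : k.+2%:R^-1 < 1 :> R by rewrite invf_lt1 ?ltr0n // ltr1n.
  by rewrite /hk; apply/andP; split; [rewrite subr_gt0|rewrite gtrBl].
have ccont w : continuous (fun x => (a x w)^-1) := @medium_cinv_cont _ _ _ _ _ _ _ _ _ M2 w.
have hillP k j : {ae P, forall w, forall x0 r : R, 0 < r -> \forall e \near 0^'+, exists L1 L2,
     [/\ hill (fun x => (a x w)^-1) (V ^~ w) (hk k) (j.+1%:R) L1 L2, (x0 - r) / e <= L1 & L2 <= (x0 + r) / e]}.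
  have j0 : 0 < j.+1%:R :> R by rewrite ltr0n.
  have j1 : 0 < j.+1%:R + 1 :> R by rewrite addr_gt0.
  apply: (hill_density M2 hergodic j0).
  apply: filterS (hhill _ _ (hk01 k) j1) => w [L1 [L2 [L12 HC HV]]]; exists L1, L2; split => //.
  (* A degenerate interval has zero integral, which cannot reach a positive length. *)
  move: L12 HC; rewrite le_eqVlt => /predU1P[->|L12].
    by rewrite set_itv1 integral_set1 lee_fin leNgt j1.
  by rewrite (integral_prim (@ccont w) L12) lee_fin.
have [N [mN PN HN]] : {ae P, forall w,
    [/\ forall i j : nat, sublinear (F2 G a V beta (grid_level beta i j) w) (theta2 P G a V beta (grid_level beta i j)),
        forall i j : nat, sublinear (F2 (fun p => G (- p)) (fun x => a (- x)) (fun x => V (- x)) beta (grid_level beta i j) w)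
           (theta2 P (fun p => G (- p)) (fun x => a (- x)) (fun x => V (- x)) beta (grid_level beta i j)) &
        forall k j : nat, forall x0 r : R, 0 < r -> \forall e \near 0^'+, exists L1 L2,
     [/\ hill (fun x => (a x w)^-1) (V ^~ w) (hk k) (j.+1%:R) L1 L2, (x0 - r) / e <= L1 & L2 <= (x0 + r) / e]]}.
  have A1 := grid_sublinear M2 hergodic; have A2 := grid_sublinear M1 (ergodic_opp hergodic).
  have A3 := ae_foralln (fun k => ae_foralln (hillP k)).
  by apply: filterS3 A1 A2 A3 => w.
(* The almost sure statement comes with a measurable null set, whose complement is the required
   event; it is independent of [g]. *)
exists (~` N); split; first exact: measurableC.
  by rewrite probability_setC // PN sube0.
move=> w g Nw ug.
have [lin2 lin1 hills] : [/\ forall i j : nat, sublinear (F2 G a V beta (grid_level beta i j) w) (theta2 P G a V beta (grid_level beta i j)),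
        forall i j : nat, sublinear (F2 (fun p => G (- p)) (fun x => a (- x)) (fun x => V (- x)) beta (grid_level beta i j) w)
           (theta2 P (fun p => G (- p)) (fun x => a (- x)) (fun x => V (- x)) beta (grid_level beta i j)) &
        forall k j : nat, forall x0 r : R, 0 < r -> \forall e \near 0^'+, exists L1 L2,
     [/\ hill (fun x => (a x w)^-1) (V ^~ w) (hk k) (j.+1%:R) L1 L2, (x0 - r) / e <= L1 & L2 <= (x0 + r) / e]].
  by apply: contrapT => h; apply: Nw; exact: HN.
(* A higher and longer hill is also a hill for [(h, C)], so the countable family is enough. *)
have hills' (h C : R) : 0 < h < 1 -> 0 < C -> forall x0 r : R, 0 < r ->
  \forall e \near 0^'+, exists L1 L2, [/\ hill (fun x => (a x w)^-1) (V ^~ w) h C L1 L2,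
     (x0 - r) / e <= L1 & L2 <= (x0 + r) / e].
  move=> /andP[h0 h1] C0 x0 r r0.
  have h1' : 0 < 1 - h by rewrite subr_gt0.
  pose k := Num.truncn (1 - h)^-1; pose j := Num.truncn C.
  have hh : h <= hk k.
    rewrite /hk lerBrDl -lerBrDr invf_ple ?posrE ?ltr0n //.
    by apply: le_trans (ltW (truncnS_gt _)) _; rewrite ler_nat.
  have CC : C <= j.+1%:R by exact/ltW/truncnS_gt.
  apply: filterS (hills k j x0 r r0) => e [L1 [L2 [[q1 q2 q3] q4 q5]]]; exists L1, L2; split => //.
  by split => // [|y yL]; [exact: le_trans q2|exact: le_trans (q3 y yL)].
have key := medium_near_corrector M2 M1 lin2 lin1 hills'.
apply: (@homogenization R (a ^~ w) G (fun x => beta * V x w) (Hbar P G a V beta) beta _ Gc _ _ _ _ (hwp w) g ug).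
- by move=> x; have /andP[h1 h2] := ha_range x w; rewrite (ltW h1).
- move=> x; have /andP[h1 h2] := hV_range x w.
  by rewrite ger0_norm ?mulr_ge0 // ?(ltW hbeta) // ler_piMr // ltW.
- exact: Hbar_continuous M2 M1.
- move=> p x0; apply: near_corrector_upper => eta eta0; have [M M0 HM] := key p x0 eta eta0.
  exists M => // r r0; have [thl [thr [[h1 h2] h3 h4 h5]]] := HM r r0 true.
  by exists thl, thr.
(* The equation of [- u] tests the slope [- p] of the original one, with the opposite order of
   gluing. *)
- move=> p x0.
  have := @near_corrector_lower R (a ^~ w) G (fun x => beta * V x w) (Hbar P G a V beta (- p)) (- p) x0.
  rewrite opprK; apply => eta eta0; have [M M0 HM] := key (- p) x0 eta eta0.
  exists M => // r r0; have [thl [thr [[h1 h2] h3 h4 h5]]] := HM r r0 false.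
  by exists thl, thr.
Unshelve. all: by end_near. Qed.
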